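(* Assume that $\mathfrak g$ and $\mathfrak r$ have equal rank. Let $V$ be a $(\mathfrak g,\mathfrak r)$-module, and let $I(V)=H(V)^+-H(V)^-$ be its higher Dirac index. Then $$I(V)=V\otimes S^+-V\otimes S^-$$ as virtual $\mathfrak r$-modules.
   Context: Setting. $\mathfrak g$ is a complex reductive Lie algebra with a nondegenerate invariant symmetric bilinear form $B$, $\mathfrak r\subset\mathfrak g$ is a reductive subalgebra with $B|_{\mathfrak r\times\mathfrak r}$ nondegenerate, and $\mathfrak s=\mathfrak r^{\perp}$, so $\mathfrak g=\mathfrak r\oplus\mathfrak s$. $C(\mathfrak s)$ is the Clifford algebra of $\mathfrak s$ with relations $xy+yx=-2B(x,y)$, identified as a vector space with $\bigwedge(\mathfrak s)$ by Chevalley's antisymmetrization map. Dirac operator. If $b_i$ and $d_i$ are bases of $\mathfrak s$ dual with respect to $B$, Kostant's cubic Dirac operator is $$D=\sum_i b_i\otimes d_i+\frac12\sum_{i<j<k}B([b_i,b_j],b_k)\,1\otimes (d_i\wedge d_j\wedge d_k)\in U(\mathfrak g)\otimes C(\mathfrak s).$$ $(\mathfrak g,\mathfrak r)$-modules. A $(\mathfrak g,\mathfrak r)$-module means a $\mathfrak g$-module $V$ of finite length, whose restriction to $\mathfrak r$ is a direct sum of finite-dimensional irreducible $\mathfrak r$-modules with finite multiplicities, and which is a direct sum of submodules with generalized infinitesimal character. ($W$ has generalized infinitesimal character $\chi:Z(\mathfrak g)\to\mathbb C$ if there is $N\in\mathbb N$ such that $(z-\chi(z))^N=0$ on $W$ for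 all $z$ in the center $Z(\mathfrak g)$ of $U(\mathfrak g)$.) Spin module in the equal rank case. Let $\mathfrak h$ be a common Cartan subalgebra of $\mathfrak g$ and $\mathfrak r$ and fix compatible positive roots $\Delta^+(\mathfrak g,\mathfrak h)\supset\Delta^+(\mathfrak r,\mathfrak h)$. Let $\mathfrak s^+$ be the span of the positive root spaces of $\mathfrak g$ not in $\mathfrak r$. The spin module is $S=\bigwedge(\mathfrak s^+)$ (the simple $C(\mathfrak s)$-module on which $\mathfrak s^+$ acts by exterior multiplication and the span of the opposite root spaces annihilates $1$), and $S^+=\bigwedge^{even}(\mathfrak s^+)$, $S^-=\bigwedge^{odd}(\mathfrak s^+)$. The Lie algebra $\mathfrak r$ acts on $S$ and $S^\pm$ via the Lie algebra map $\alpha:\mathfrak r\to\mathfrak{so}(\mathfrak s)\cong\bigwedge^2(\mathfrak s)\hookrightarrow C(\mathfrak s)$ with $[\alpha(X),v]=[X,v]$ for $v\in\mathfrak s$, and on $V\otimes S$ by $X\otimes1+1\otimes\alpha(X)$. $D$ acts on $V\otimes S$, commutes with $\mathfrak r$, and interchanges $V\otimes S^+$ and $V\otimes S^-$. Higher Dirac cohomology and index. For an integer $k\ge 0$, $H^k(V)=(\operatorname{Im}D^{2k}\cap\operatorname{Ker}D)/(\operatorname{Im}D^{2k+1}\cap\operatorname{Ker}D)$ (for $D$ acting on $V\otimes S$), and $H(V)=\bigoplus_{k\ge0}H^k(V)$. The decomposition $V\otimes S=V\otimes S^+\oplus V\otimes S^-$ induces a decomposition of $\mathfrak r$-modules $H(V)=H(V)^+\oplus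 H(V)^-$. A virtual $\mathfrak r$-module is an element of the Grothendieck group of the category of semisimple admissible $\mathfrak r$-modules (direct sums of finite-dimensional irreducible $\mathfrak r$-modules with finite multiplicities). *)

(* Defs.v *)
(* Lie algebras are finite-dimensional; modules over them may be infinite-dimensional. *)
From HB Require Import structures.
From mathcomp Require Import all_boot all_order all_fingroup all_algebra all_field.
From mathcomp Require Import generic_quotient ring_quotient sesquilinear.
From mathcomp Require Import boolp classical_sets functions cardinality reals.
From mathcomp Require Import complex.

Set Implicit Arguments.
Unset Strict Implicit.
Unset Printing Implicit Defensive.

Import GRing.Theory Num.Theory Quotient.

Local Open Scope ring_scope.
Local Open Scope quotient_scope.
Local Open Scope classical_set_scope.

HB.mixin Record Vector_isLie (K : fieldType) (L : Type) of Vector K L := {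
  lie : L -> L -> L;
  lie_is_linearl : forall a x y z,
    lie (a *: x + y) z = a *: lie x z + lie y z;
  lie_is_linearr : forall a x y z,
    lie z (a *: x + y) = a *: lie z x + lie z y;
  liexx : forall x, lie x x = 0;
  lie_jacobi : forall x y z,
    lie x (lie y z) + lie y (lie z x) + lie z (lie x y) = 0
}.

#[short(type="lieAlgType")]
HB.structure Definition LieAlgebra (K : fieldType) :=
  { L of Vector_isLie K L & Vector K L }.

Notation "''L[' x , y ]" := (lie x y) (at level 0, x, y at level 99,
  format "''L[' x ,  y ]") : ring_scope.

HB.instance Definition _ (K : fieldType) (g : lieAlgType K) (x : g) :=
  GRing.isLinear.Build K g g _ (lie x) (fun a y z => lie_is_linearr a y z x).

Section Subalgebras.
Variables (K : fieldType) (g : lieAlgType K).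
Implicit Types (x y : g) (r h I J : {vspace g}).

Definition lie_closed r := {in r &, forall x y, 'L[x, y] \in r}.

Definition ideal_of r I := (I <= r)%VS /\ {in r & I, forall x y, 'L[x, y] \in I}.

Definition reductive r := forall I, ideal_of r I ->
  exists J, [/\ ideal_of r J, (I + J = r)%VS & (I :&: J = 0)%VS].

Definition lie_prod r h : {vspace g} :=
  <<[seq 'L[x, y] | x <- vbasis r, y <- vbasis h]>>%VS.

Definition nilpotent_lie h := exists n, iter n (lie_prod h) h = 0%VS.

Definition cartan_subalgebra r h :=
  [/\ (h <= r)%VS, lie_closed h, nilpotent_lie h &
      forall x, x \in r -> {in h, forall y, 'L[x, y] \in h} -> x \in h].

End Subalgebras.

Record lieSubalg (K : fieldType) (g : lieAlgType K) := LieSubalg {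
  lsubalg_vspace :> {vspace g};
  lsubalgP : lie_closed lsubalg_vspace
}.

Section SubLie.
Variables (K : fieldType) (g : lieAlgType K) (r : lieSubalg g).
Implicit Types x y z : subvs_of r.

Definition sub_lie x y : subvs_of r := vsproj r 'L[vsval x, vsval y].

Lemma vsval_sub_lie x y : vsval (sub_lie x y) = 'L[vsval x, vsval y].
Proof. by rewrite vsprojK// lsubalgP ?subvsP. Qed.

Let sub_lie_linearl a x y z :
  sub_lie (a *: x + y) z = a *: sub_lie x z + sub_lie y z.
Proof.
by apply: val_inj; rewrite linearP/= !vsval_sub_lie linearP lie_is_linearl.
Qed.

Let sub_lie_linearr a x y z :
  sub_lie z (a *: x + y) = a *: sub_lie z x + sub_lie z y.
Proof.
by apply: val_inj; rewrite /= vsval_sub_lie !linearP/= !vsval_sub_lie.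
Qed.

Let sub_liexx x : sub_lie x x = 0.
Proof. by apply: val_inj => /=; rewrite vsval_sub_lie liexx. Qed.

Let sub_lie_jacobi x y z :
  sub_lie x (sub_lie y z) + sub_lie y (sub_lie z x) + sub_lie z (sub_lie x y)
    = 0.
Proof. by apply: val_inj => /=; rewrite !vsval_sub_lie lie_jacobi. Qed.

HB.instance Definition _ := Vector_isLie.Build K (subvs_of r)
  sub_lie_linearl sub_lie_linearr sub_liexx sub_lie_jacobi.

End SubLie.

Section Roots.
Variables (K : fieldType) (g : lieAlgType K) (h : {vspace g}).

Notation weight := 'Hom(subvs_of h, K^o).
Implicit Types a b : weight.

Definition root_space a : {vspace g} :=
  (\bigcap_(t <- vbasis h) passmx.leigenspace (linfun (lie t)) (a (vsproj h t)))%VS.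

Definition is_root a := (a != 0) && (root_space a != 0%VS).

Definition positive_system (P : seq weight) :=
  [/\ {in P, forall a, is_root a},
      forall a, is_root a -> (a \in P) = (- a \notin P) &
      {in P &, forall a b, is_root (a + b) -> a + b \in P}].

Variables (P : seq weight) (r : {vspace g}).

(* For a common Cartan subalgebra [h] of [g] and [r], root spaces are lines, so *)
(* those that meet [r] trivially are those that are not contained in [r].       *)
Definition splus : {vspace g} :=
  (\sum_(a <- P | (root_space a :&: r == 0)%VS) root_space a)%VS.

Definition sminus : {vspace g} :=
  (\sum_(a <- P | (root_space a :&: r == 0)%VS) root_space (- a))%VS.

End Roots.

Section UniversalAlgebras.
Variable K : fieldType.

Definition universal (W : lmodType K)
    (rel : forall A : algType K, {linear W -> A} -> Prop)
    (A : algType K) (i : {linear W -> A}) :=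
  rel A i /\
  forall (A' : algType K) (f : {linear W -> A'}), rel A' f ->
    exists F : {lrmorphism A -> A'}, F \o i =1 f /\
      forall F' : {lrmorphism A -> A'}, F' \o i =1 f -> F' =1 F.

Definition lie_rel (g : lieAlgType K) (A : algType K) (f : {linear g -> A}) :=
  forall x y, f 'L[x, y] = f x * f y - f y * f x.

Definition clifford_rel (W : lmodType K) (form : W -> W -> K)
    (A : algType K) (f : {linear W -> A}) :=
  forall x y, f x * f y + f y * f x = (- 2%:R * form x y)%:A.

Definition exterior_rel (W : lmodType K) (A : algType K)
    (f : {linear W -> A}) :=
  forall x, f x * f x = 0.

(* The algebras U(g), C(W) and /\(W), known up to unique isomorphism. *)
Record envelopingAlg (g : lieAlgType K) := EnvelopingAlg {
  env_alg :> algType K;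
  env_in : {linear g -> env_alg};
  env_universal : universal (@lie_rel g) env_in
}.

Record cliffordAlg (W : vectType K) (form : W -> W -> K) := CliffordAlg {
  cliff_alg :> falgType K;
  cliff_in : {linear W -> cliff_alg};
  cliff_universal : universal (clifford_rel form) cliff_in
}.

Record exteriorAlg (W : vectType K) := ExteriorAlg {
  ext_alg :> falgType K;
  ext_in : {linear W -> ext_alg};
  ext_universal : universal (@exterior_rel W) ext_in
}.

Definition ext_parity (W : vectType K) (E : exteriorAlg W) (odd_part : bool) :
    {vspace E} :=
  (\sum_(k < (\dim {:W}).+1 | odd k == odd_part)
     limg (linfun (ext_in E)) ^+ k)%VS.

Section Chevalley.
Variables (W : vectType K) (form : W -> W -> K) (C : cliffordAlg form).

Definition chevalley k (x : k.-tuple W) : C :=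
  k`!%:R^-1 *: \sum_(s : 'S_k) (-1) ^+ s *: \prod_(i < k) cliff_in C (tnth x (s i)).

Definition in_wedge2 (c : C) :=
  exists (n : nat) (x y : 'I_n -> W), c = \sum_(i < n) chevalley [tuple x i; y i].

End Chevalley.
End UniversalAlgebras.

Arguments env_in {K g} _.
Arguments cliff_in {K W form} _.
Arguments ext_in {K W} _.

Record algModule (K : fieldType) (A : algType K) (M : lmodType K) := AlgModule {
  algm_act :> {bilinear A -> M -> M};
  algm_act1 : forall u, algm_act 1 u = u;
  algm_actM : forall a b u, algm_act (a * b) u = algm_act a (algm_act b u)
}.

(* [V (x) S] for finite-dimensional [S]: [t] stands for the sum of the *)
(* [t i (x) e_i], where [e] is [vbasis {:S}].                          *)
Definition tensor (K : fieldType) (V : lmodType K) (S : vectType K) :=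
  {ffun 'I_(\dim {:S}) -> V}.

Section Tensor.
Variables (K : fieldType).

HB.instance Definition _ (V : lmodType K) (S : vectType K) :=
  GRing.Lmodule.on (tensor V S).

Definition tens (V : lmodType K) (S : vectType K) (v : V) (s : S) : tensor V S :=
  [ffun i => coord (vbasis {:S}) i s *: v].

Definition tens_sub (V : lmodType K) (S : vectType K) (W : {vspace S}) :
    set (tensor V S) :=
  [set t | exists (n : nat) (v : 'I_n -> V) (s : 'I_n -> S),
     (forall i, s i \in W) /\ t = \sum_(i < n) tens (v i) (s i)].

Variables (A : algType K) (C : falgType K) (V : lmodType K) (S : vectType K).
Variables (aV : algModule A V) (cS : algModule C S).

Definition tensor_act (w : tensor A C) (t : tensor V S) : tensor V S :=
  \sum_i \sum_j
    tens (aV (w i) (t j)) (cS (vbasis {:C})`_i (vbasis {:S})`_j).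

Lemma tensor_act_is_linear w : linear (tensor_act w).
Proof.
move=> a t u; rewrite /tensor_act scaler_sumr -big_split; apply: eq_bigr => i _.
rewrite scaler_sumr -big_split; apply: eq_bigr => j _.
apply/ffunP => k; rewrite !ffunE linearPr/= scalerDr !scalerA.
by rewrite [_ * a]mulrC.
Qed.

HB.instance Definition _ w :=
  GRing.isLinear.Build K (tensor V S) (tensor V S) _ (tensor_act w)
    (tensor_act_is_linear w).

End Tensor.

(* An [L]-module is given by a subspace of an ambient space, together with *)
(* operators on the latter that preserve it; see [is_module].              *)
Record premodule (K : fieldType) (L : lieAlgType K) := Premodule {
  ambient :> lmodType K;
  action : L -> ambient -> ambient;
  carrier : set ambient
}.

Arguments Premodule {K L} ambient action carrier.
Arguments action {K L} p.
Arguments carrier {K L} p.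

Section Modules.
Variables (K : fieldType) (L : lieAlgType K).
Implicit Types M N X : premodule L.

Definition is_subspace (T : lmodType K) (W : set T) :=
  W 0 /\ forall a u v, W u -> W v -> W (a *: u + v).

Definition linear_on (T T' : lmodType K) (W : set T) (f : T -> T') :=
  forall a u v, W u -> W v -> f (a *: u + v) = a *: f u + f v.

Definition is_submodule M (W : set M) :=
  [/\ is_subspace W, W `<=` carrier M & forall x u, W u -> W (action M x u)].

Definition is_module M :=
  [/\ is_submodule (carrier M),
      forall x, linear_on (carrier M) (action M x),
      forall u, carrier M u -> linear (action M ^~ u) &
      forall x y u, carrier M u -> action M 'L[x, y] u =
        action M x (action M y u) - action M y (action M x u)].

Definition submodule M (W : set M) : premodule L := Premodule M (action M) W.

Definition irreducible M := carrier M <> [set 0] /\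
  forall W : set M, is_submodule W -> W = [set 0] \/ W = carrier M.

Definition finite_dim M := exists (n : nat) (e : 'I_n -> M),
  carrier M = range (fun c : 'I_n -> K => \sum_(i < n) c i *: e i).

Definition isomorphic M N := exists f : M -> N,
  [/\ linear_on (carrier M) f, set_bij (carrier M) (carrier N) f &
      forall x u, carrier M u -> f (action M x u) = action N x (f u)].

Definition direct_sum M (I : choiceType) (F : I -> set M) :=
  [/\ forall i, is_submodule (F i),
      forall u, carrier M u -> exists (s : seq I) (w : I -> M),
        (forall i, F i (w i)) /\ u = \sum_(i <- s) w i &
      forall (s : seq I) (w : I -> M), uniq s -> (forall i, F i (w i)) ->
        \sum_(i <- s) w i = 0 -> {in s, forall i, w i = 0}].

Definition semisimple_admissible M := is_module M /\
  exists (I : choiceType) (F : I -> set M),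
    [/\ direct_sum F,
        forall i, irreducible (submodule (F i)) /\ finite_dim (submodule (F i)) &
        forall i, finite_set
          [set j | isomorphic (submodule (F i)) (submodule (F j))]].

Definition finite_length M := exists (n : nat) (F : nat -> set M),
  [/\ F 0%N = [set 0], F n = carrier M,
      forall i, (i <= n)%N -> is_submodule (F i) &
      forall i, (i < n)%N -> [/\ F i `<=` F i.+1, F i <> F i.+1 &
        forall W : set M, is_submodule W -> F i `<=` W -> W `<=` F i.+1 ->
          W = F i \/ W = F i.+1]].

Definition dsum M N : premodule L := Premodule (M * N)%type
  (fun x u => (action M x u.1, action N x u.2))
  [set u | carrier M u.1 /\ carrier N u.2].

(* Equality of [M] - [N] and [M'] - [N'] in the Grothendieck group; as short *)
(* exact sequences of semisimple modules split, that group is the group      *)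
(* completion of the monoid of isomorphism classes.                          *)
Definition virtual_eq M N M' N' := exists X, semisimple_admissible X /\
  isomorphic (dsum (dsum M N') X) (dsum (dsum M' N) X).

End Modules.

Arguments is_submodule {K L M} W.
Arguments submodule {K L M} W.
Arguments direct_sum {K L M I} F.

Definition res (K : fieldType) (g : lieAlgType K) (r : lieSubalg g)
    (M : premodule g) : premodule (subvs_of r : lieAlgType K) :=
  Premodule M (fun x => action M (vsval x)) (carrier M).

Section GRModules.
Variables (K : fieldType) (g : lieAlgType K) (U : envelopingAlg g).

(* Only the values of [chi] on the center of U(g) matter; if [W] is nonzero, the *)
(* condition forces [chi] to be an algebra morphism there.                       *)
Definition generalized_inf_char (V : lmodType K) (uV : algModule U V)
    (chi : U -> K) (W : set V) :=
  exists N : nat, forall z : U, (forall u, z * u = u * z) ->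
    forall w, W w -> uV ((z - (chi z)%:A) ^+ N) w = 0.

(* [uV] is the extension of the action of [g] to U(g). *)
Definition gr_module (r : lieSubalg g) (V : lmodType K) (piV : g -> V -> V)
    (uV : algModule U V) :=
  let M := Premodule V piV [set: V] in
  [/\ is_module M,
      forall x v, uV (env_in U x) v = piV x v,
      finite_length M,
      semisimple_admissible (res r M) &
      exists (I : choiceType) (F : I -> set M), direct_sum F /\
        forall i, exists chi : U -> K, generalized_inf_char uV chi (F i)].

End GRModules.

Section Product.
Variables (K : fieldType) (M : nat -> lmodType K).

Definition prodmod := forall k, M k.

HB.instance Definition _ := gen_eqMixin prodmod.
HB.instance Definition _ := gen_choiceMixin prodmod.

Implicit Types f g h : prodmod.

Let padd f g : prodmod := fun k => f k + g k.
Let popp f : prodmod := fun k => - f k.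
Let pscale a f : prodmod := fun k => a *: f k.

Let paddA : associative padd.
Proof. by move=> f g h; apply: functional_extensionality_dep => k; apply: addrA. Qed.
Let paddC : commutative padd.
Proof. by move=> f g; apply: functional_extensionality_dep => k; apply: addrC. Qed.
Let padd0 : left_id ((fun k => 0) : prodmod) padd.
Proof. by move=> f; apply: functional_extensionality_dep => k; apply: add0r. Qed.
Let paddN : left_inverse ((fun k => 0) : prodmod) popp padd.
Proof. by move=> f; apply: functional_extensionality_dep => k; apply: addNr. Qed.

HB.instance Definition _ := GRing.isZmodule.Build prodmod paddA paddC padd0 paddN.

Let pscaleA a b f : pscale a (pscale b f) = pscale (a * b) f.
Proof. by apply: functional_extensionality_dep => k; apply: scalerA. Qed.
Let pscale1 : left_id 1 pscale.
Proof. by move=> f; apply: functional_extensionality_dep => k; apply: scale1r. Qed.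
Let pscaleDr : right_distributive pscale +%R.
Proof. by move=> a f g; apply: functional_extensionality_dep => k; apply: scalerDr. Qed.
Let pscaleDl f : {morph pscale^~ f : a b / a + b}.
Proof. by move=> a b; apply: functional_extensionality_dep => k; apply: scalerDl. Qed.

HB.instance Definition _ := GRing.Zmodule_isLmodule.Build K prodmod
  pscaleA pscale1 pscaleDr pscaleDl.

End Product.

Section ImKer.
Variables (K : fieldType) (T : lmodType K) (D : {linear T -> T}) (n : nat).

Definition imker : {pred T} := [pred t | `[< exists u, iter n D u = t >] & D t == 0].

Lemma imker_submod_closed : submod_closed imker.
Proof.
have iterP a u v : iter n D (a *: u + v) = a *: iter n D u + iter n D v.
  by elim: n => //= m ->; rewrite linearP.
split=> [|a _ _ /andP[/asboolP[u <-] /eqP Du] /andP[/asboolP[v <-] /eqP Dv]].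
  apply/andP; split; last by rewrite linear0.
  by apply/asboolP; exists (0 *: 0 + (-1) *: 0); rewrite !scaler0 addr0; elim: n => //= m ->; rewrite linear0.
apply/andP; split; last by rewrite linearP Du Dv scaler0 addr0.
by apply/asboolP; exists (a *: u + v); rewrite iterP.
Qed.

HB.instance Definition _ := GRing.isSubmodClosed.Build K T imker imker_submod_closed.

End ImKer.

Section QuotientModule.
Variables (K : fieldType) (T : lmodType K) (D : {linear T -> T}) (n : nat).

Notation I := (imker D n).

Definition quot_scale (a : K) (q : {quot I}) : {quot I} := \pi_{quot I} (a *: repr q).

Lemma quot_scale_pi a t : quot_scale a (\pi_{quot I} t) = \pi_{quot I} (a *: t).
Proof.
apply/eqP; rewrite -idealrBE -scalerBr; apply: (@rpredZ _ _ I).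
by rewrite idealrBE reprK eqxx.
Qed.

Lemma quot_add_pi t u :
  \pi_{quot I} t + \pi_{quot I} u = \pi_{quot I} (t + u).
Proof. exact/esym/pi_add. Qed.

Let quot_scaleA a b q : quot_scale a (quot_scale b q) = quot_scale (a * b) q.
Proof. by rewrite -[q]reprK (quot_scale_pi b) !quot_scale_pi scalerA. Qed.

Let quot_scale1 : left_id 1 quot_scale.
Proof. by move=> q; rewrite -[q]reprK quot_scale_pi scale1r. Qed.

Let quot_scaleDr : right_distributive quot_scale +%R.
Proof.
move=> a p q; rewrite -[p]reprK -[q]reprK.
by rewrite quot_add_pi !quot_scale_pi scalerDr -quot_add_pi.
Qed.

Let quot_scaleDl q : {morph quot_scale^~ q : a b / a + b}.
Proof.
by move=> a b; rewrite -[q]reprK !quot_scale_pi scalerDl -quot_add_pi.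
Qed.

HB.instance Definition _ := GRing.Zmodule_isLmodule.Build K {quot I}
  quot_scaleA quot_scale1 quot_scaleDr quot_scaleDl.

End QuotientModule.

(* For an endomorphism [D] of [T] commuting with an action of [L] on [T], the *)
(* part of the direct sum over [k] of the spaces                              *)
(*   (Im D^2k `&` Ker D) / (Im D^(2k+1) `&` Ker D)                            *)
(* that consists of the classes having representatives in [P].                *)
Definition higher_cohomology (K : fieldType) (L : lieAlgType K) (T : lmodType K)
    (act : L -> T -> T) (D : {linear T -> T}) (P : set T) : premodule L :=
  Premodule (prodmod (fun k => {quot (imker D k.*2.+1)}))
    (fun x c k => \pi_{quot (imker D k.*2.+1)} (act x (repr (c k))))
    [set c | (exists N, forall k, (N <= k)%N -> c k = 0) /\
       forall k, exists t, [/\ t \in imker D k.*2, P t & c k = \pi_{quot (imker D k.*2.+1)} t]].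

Section Dirac.
Variables (K : fieldType) (g : lieAlgType K) (B : {symmetric g}).
Variable r : lieSubalg g.

Definition invariant_form := forall x y z, B 'L[x, y] z = B x 'L[y, z].

Definition rperp : {vspace g} := orthov B r.

Definition rperp_form (x y : subvs_of rperp) : K := B (vsval x) (vsval y).

Definition dual_bases (b d : 'I_(\dim rperp) -> subvs_of rperp) :=
  [/\ basis_of fullv [seq b i | i : 'I_(\dim rperp)],
      basis_of fullv [seq d i | i : 'I_(\dim rperp)] &
      forall i j, rperp_form (b i) (d j) = (i == j)%:R].

Variables (U : envelopingAlg g) (C : cliffordAlg rperp_form).

Definition dirac (b d : 'I_(\dim rperp) -> subvs_of rperp) : tensor U C :=
  \sum_i tens (env_in U (vsval (b i))) (cliff_in C (d i)) +
  2%:R^-1 *: \sum_(i < \dim rperp) \sum_(j < \dim rperp | (i < j)%N)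
    \sum_(k < \dim rperp | (j < k)%N)
    B 'L[vsval (b i), vsval (b j)] (vsval (b k)) *:
      tens 1 (chevalley C [tuple d i; d j; d k]).

(* The conditions determine [alpha]. *)
Definition is_alpha (alpha : {linear subvs_of r -> C}) :=
  [/\ lie_rel alpha,
      forall x, in_wedge2 (alpha x) &
      forall x v, alpha x * cliff_in C v - cliff_in C v * alpha x =
        cliff_in C (vsproj rperp 'L[vsval x, vsval v])].

Section Spin.
Variables (h : {vspace g}) (P : seq 'Hom(subvs_of h, K^o)).
Variable E : exteriorAlg (subvs_of (splus P r)).

(* The conditions determine [cS], as [rperp] is the sum of [splus] and [sminus]. *)
Definition is_spin_module (cS : algModule C E) :=
  (forall (x : subvs_of (splus P r)) w,
     cS (cliff_in C (vsproj rperp (vsval x))) w = ext_in E x * w) /\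
  (forall y, y \in sminus P r -> cS (cliff_in C (vsproj rperp y)) 1 = 0).

End Spin.

Variables (V : lmodType K) (uV : algModule U V).
Variables (S : vectType K) (cS : algModule C S).
Variables (alpha : {linear subvs_of r -> C}).

Definition diag_act (x : subvs_of r) : tensor V S -> tensor V S :=
  tensor_act uV cS (tens (env_in U (vsval x)) 1 + tens 1 (alpha x)).

Definition tensor_module (W : {vspace S}) : premodule (subvs_of r : lieAlgType K) :=
  Premodule (tensor V S) diag_act (tens_sub W).

Definition dirac_cohomology (b d : 'I_(\dim rperp) -> subvs_of rperp)
    (W : {vspace S}) : premodule (subvs_of r : lieAlgType K) :=
  higher_cohomology diag_act (tensor_act uV cS (dirac b d)) (tens_sub W).

End Dirac.

(* Main.v *)
(* D commutes with r and exchanges the two parity halves of V (x) S, both of which are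
   semisimple admissible. On the isotypic component of type c it is therefore given by a
   pair of finite matrices X : T+_c -> T-_c and Y : T-_c -> T+_c between the multiplicity
   spaces, and H^k(V) is computed by ranks of words in X and Y. Summing over k telescopes,
   by rank-nullity, to
     dim H(V)+_c - dim H(V)-_c = dim T+_c - dim T-_c ;
   the ranks of (XY)^k and (YX)^k that remain agree as soon as k exceeds both sizes.
   What has to be built is the decomposition of V (x) S+-: weight theory and Whitehead's
   lemma give complete reducibility of the finite dimensional r-modules on which the
   centre acts diagonally, and E* (x) c has only finitely many types, each of finite
   multiplicity in V. The parity of S and its compatibility with D come from the sign
   automorphism of the exterior algebra. *)
Require Import Defs.
From HB Require Import structures.
From mathcomp Require Import all_boot all_order all_fingroup all_algebra all_field.
From mathcomp Require Import generic_quotient ring_quotient sesquilinear boolp classical_sets functions cardinality reals.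
From mathcomp Require Import complex.
From mathcomp Require Import ring zify.
(* Again, since [action] and other names are shadowed by the imports above. *)
Import Defs.

Set Implicit Arguments.
Unset Strict Implicit.
Unset Printing Implicit Defensive.

Import GRing.Theory Num.Theory VectorInternalTheory.

Local Open Scope ring_scope.

(** * Engel's theorem *)

(** By definition a Cartan subalgebra is only nilpotent and self-normalizing, and [reductive] only
    provides complementary ideals, whereas the spin module is built from roots in the classical
    sense. Most of the weight theory recovers that setting from the two definitions and the form B:
    h acts diagonally on g, and nonzero root spaces are lines, so that each of them lies either in r
    or in its orthogonal. Engel's theorem and Cartan's criterion are the tools. The obstacle to
    complete reducibility is the center of r, which Whitehead's lemma does not see. It acts
    diagonally on S because it lies in h and S is spanned by products of root vectors applied to 1,
    which is itself a weight vector. Modules act on row vectors from the right, which fixes the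
    order of products everywhere. An isotypic component is a space of matrices on which r acts from
    the left, through transposes; intertwiners act from the right, so that D becomes right
    multiplication by matrices. *)

Section MatrixFacts.
Variable K : fieldType.

(* Generalized eigenvectors: a right multiplication by [s] shifts the
   generalized eigenvalue of [A0] to that of [A1]. *)
Lemma mulmx_shift n p q (A0 : 'M[K]_n) (A1 : 'M[K]_p) N m (f : 'M_(q, n))
    (s : 'M_(n, p)) :
  iter N (fun s => s *m A1 - A0 *m s) s = 0 -> f *m (A0 ^+ m) = 0 ->
  f *m s *m (A1 ^+ (N + m)) = 0.
Proof.
move: f s.
have [k] := ubnP (N + m)%N; elim: k N m => // k IH [|N] [|m] lek f s.
- by move=> /= -> _; rewrite mulmx0 mul0mx.
- by move=> /= -> _; rewrite mulmx0 mul0mx.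
- by move=> _; rewrite expr0 mulmx1 => ->; rewrite !mul0mx.
rewrite iterSr exprS -mulmxE mulmxA => sN fm.
have -> : A1 ^+ (N.+1 + m.+1) = A1 *m A1 ^+ (N + m.+1) by rewrite mulmxE -exprS.
have -> : f *m s *m (A1 *m A1 ^+ (N + m.+1)) =
    f *m A0 *m s *m A1 ^+ (N.+1 + m) + f *m (s *m A1 - A0 *m s) *m A1 ^+ (N + m.+1).
  by rewrite addSnnS -mulmxDl mulmxBr !mulmxA addrC subrK.
have le1 : (N.+1 + m < k)%N by move: lek; rewrite addnS ltnS.
have le2 : (N + m.+1 < k)%N by move: lek; rewrite addSn ltnS.
rewrite (IH _ _ le1) ?(IH _ _ le2) ?addr0 ?iterSr//.
by rewrite -fm -mulmxA mulmxE -exprS.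
Qed.

Lemma trmxX n (A : 'M[K]_n) k : (A ^+ k)^T = A^T ^+ k.
Proof.
elim: k => [|k IH]; first by rewrite !expr0 trmx1.
by rewrite exprS exprSr -!mulmxE trmx_mul IH.
Qed.

Lemma mulmx_shiftl n p q (A0 : 'M[K]_n) (A1 : 'M[K]_p) N m (f : 'M_(p, q))
    (s : 'M_(n, p)) :
  iter N (fun s => s *m A1 - A0 *m s) s = 0 -> A1 ^+ m *m f = 0 ->
  A0 ^+ (N + m) *m s *m f = 0.
Proof.
move=> sN fm; apply: trmx_inj; rewrite !trmx_mul trmxX trmx0 mulmxA.
apply: (mulmx_shift (A0 := A1^T)); last by rewrite -trmxX -trmx_mul fm trmx0.
have -> k : iter k (fun s => s *m A0^T - A1^T *m s) s^T =
    (-1) ^+ k *: (iter k (fun s => s *m A1 - A0 *m s) s)^T.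
  elim: k => [|k /= ->]; first by rewrite expr0 scale1r.
  rewrite linearB/= !trmx_mul -scalemxAl -scalemxAr -scalerBr exprSr -scalerA.
  by rewrite scaleN1r opprB.
by rewrite sN trmx0 scaler0.
Qed.

Lemma mulmxX_stable n m (U : 'M[K]_(m, n)) (A : 'M[K]_n) k :
  (U *m A <= U)%MS -> (U *m A ^+ k <= U)%MS.
Proof.
move=> UA; elim: k => [|k IH]; first by rewrite expr0 mulmx1.
by rewrite exprSr -mulmxE mulmxA (submx_trans _ UA)// submxMr.
Qed.

Lemma mx_exp_comm n m (X : 'M[K]_(m, n)) (A : 'M[K]_n) (B : 'M[K]_m) k :
  X *m A = B *m X -> X *m A ^+ k = B ^+ k *m X.
Proof.
move=> XA; elim: k => [|k IH]; first by rewrite !expr0 mulmx1 mul1mx.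
by rewrite exprSr [B ^+ _]exprSr -!mulmxE mulmxA IH -!mulmxA XA.
Qed.

(** Both [f] and [B] are polynomials in A, read off a Bezout identity between 'X^n and the factor of
    the characteristic polynomial that does not vanish at 0. This is why they preserve every
    A-stable subspace and commute with all that commutes with A. *)
Lemma fitting n (A : 'M[K]_n) : exists f B : 'M[K]_n,
  [/\ f *m f = f, f *m A ^+ n = 0, A ^+ n *m B = 1%:M - f &
   [/\ A *m f = f *m A, B *m A = A *m B,
     forall (U : 'M[K]_n), (U *m A <= U)%MS -> (U *m f <= U)%MS &
     forall X, X *m A = A *m X -> X *m f = f *m X /\ X *m B = B *m X]].
Proof.
case: n A => [|n] A.
  have mx0 (X Y : 'M[K]_0) : X = Y by apply/matrixP => -[].
  exists 0, 0; split; [exact: mx0 | exact: mx0 | exact: mx0 |].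
  split=> [||U _|X _]; [exact: mx0 | exact: mx0 | by rewrite mulmx0 sub0mx |].
  by rewrite !mulmx0 !mul0mx.
set p := char_poly A.
have [m [q q0 ep]] : exists m, exists2 q : {poly K}, ~~ root q 0 & p = q * ('X - 0%:P) ^+ m.
  have := multiplicity_XsubC p 0; rewrite /p monic_neq0 ?char_poly_monic//=.
  by move=> [m [q q0 ->]]; exists m, q.
rewrite subr0 in ep.
have cop : coprimep ('X ^+ n.+1) q.
  rewrite coprimep_sym coprimep_expr//.
  by have := coprimep_XsubC q 0; rewrite subr0 => ->.
have [[u v]/= /eqpP[[c d] /= /andP[c0 d0]]] := Bezout_coprimepP _ _ cop => uv.
wlog c1 : c d u v c0 d0 uv / c = 1 => [wl|].
  by apply: (wl 1 (c^-1 * d) u v); rewrite ?oner_eq0 ?mulf_neq0 ?invr_eq0//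
    -scalerA -uv scalerA mulVf.
rewrite c1 scale1r in uv.
have uvd : (d^-1 *: u) * 'X ^+ n.+1 + (d^-1 *: v) * q = 1.
  by rewrite -!scalerAl -scalerDr uv scalerA mulVf// scale1r.
set u' := d^-1 *: u in uvd; set v' := d^-1 *: v in uvd.
(* The multiplicity of the root 0 is at most the size, so 'X^n * q is a multiple of the
   characteristic polynomial and Cayley-Hamilton kills it. *)
have mn : (m <= n.+1)%N.
  have := size_char_poly A; rewrite -/p ep size_Mmonic ?monicXn//; last first.
    by apply/eqP => qe; move: q0; rewrite qe root0.
  rewrite size_polyXn; case: (size q) (size_poly_eq0 q) => [/esym/eqP qe|k _ /=].
    by move: q0; rewrite qe root0.
  by rewrite addnS => -[] <-; rewrite leq_addl.
set f := horner_mx A (v' * q); set B := horner_mx A u'.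
have pA : horner_mx A ('X ^+ n.+1 * q) = 0.
  rewrite -(subnK mn) exprD -mulrA mulrC [_ * q]mulrC -ep rmorphM/= -/p.
  by rewrite Cayley_Hamilton mul0r.
have cA (w : {poly K}) : horner_mx A w *m A = A *m horner_mx A w.
  transitivity (horner_mx A (w * 'X)); first by rewrite rmorphM/= horner_mx_X.
  by rewrite mulrC rmorphM/= horner_mx_X.
have An : A ^+ n.+1 = horner_mx A ('X ^+ n.+1) by rewrite rmorphXn/= horner_mx_X.
have fA : f *m A ^+ n.+1 = 0.
  rewrite An mulmxE -rmorphM/= -mulrA [q * _]mulrC.
  by rewrite rmorphM/= pA mulr0.
have AB : A ^+ n.+1 *m B = 1%:M - f.
  rewrite An mulmxE -rmorphM/= mulrC -[1%:M](rmorph1 (horner_mx A)) -rmorphB.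
  by rewrite -uvd/= addrK.
exists f, B; split => //.
  have : f *m (1%:M - f) = 0 by rewrite -AB mulmxA fA mul0mx.
  by rewrite mulmxBr mulmx1 => /eqP; rewrite subr_eq0 => /eqP.
split=> [||U UA|].
- by rewrite cA.
- by rewrite cA.
2: by move=> X XA; split; apply: comm_mx_horner.
rewrite /f; elim/poly_ind: (v' * q) => [|w c' IH]; first by rewrite rmorph0 mulmx0 sub0mx.
rewrite rmorphD rmorphM/= horner_mx_X horner_mx_C mulmxDr addmx_sub//; last first.
  by rewrite mul_mx_scalar scalemx_sub.
by rewrite -mulmxE mulmxA (submx_trans _ UA)// submxMr.
Qed.

(** A singular matrix factors as C R through a smaller size, and R C has the same trace and is again
    nilpotent; an invertible nilpotent matrix has size 0. *)
Lemma mxtrace_nilp n (A : 'M[K]_n) k : A ^+ k = 0 -> \tr A = 0.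
Proof.
have [d] := ubnP n; elim: d n A => // d IH n A; rewrite ltnS => nd Ak.
have [rA|] := boolP (row_free A).
  have : A ^+ k \in unitmx.
    elim: (k) => [|j jA]; first by rewrite expr0 unitmx1.
    by rewrite exprS -mulmxE unitmx_mul jA -row_free_unit rA.
  rewrite Ak; case: n A {nd Ak rA} => [|n] A; first by rewrite /mxtrace big_ord0.
  by rewrite unitr0.
move=> rA; set r := \rank A.
have rn : (r < n)%N by rewrite ltn_neqAle rank_leq_row andbT.
have eA : A = col_base A *m row_base A by rewrite mulmx_base.
rewrite eA mxtrace_mulC; apply: (IH _ _ (leq_trans rn nd)).
have colA : row_base A *m A = (row_base A *m col_base A) *m row_base A.
  by rewrite -mulmxA mulmx_base.
have := mx_exp_comm k colA; rewrite Ak mulmx0 => /esym/eqP.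
by rewrite (mulmx_free_eq0 _ (row_base_free A)) => /eqP.
Qed.

Lemma mx_dim0 m n (X Y : 'M[K]_(m, n)) : n = 0%N -> X = Y.
Proof.
by move=> n0; apply/matrixP => i j; have := ltn_ord j; rewrite [X in (_ < X)%N]n0.
Qed.

Lemma mxtrace_idem n (e : 'M[K]_n) : e *m e = e -> \tr e = (\rank e)%:R.
Proof.
move=> ee; rewrite -{1}(mulmx_base e) mxtrace_mulC.
suff -> : row_base e *m col_base e = 1%:M by rewrite mxtrace1.
apply: (row_free_inj (row_base_free e)).
apply: (row_full_inj (col_base_full e)).
by rewrite mul1mx -mulmxA mulmx_base mulmxA mulmx_base.
Qed.

Lemma idem_sub n m (X : 'M[K]_(m, n)) (e : 'M[K]_n) : e *m e = e -> (X <= e)%MS -> X *m e = X.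
Proof. by move=> ee /submxP[Y ->]; rewrite -mulmxA ee. Qed.

Lemma idem_exp n (e : 'M[K]_n) k : e *m e = e -> (0 < k)%N -> e ^+ k = e.
Proof.
by move=> ee; case: k => // k _; elim: k => [|k IH]; rewrite ?expr1// exprS IH -mulmxE.
Qed.

Lemma eigen_exp n m (v : 'M[K]_(m, n)) (A : 'M[K]_n) c k : v *m A = c *: v -> v *m A ^+ k = c ^+ k *: v.
Proof.
move=> vA; elim: k => [|k IH]; first by rewrite !expr0 mulmx1 scale1r.
by rewrite exprSr -mulmxE mulmxA IH -scalemxAl vA scalerA -exprSr.
Qed.

Lemma linear_lfun (U V : vectType K) (f : U -> V) : linear f -> exists F : 'Hom(U, V), F =1 f.
Proof.
move=> fl; pose F : {linear U -> V} := HB.pack f (GRing.isLinear.Build K U V _ f fl).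
by exists (linfun F) => u; rewrite lfunE.
Qed.

Section Engel.
Variable n : nat.
Implicit Types (S : 'M[K]_n -> Prop) (U W : 'M[K]_n).

(** The conclusion of Engel's theorem for every invariant subquotient W/U, phrased without
    quotients: a nonzero class that all of [S] kills. *)
Definition engelian S := forall U W, (U <= W)%MS -> ~~ (W <= U)%MS ->
  (forall s, S s -> (U *m s <= U)%MS /\ (W *m s <= W)%MS) ->
  exists v : 'rV_n, [/\ (v <= W)%MS, ~~ (v <= U)%MS &
    forall s, S s -> (v *m s <= U)%MS].

(** Starting from 0, a vector killed modulo the current subspace is added; the rank grows until the
    whole space is reached, so n steps suffice. *)
Lemma engelian_flag S : engelian S -> exists (Z : nat -> 'M[K]_n) (N : nat),
  [/\ Z 0%N = 0, (1%:M <= Z N)%MS &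
    forall i, (Z i <= Z i.+1)%MS /\ forall s, S s -> (Z i.+1 *m s <= Z i)%MS].
Proof.
move=> ES.
(* The stability of [U] sits inside the statement so that [choice] returns a total function, which
   can be iterated. *)
have step (U : 'M[K]_n) : exists U' : 'M[K]_n,
    (forall s, S s -> (U *m s <= U)%MS) ->
    [/\ (U <= U')%MS, forall s, S s -> (U' *m s <= U)%MS &
      ~~ (1%:M <= U)%MS -> (\rank U < \rank U')%N].
  have [US|] := pselect (forall s, S s -> (U *m s <= U)%MS); last by exists U.
  have [fU|fU] := boolP ((1%:M : 'M_n) <= U)%MS; first by exists U.
  have [|v [_ vU vS]] := ES U 1%:M (submx1 _) fU.
    by move=> s Ss; rewrite US ?submx1.
  exists (U + v)%MS => _; split; first exact: addsmxSl.
    by move=> s Ss; rewrite addsmxMr addsmx_sub US ?vS.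
  move=> _; apply: rank_ltmx; rewrite /ltmx addsmxSl/=.
  by apply: contra vU; apply: submx_trans; apply: addsmxSr.
have [f fP] := choice step.
pose Z i := iter i f (0 : 'M[K]_n).
have ZS i : forall s, S s -> (Z i *m s <= Z i)%MS.
  elim: i => [|i IH] s Ss; first by rewrite mul0mx sub0mx.
  have [sub stab _] := fP _ IH.
  exact: submx_trans (stab _ Ss) sub.
have Zr i : (minn i n <= \rank (Z i))%N.
  elim: i => [|i IH]; first by rewrite min0n.
  have [sub stab lt] := fP _ (ZS i).
  have [fU|fU] := boolP ((1%:M : 'M_n) <= Z i)%MS.
    by apply: leq_trans (mxrankS (submx_trans fU sub)); rewrite mxrank1 geq_minr.
  apply: leq_trans (leq_ltn_trans IH (lt fU)).
  by rewrite -minnSS leq_min geq_minl (leq_trans (geq_minr _ _)).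
exists Z, n; split=> //; last by move=> i; have [sub stab _] := fP _ (ZS i).
by rewrite sub1mx -col_leq_rank; have := Zr n; rewrite minnn.
Qed.

(* Commutators with [S] lower the degree of a matrix with respect to the flag,
   so iterating them from [s0] must end at a matrix that they send into [T]. *)
Lemma engelian_normal S (T R : 'M[K]_n -> Prop) s0 : engelian S -> T 0 -> ~ T s0 ->
  R s0 -> (forall a s, S a -> R s -> R (s *m a - a *m s)) ->
  exists s, [/\ R s, ~ T s & forall a, S a -> T (s *m a - a *m s)].
Proof.
move=> ES T0 Ts0 Rs0 RS.
have [Z [N [Z0 ZN ZS]]] := engelian_flag ES.
have Za i a : S a -> (Z i *m a <= Z i.-1)%MS.
  by case: i => [|i] Sa; [rewrite Z0 mul0mx sub0mx | apply: (ZS i).2].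
have ZmN i : (1%:M <= Z (i + N)%N)%MS.
  by elim: i => // i IH; apply: submx_trans IH (ZS _).1.
apply: contrapT => none.
have next s : R s -> ~ T s -> exists a, S a /\ ~ T (s *m a - a *m s).
  move=> Rs Ts; apply: contrapT => nex; apply: none; exists s; split=> // a Sa.
  by apply: contrapT => nT; apply: nex; exists a.
have deg j : exists s, [/\ R s, ~ T s & forall i, (Z i *m s <= Z (i + N - j)%N)%MS].
  elim: j => [|j [s [Rs Ts sZ]]].
    by exists s0; split=> // i; rewrite subn0 (submx_trans (submx1 _)).
  have [a [Sa Ta]] := next s Rs Ts.
  exists (s *m a - a *m s); split=> //; first exact: RS.
  move=> i; rewrite mulmxBr !mulmxA addmx_sub ?eqmx_opp//.
    by apply: submx_trans (submxMr _ (sZ i)) _; rewrite subnS Za.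
  case: i => [|i]; first by rewrite Z0 !mul0mx sub0mx.
  by apply: submx_trans (submxMr _ (Za i.+1 _ Sa)) _; rewrite addSn subSS sZ.
have [s [_ Ts sZ]] := deg (N + N)%N.
apply: Ts; suff -> : s = 0 by [].
apply/eqP; rewrite -submx0 -[s]mul1mx -Z0 -(subnn (N + N)).
exact: submx_trans (submxMr _ ZN) (sZ N).
Qed.

(** Jacobson's form: [S] is closed under commutators but need not be a subspace, so it may consist
    of the images of weight vectors only, whose sums need not be nilpotent. A finite list from [S]
    with bracket-closed engelian span of maximal dimension must span [S], as otherwise an element
    normalizing the span could be added. *)
Lemma engel_jacobson S : (forall s, S s -> s ^+ n = 0) ->
  (forall a s, S a -> S s -> S (s *m a - a *m s)) -> engelian S.
Proof.
move=> nilS closS.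
pose sp (t : seq 'M[K]_n) x := x \in <<t>>%VS.
pose good t := [/\ forall a, a \in t -> S a,
  forall a b, a \in t -> b \in t -> sp t (b *m a - a *m b) & engelian (fun a => a \in t)].
have ex_max : exists t, good t /\ forall t', good t' -> (\dim <<t'>> <= \dim <<t>>)%N.
  pose Q k := `[< exists t, good t /\ \dim <<t>> = k >].
  have Q0 : exists k, Q k.
    exists (\dim <<Nil 'M[K]_n>>); apply/asboolP; exists [::]; do ?split => //.
    move=> U W UW /row_subPn[i Wi] _; exists (row i W); split=> //.
    exact: row_sub.
  have Qb k : Q k -> (k <= \dim {:'M[K]_n})%N.
    by move=> /asboolP[t [_ <-]]; rewrite dimvS// subvf.
  case: (ex_maxnP Q0 Qb) => k /asboolP[t [gt tk]] kmax; exists t; split=> // t' gt'.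
  by rewrite tk kmax//; apply/asboolP; exists t'.
have [t [[tS tc tE] tmax]] := ex_max.
have span_sub (t' : seq 'M[K]_n) (v : 'rV_n) (U s : 'M_n) :
    (forall a, a \in t' -> (v *m a <= U)%MS) -> sp t' s -> (v *m s <= U)%MS.
  move=> vt /(@coord_span _ _ _ (in_tuple t')) ->; rewrite mulmx_sumr summx_sub// => i _.
  by rewrite -scalemxAr scalemx_sub// vt// mem_nth.
have allt : forall s, S s -> sp t s.
  move=> s0 Ss0; apply: contrapT => ts0.
  have [] := @engelian_normal (fun a => a \in t) (sp t) S s0 tE (mem0v _) ts0 Ss0.
    by move=> a s /tS Sa Ss; apply: closS.
  move=> s [Ss ts sN].
  have ssp : {subset <<t>>%VS <= <<s :: t>>%VS}.
    by apply/subvP/sub_span => a at_; rewrite inE at_ orbT.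
  have goods : good (s :: t).
    split.
    - by move=> a; rewrite inE => /orP[/eqP->|/tS].
    - move=> a b; rewrite !inE => /orP[/eqP->|ta] /orP[/eqP->|tb].
      + by rewrite subrr /sp mem0v.
      + by rewrite /sp -opprB rpredN; apply: ssp; apply: sN.
      + by apply: ssp; apply: sN.
      + by apply: ssp; apply: tc.
    move=> U W UW WU stab.
    have [|v [vW vU vt]] := tE U W UW WU.
      by move=> a ta; apply: stab; rewrite inE ta orbT.
    have [Us Ws] := stab s (mem_head _ _).
    have vsW j : (v *m s ^+ j <= W)%MS.
      by rewrite (submx_trans (submxMr _ vW))// mulmxX_stable.
    have vst j a : a \in t -> (v *m s ^+ j *m a <= U)%MS.
      elim: j a => [|j IH] a ta; first by rewrite expr0 mulmx1 vt.
      rewrite exprSr -mulmxE mulmxA -[X in (X <= _)%MS](subrK (v *m s ^+ j *m a *m s)).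
      rewrite addmx_sub//; last by rewrite (submx_trans _ Us)// submxMr// IH.
      rewrite -!(mulmxA (v *m _)) -mulmxBr; apply: span_sub (IH) (sN _ ta).
    (* The last power [v *m s ^+ j] outside [U] is killed by [s] modulo [U], and still by [t],
       because [s] normalizes the span of [t]. *)
    have Pn : exists j, (v *m s ^+ j <= U)%MS by exists n; rewrite nilS// mulmx0 sub0mx.
    case: (ex_minnP Pn) => -[|j] vj jmin.
      by move: vU; rewrite expr0 mulmx1 in vj; rewrite vj.
    exists (v *m s ^+ j); split=> //.
      by apply/negP => /jmin; rewrite ltnn.
    move=> a; rewrite inE => /orP[/eqP->|]; last exact: vst.
    by rewrite -mulmxA mulmxE -exprSr.
  have := tmax _ goods; rewrite leqNgt => /negP[].
  rewrite ltn_neqAle dimvS ?andbT; last exact/subvP.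
  apply/eqP => dimE; apply: ts; rewrite /sp.
  have /eqP-> : (<<t>> == <<s :: t>>)%VS by rewrite eqEdim dimE leqnn andbT; apply/subvP.
  by rewrite memv_span ?mem_head.
move=> U W UW WU stab; have [|v [vW vU vt]] := tE U W UW WU.
  by move=> a /tS /stab.
by exists v; split=> // s /allt; apply: span_sub.
Qed.

End Engel.
End MatrixFacts.

(** * Brackets, ideals and reductive subalgebras *)

Section LieFacts.
Variables (K : fieldType) (g : lieAlgType K).
Implicit Types (x y z t : g) (r h I : {vspace g}).

Lemma lie0l x : 'L[0, x] = 0.
Proof. by have := lie_is_linearl (-1) 0 0 x; rewrite !scaleN1r !addNr. Qed.

Lemma lieDl x y z : 'L[x + y, z] = 'L[x, z] + 'L[y, z].
Proof. by have := lie_is_linearl 1 x y z; rewrite !scale1r. Qed.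

Lemma lieZl (a : K) x z : 'L[a *: x, z] = a *: 'L[x, z].
Proof. by have := lie_is_linearl a x 0 z; rewrite !addr0 lie0l addr0. Qed.

Lemma lieC x y : 'L[x, y] = - 'L[y, x].
Proof.
apply/eqP; rewrite -addr_eq0; apply/eqP.
by have := liexx (x + y); rewrite lieDl !linearD/= !liexx add0r addr0.
Qed.

Lemma lie_leibniz t x y : 'L[t, 'L[x, y]] = 'L['L[t, x], y] + 'L[x, 'L[t, y]].
Proof.
have /eqP := lie_jacobi t x y; rewrite -addrA addr_eq0 => /eqP ->.
by rewrite ['L['L[t, x], y]]lieC ['L[t, y]]lieC linearN/= opprD addrC.
Qed.

End LieFacts.

Section LieSubspaces.
Variables (K : fieldType) (g : lieAlgType K).
Implicit Types (x y z t : g) (r h I : {vspace g}).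

Lemma mem_lie_prod r h x y : x \in r -> y \in h -> 'L[x, y] \in lie_prod r h.
Proof.
move=> xr yh; rewrite (coord_vbasis xr) (coord_vbasis yh).
rewrite (big_morph (fun z => 'L[z, _]) (fun a b => lieDl a b _) (lie0l _)).
apply: rpred_sum => i _; rewrite lieZl linear_sum rpredZ//.
apply: rpred_sum => j _; rewrite linearZ/= rpredZ// memv_span//.
by apply/allpairsP; exists ((vbasis r)`_i, (vbasis h)`_j); split => //=; apply: mem_nth;
  rewrite size_tuple.
Qed.

Lemma lie_prod_ind r h (U : {vspace g}) :
  {in r & h, forall x y, 'L[x, y] \in U} -> (lie_prod r h <= U)%VS.
Proof.
move=> H; apply/span_subvP => _ /allpairsP[[x y] [/= /vbasis_mem xr /vbasis_mem yh ->]].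
exact: H.
Qed.

Lemma lie_prod_elim r h (Q : g -> Prop) : Q 0 ->
  (forall a u v, Q u -> Q v -> Q (a *: u + v)) ->
  (forall x y, x \in r -> y \in h -> Q 'L[x, y]) -> forall z, z \in lie_prod r h -> Q z.
Proof.
move=> Q0 QP Ql z; pose s := [seq 'L[x, y] | x <- vbasis r, y <- vbasis h].
rewrite -[lie_prod r h]/(<<in_tuple s>>%VS) => /coord_span ->.
elim/big_rec: _ => // i u _ Qu; apply: QP => //.
have /allpairsP[[x y] [/= /vbasis_mem xr /vbasis_mem yh ->]] : (in_tuple s)`_i \in s by exact: mem_nth.
exact: Ql.
Qed.

Definition perfect I := lie_prod I I = I.

Lemma ideal_lie_prod r I : ideal_of r I -> ideal_of r (lie_prod I I).
Proof.
move=> [Ir II]; split.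
  apply: (subv_trans _ Ir); apply: lie_prod_ind => x y xI yI.
  by apply: II => //; apply: (subvP Ir).
move=> x y xr; apply: (lie_prod_elim (Q := fun y => 'L[x, y] \in lie_prod I I)) => [|a u v|u v uI vI].
- by rewrite linear0 mem0v.
- by rewrite linearP => ? ?; rewrite rpredD// rpredZ.
by rewrite lie_leibniz rpredD// mem_lie_prod// II.
Qed.

Lemma ideal_lie_sub r I : ideal_of r I -> (lie_prod I I <= I)%VS.
Proof.
by move=> [Ir II]; apply: lie_prod_ind => a b aI; apply: II; apply: (subvP Ir).
Qed.

(* A complement [J] of [I, I] in [r] meets [I] in a subspace that brackets [I] to zero. *)
Lemma reductive_perfect r I : reductive r -> ideal_of r I -> perfect (lie_prod I I).
Proof.
move=> redr idI; have [Ir II] := idI; have uII := subvP (ideal_lie_sub idI).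
have [J [[Jr JJ] sIJ dIJ]] := redr _ (ideal_lie_prod idI).
have ab x y : x \in J -> x \in I -> y \in I -> 'L[x, y] = 0.
  move=> xJ xI yI; apply/eqP; rewrite -memv0 -dIJ memv_cap mem_lie_prod//=.
  by rewrite lieC rpredN JJ// (subvP Ir).
apply/eqP; rewrite eqEsubv; apply/andP; split; apply: lie_prod_ind => x y.
  by move=> /uII xI /uII yI; apply: mem_lie_prod.
have dec z : z \in I -> exists u v, [/\ u \in lie_prod I I, v \in J, v \in I & z = u + v].
  move=> zI; have : z \in r by apply: (subvP Ir).
  rewrite -sIJ => /memv_addP[u uI [v vJ zE]]; exists u, v; split=> //.
  by rewrite -(addKr u v) -zE rpredD// rpredN uII.
move=> /dec[u [v [uI vJ vI ->]]] /dec[u' [v' [uI' vJ' vI' ->]]].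
have -> : 'L[u + v, u' + v'] = 'L[u, u'] - 'L[v', u] + ('L[v, u'] + 'L[v, v']).
  by rewrite lieDl !linearD/= (lieC v' u) opprK.
rewrite (ab v' u vJ' vI' (uII _ uI)) (ab v u' vJ vI (uII _ uI')) (ab v v')//.
by rewrite subr0 !addr0 mem_lie_prod.
Qed.

Definition lie_center r : {vspace g} :=
  (r :&: \bigcap_(i < \dim r) lker (linfun (lie (vbasis r)`_i)))%VS.

Lemma lie_centerP r x : reflect (x \in r /\ {in r, forall y, 'L[y, x] = 0}) (x \in lie_center r).
Proof.
rewrite memv_cap; apply: (iffP andP) => -[xr H]; split=> //.
  move=> y yr; rewrite (coord_vbasis yr) lieC linear_sum/=.
  rewrite big1 ?oppr0// => i _; rewrite linearZ/= lieC.
  suff -> : 'L[(vbasis r)`_i, x] = 0 by rewrite oppr0 scaler0.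
  move: H; rewrite (bigD1 i)//= memv_cap => /andP[]; rewrite memv_ker lfunE/=.
  by move=> /eqP.
apply: (big_ind (fun U : {vspace g} => x \in U)) => [|U W xU xW|i _].
- exact: memvf.
- by rewrite memv_cap xU.
by rewrite memv_ker lfunE/= H// vbasis_mem// mem_nth// size_tuple.
Qed.

Lemma ideal_center r : lie_closed r -> ideal_of r (lie_center r).
Proof.
move=> clr; split; first exact: capvSl.
move=> x y xr /lie_centerP[yr yc]; apply/lie_centerP; split; first exact: clr.
by move=> z zr; rewrite yc// linear0.
Qed.

(** Brackets with central elements vanish, so the derived algebra lies in any ideal complementary to
    the center. *)
Lemma reductive_center r x : reductive r -> lie_closed r ->
  x \in lie_center r -> x \in lie_prod r r -> x = 0.
Proof.
move=> redr clr xZ xr; have [J [[Jr JJ] sZJ dZJ]] := redr _ (ideal_center clr).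
apply/eqP; rewrite -memv0 -dZJ memv_cap xZ/=; apply: subvP xr.
apply: lie_prod_ind => y z yr; rewrite -{1}sZJ => /memv_addP[c /lie_centerP[_ cc] [j jJ ->]].
by rewrite linearD/= cc// add0r JJ.
Qed.

(** An ideal complementary to the derived algebra is central: its brackets with r lie in both. *)
Lemma reductive_sum r x : reductive r -> lie_closed r -> x \in r ->
  exists2 c, c \in lie_center r & exists2 d, d \in lie_prod r r & x = c + d.
Proof.
move=> redr clr; have idr : ideal_of r r by split.
have [J [[Jr JJ] sJ dJ]] := redr _ (ideal_lie_prod idr).
rewrite -{1}sJ => /memv_addP[d dr [c cJ ->]]; exists c; last by exists d; rewrite // addrC.
have cr := subvP Jr _ cJ; apply/lie_centerP; split=> // y yr.
by apply/eqP; rewrite -memv0 -dJ memv_cap mem_lie_prod//= JJ.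
Qed.

(** Such an ideal commutes with itself, and with a complementary ideal because their brackets lie in
    the zero intersection. *)
Lemma abelian_ideal_center r I : reductive r -> ideal_of r I ->
  lie_prod I I = 0%VS -> (I <= lie_center r)%VS.
Proof.
move=> redr idI I0; have [Ir II] := idI; have [J [[Jr JJ] sJ dJ]] := redr _ idI.
apply/subvP => x xI; apply/lie_centerP; split; first exact: (subvP Ir).
move=> y; rewrite -{1}sJ => /memv_addP[u uI [j jJ ->]]; rewrite lieDl.
have /eqP -> : 'L[u, x] == 0 by rewrite -memv0 -I0 mem_lie_prod.
apply/eqP; rewrite add0r -memv0 -dJ memv_cap II ?(subvP Jr)//=.
by rewrite lieC rpredN JJ ?(subvP Ir).
Qed.

End LieSubspaces.

(** * Weights of commuting families *)

Section Weights.
Variables (K : numClosedFieldType) (g : lieAlgType K) (h : {vspace g}).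
Implicit Types (t x y : g).
Notation weight := 'Hom(subvs_of h, K^o).
Implicit Types (a b c : weight).

Definition wt a t : K := a (vsproj h t).

Lemma wtD a b t : wt (a + b) t = wt a t + wt b t.
Proof. by rewrite /wt add_lfunE. Qed.

Lemma wtN a t : wt (- a) t = - wt a t.
Proof. by rewrite /wt opp_lfunE. Qed.

Lemma wt0 t : wt 0 t = 0.
Proof. by rewrite /wt zero_lfunE. Qed.

Lemma wtMn a k t : wt (a *+ k) t = wt a t *+ k.
Proof. by elim: k => [|k IH]; rewrite ?wt0// !mulrS wtD IH. Qed.

Lemma wt_lin a (c : K) x y : wt a (c *: x + y) = c * wt a x + wt a y.
Proof. by rewrite /wt !linearP. Qed.

Lemma wt_inj a b : {in h, wt a =1 wt b} -> a = b.
Proof.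
move=> ab; apply/lfunP => u; have := ab (vsval u) (subvsP u).
by rewrite /wt vsvalK.
Qed.

Lemma wt_neq a b : a != b -> exists2 t, t \in h & wt a t != wt b t.
Proof.
move=> /eqP ab; apply: contrapT => nt; apply: ab; apply: wt_inj => t th.
by apply/eqP; apply: contrapT => /negP abt; apply: nt; exists t.
Qed.

(** Matrices act on row vectors from the right, hence the reversed commutator. Only the values of
    [rho] on r are constrained. *)
Definition lie_rep (r : {vspace g}) n (rho : {linear g -> 'M[K]_n}) :=
  {in r &, forall x y, rho 'L[x, y] = rho y *m rho x - rho x *m rho y}.

Lemma lie_repS r r' n (rho : {linear g -> 'M[K]_n}) : (r <= r')%VS -> lie_rep r' rho -> lie_rep r rho.
Proof. by move=> /subvP rr H x y /rr xr /rr; apply: H. Qed.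

Definition wspace n (rho : g -> 'M[K]_n) a m (v : 'M[K]_(m, n)) :=
  forall t, t \in h -> exists N, v *m ((rho t - (wt a t)%:M) ^+ N) = 0.

Definition lie_shift a t y := 'L[t, y] - wt a t *: y.

(** Generalized weight vectors, since the diagonal action of h on g is not part of the definition of
    a Cartan subalgebra; it is proved in [toral_eigen]. *)
Definition gweight a e := forall t, t \in h -> exists N, iter N (lie_shift a t) e = 0.

(** Weight spaces are recorded by their projectors, defined for all weights and zero off the finite
    list [s]. That the projectors preserve h-stable subspaces makes it unnecessary to decompose
    those separately. *)
Record weight_dec n (rho : g -> 'M[K]_n) (s : seq weight) (pi : weight -> 'M[K]_n) := WeightDec {
  wdec_uniq : uniq s;
  wdec0 : forall a, a \notin s -> pi a = 0;
  wdec_sum : \sum_(a <- s) pi a = 1%:M;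
  wdec_mul : forall a b, pi a *m pi b = if a == b then pi a else 0;
  wdec_comm : forall a t, t \in h -> pi a *m rho t = rho t *m pi a;
  wdec_nil : forall a t, t \in h -> pi a *m ((rho t - (wt a t)%:M) ^+ n) = 0;
  wdec_stable : forall a (U : 'M[K]_n), (forall t, t \in h -> (U *m rho t <= U)%MS) ->
    (U *m pi a <= U)%MS
}.

Section Existence.
Hypotheses (clh : lie_closed h) (nilh : nilpotent_lie h).

Lemma nilpotent_iter t y : t \in h -> y \in h -> exists N, iter N (lie t) y = 0.
Proof.
move=> th yh; have [N hN] := nilh; exists N; apply/eqP; rewrite -memv0 -hN.
by elim: N {hN} => //= N IH; apply: mem_lie_prod.
Qed.

Variables (n : nat) (rho : {linear g -> 'M[K]_n}).
Hypothesis rhoP : lie_rep h rho.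

Let iter_rho N t y : t \in h -> y \in h ->
  iter N (fun s => s *m rho t - rho t *m s) (rho y) = rho (iter N (lie t) y).
Proof.
move=> th yh; elim: N => //= N ->; rewrite rhoP//.
by elim: N => //= N IH; apply: clh.
Qed.

Record hproj (e : 'M[K]_n) : Prop := HProj {
  hproj_idem : e *m e = e;
  hproj_comm : forall t, t \in h -> e *m rho t = rho t *m e;
  hproj_stable : forall (U : 'M[K]_n), (forall t, t \in h -> (U *m rho t <= U)%MS) ->
    (U *m e <= U)%MS
}.

(** [rho y] need not commute with [rho t], but ad t is nilpotent on y. By [mulmx_shift] and
    [mulmx_shiftl] this is enough for [rho y] to preserve both Fitting components of [rho t - c]. *)
Let fitting_hproj t (c : K) : t \in h -> exists f B : 'M[K]_n,
  [/\ hproj f, f *m ((rho t - c%:M) ^+ n) = 0 & (rho t - c%:M) ^+ n *m B = 1%:M - f].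
Proof.
move=> th; set A := rho t - c%:M.
have [f [B [ff fA AB [Af BA fst _]]]] := fitting A; exists f, B; split=> //.
have AC s : s *m rho t - rho t *m s = s *m A - A *m s.
  rewrite /A mulmxBr mulmxBl mul_mx_scalar mul_scalar_mx opprB.
  by rewrite addrA subrK.
(* Being idempotent, 1 - f = A^n B is divisible by arbitrarily high powers of A, which absorbs the
   shift by the nilpotency order of ad t. *)
have cf k : (A ^+ n *m B) ^+ k.+1 = 1%:M - f.
  rewrite AB; elim: k => [|k IH]; first by rewrite expr1.
  rewrite exprS IH -mulmxE mulmxBr mulmx1 mulmxBl mul1mx ff subrr subr0//.
have cBA k : (A ^+ n *m B) ^+ k = A ^+ (n * k) *m B ^+ k.
  rewrite mulmxE exprMn_comm ?exprM//; apply: commr_sym; apply: commrX; exact: BA.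
have cBA' k : (A ^+ n *m B) ^+ k = B ^+ k *m A ^+ (n * k).
  rewrite cBA mulmxE; apply: commrX; apply: commr_sym; apply: commrX; exact: BA.
have fs y : y \in h -> f *m rho y = rho y *m f.
  move=> yh; have [N tN] := nilpotent_iter th yh.
  have itA : iter N (fun s => s *m A - A *m s) (rho y) = 0.
    by rewrite -(linear0 rho) -tN -iter_rho//; apply: eq_iter => s; rewrite AC.
  have [n0|n0] := posnP n.
    exact: mx_dim0.
  have le : (N + n <= n * N.+1)%N by rewrite mulnS addnC leq_add2l leq_pmull.
  have fr : f *m rho y *m (1%:M - f) = 0.
    rewrite -(cf N) cBA -(subnKC le) exprD -mulmxE !mulmxA.
    by rewrite (mulmx_shift itA fA) !mul0mx.
  have fl : (1%:M - f) *m rho y *m f = 0.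
    rewrite -(cf N) cBA' -(subnK le) exprD -!mulmxE -!mulmxA.
    rewrite (mulmxA (A ^+ (N + n))) (mulmx_shiftl itA) ?mulmx0//.
    by rewrite -(mx_exp_comm n (esym Af)).
  move/eqP: fr; rewrite mulmxBr mulmx1 subr_eq0 => /eqP->.
  by move/eqP: fl; rewrite mulmxBl mul1mx mulmxBl subr_eq0 => /eqP->.
split=> // U Ust; apply: fst; rewrite mulmxBr addmx_sub ?Ust// eqmx_opp.
by rewrite mul_mx_scalar scalemx_sub.
Qed.

Let hprojB f : hproj f -> hproj (1%:M - f).
Proof.
move=> [ff fc fs]; split=> [|t th|U Us].
- by rewrite mulmxBr mulmx1 mulmxBl mul1mx ff subrr subr0.
- by rewrite mulmxBr mulmx1 mulmxBl mul1mx fc.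
by rewrite mulmxBr mulmx1 addmx_sub// eqmx_opp fs.
Qed.

(** The row spaces of f and of 1 - f are h-stable, hence preserved by e; this forces e and f to
    commute. *)
Let hprojM e f : hproj e -> hproj f -> e *m f = f *m e /\ hproj (e *m f).
Proof.
move=> he hf; have [ee ec es] := he; have [ff fc fs] := hf.
have efe k : hproj k -> k *m e = k *m e *m k.
  move=> [kk kc ks]; rewrite [RHS]idem_sub// es// => t th.
  by rewrite kc// submxMl.
have ef : e *m f = f *m e.
  have := efe _ (hprojB hf); rewrite [RHS]mulmxBr mulmx1 => /eqP.
  rewrite -subr_eq0 opprB addrCA subrr addr0 mulmxBl mul1mx mulmxBl subr_eq0.
  by rewrite -efe// => /eqP.
split=> //; split=> [|t th|U Us].
- by rewrite {1}ef -mulmxA (mulmxA e) ee mulmxA -ef -mulmxA ff.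

- by rewrite -mulmxA fc// mulmxA ec// mulmxA.
rewrite mulmxA; apply: submx_trans (fs U Us).
by rewrite submxMr// es.
Qed.

Let eigen_exists (A e : 'M[K]_n) : e != 0 -> e *m A = A *m e ->
  exists (c : K) (v : 'rV_n), [/\ v != 0, (v <= e)%MS & v *m A = c *: v].
Proof.
case: n e A => [|m] e A e0 eA; first by move: e0; rewrite (@mx_dim0 _ _ _ e 0)// eqxx.
have /row_subPn[i ei] : ~~ (e <= (0 : 'M_m.+1))%MS by rewrite submx0.
have [r rE] := closed_field_poly_normal (char_poly A).
have : row i e *m horner_mx A (\prod_(z <- r) ('X - z%:P)) == 0.
  rewrite (monicP (char_poly_monic A)) scale1r in rE.
  by rewrite -rE Cayley_Hamilton mulmx0.
have : (row i e <= e)%MS by apply: row_sub.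
rewrite submx0 in ei; move: (row i e) ei => v.
elim: r v {rE} => [|c r IH] v v0 ve.
  by rewrite big_nil rmorph1 mulmx1 (negPf v0).
rewrite big_cons rmorphM/= rmorphB/= horner_mx_X horner_mx_C -mulmxE mulmxA.
have [|w0 /IH] := eqVneq (v *m (A - c%:M)) 0; last first.
  apply=> //; rewrite mulmxBr addmx_sub ?eqmx_opp ?mul_mx_scalar ?scalemx_sub//.
  by apply: submx_trans (submxMr _ ve) _; rewrite eA submxMl.
move=> /eqP; rewrite mulmxBr mul_mx_scalar subr_eq0 => /eqP vA _.
by exists c, v.
Qed.

(** If each [rho t] has a single generalized eigenvalue on the image of e, that eigenvalue is tr(e
    rho(t)) / tr(e), which is linear in t and thus a weight. Otherwise a Fitting projector splits e
    into two of smaller rank. *)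
Let wdec_seq e : hproj e -> exists l : seq (weight * 'M[K]_n),
  [/\ \sum_(p <- l) p.2 = e,
    pairwise (fun p q => (p.2 *m q.2 == 0) && (q.2 *m p.2 == 0)) l &
    forall p, p \in l -> [/\ hproj p.2, e *m p.2 = p.2, p.2 *m e = p.2 &
      forall t, t \in h -> p.2 *m ((rho t - (wt p.1 t)%:M) ^+ n) = 0]].
Proof.
have [d] := ubnP (\rank e); elim: d e => // d IH e; rewrite ltnS => ed he.
have [e0|e0] := eqVneq e 0; first by exists [::]; rewrite big_nil e0.
have [ee ec es] := he.
have [all1|] := pselect (forall t, t \in h -> exists c : K, e *m ((rho t - c%:M) ^+ n) = 0).
  have tre : \tr e != 0 by rewrite mxtrace_idem// pnatr_eq0 mxrank_eq0.
  have [k x y|a aE] := @linear_lfun K (subvs_of h) K^o (fun u => (\tr e)^-1 * \tr (e *m rho (vsval u))).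
    by rewrite !linearP/= mulrDr mulrCA.
  exists [:: (a, e)]; rewrite big_seq1; split=> // p; rewrite inE => /eqP->/=; split=> // t th.
  have [c tc] := all1 t th; suff -> : wt a t = c by [].
  rewrite /wt aE vsprojK//.
  have : \tr (e *m (rho t - c%:M)) = 0.
    have [n0|n0] := posnP n; first by rewrite (@mx_dim0 _ _ _ (_ *m _) 0 n0) linear0.
    apply: (@mxtrace_nilp _ _ _ n).
    have cm : e *m (rho t - c%:M) = (rho t - c%:M) *m e.
      by rewrite mulmxBr mulmxBl ec// scalar_mxC.
    rewrite mulmxE exprMn_comm// -mulmxE.
    by rewrite idem_exp.
  rewrite mulmxBr linearB/= mul_mx_scalar linearZ/= => /eqP; rewrite subr_eq0 => /eqP->.
  by rewrite mulrCA mulVf ?mulr1.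
move=> /existsNP[t /not_implyP[th /forallNP tc]].
have [c [v [v0 ve vA]]] := eigen_exists e0 (ec t th).
have [f [B [hf fA AB]]] := fitting_hproj c th.
have [ff fc fs] := hf.
have [ef hef] := hprojM he hf; have [_ heg] := hprojM he (hprojB hf).
have n0 : (0 < n)%N by rewrite lt0n; apply: contra v0 => /eqP n0; rewrite (@mx_dim0 _ _ _ v 0).
have ef0 : e *m f != 0.
  apply: contra v0 => /eqP ef0; have : v *m (1%:M - f) = 0.
    rewrite -AB mulmxA; have -> : v *m (rho t - c%:M) ^+ n = 0.
      rewrite (eigen_exp (c := 0)) ?expr0n ?gtn_eqF ?scale0r// mulmxBr vA.
      by rewrite mul_mx_scalar subrr.
    by rewrite mul0mx.
  rewrite mulmxBr mulmx1 => /eqP; rewrite subr_eq0 => /eqP->.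
  by rewrite -(idem_sub ee ve) -mulmxA ef0 mulmx0.
have eg0 : e *m (1%:M - f) != 0.
  apply/eqP; rewrite mulmxBr mulmx1 => /eqP; rewrite subr_eq0 => /eqP eE.
  by apply: (tc c); rewrite eE -mulmxA fA mulmx0.
have rk : (\rank e = \rank (e *m f) + \rank (e *m (1%:M - f)))%N.
  apply/eqP; rewrite -(eqr_nat K) natrD -!mxtrace_idem//; try exact: hproj_idem.
  by rewrite -linearD/= -mulmxDr addrC subrK mulmx1.
move: ef0 eg0; rewrite -!mxrank_eq0 -!lt0n => ef0 eg0.
have [|l1 [s1 o1 p1]] := IH (e *m f) _ hef.
  by apply: leq_trans ed; rewrite rk -[X in (X < _)%N]addn0 ltn_add2l.
have [|l2 [s2 o2 p2]] := IH (e *m (1%:M - f)) _ heg.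
  by apply: leq_trans ed; rewrite rk -[X in (X < _)%N]add0n ltn_add2r.
have fg0 : e *m f *m (e *m (1%:M - f)) = 0.
  by rewrite mulmxA ef -[f *m e *m e]mulmxA ee -ef -mulmxA mulmxBr mulmx1 ff subrr mulmx0.
have gf0 : e *m (1%:M - f) *m (e *m f) = 0.
  by rewrite ef mulmxA -[e *m _ *m f]mulmxA mulmxBl mul1mx ff subrr mulmx0 mul0mx.
exists (l1 ++ l2); split.
- by rewrite big_cat/= s1 s2 -mulmxDr addrC subrK mulmx1.
- rewrite pairwise_cat o1 o2 !andbT; apply/allrelP => p q /p1[_ a1 a2 _] /p2[_ b1 b2 _].
  have -> : p.2 *m q.2 = 0.
    by rewrite -a2 -b1 -mulmxA (mulmxA (e *m f)) fg0 mul0mx mulmx0.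
  have -> : q.2 *m p.2 = 0 by rewrite -b2 -a1 -mulmxA (mulmxA (e *m (_ - _))) gf0 mul0mx mulmx0.
  by rewrite eqxx.
move=> p; rewrite mem_cat => /orP[/p1[hp a1 a2 pt]|/p2[hp a1 a2 pt]]; split=> //.
- by rewrite -a1 !mulmxA ee.
- by rewrite -a2 ef -!mulmxA ee.
- by rewrite -a1 !mulmxA ee.
have [eg _] := hprojM he (hprojB hf).
by rewrite -a2 eg -!mulmxA ee.
Qed.

Theorem weight_dec_exists : exists s pi, weight_dec rho s pi.
Proof.
have [|l [lsum lorth lP]] := wdec_seq (e := 1%:M).
  by split=> [|t _|U _]; rewrite ?mulmx1 ?mul1mx.
pose pi a := \sum_(p <- l | p.1 == a) p.2.
have pq0 p q : p \in l -> q \in l -> p != q -> p.2 *m q.2 = 0.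
  move=> pl ql pq; move/pairwiseP: lorth => /(_ p) lo.
  have {}lo i j : (i < size l)%N -> (j < size l)%N -> (i < j)%N -> _ := lo i j.
  rewrite -(nth_index p pl) -(nth_index p ql).
  have [ij|ji|ij] := ltngtP (index p l) (index q l).
  - by have := lo _ _ _ _ ij; rewrite !index_mem => /(_ pl ql)/andP[/eqP].
  - by have := lo _ _ _ _ ji; rewrite !index_mem => /(_ ql pl)/andP[_ /eqP].
  by move: pq; rewrite -[p in p != _](nth_index p pl) ij nth_index// eqxx.
have p_pi p b : p \in l -> p.2 *m pi b = if p.1 == b then p.2 else 0.
  move=> pl; have [pb|pb] := eqVneq p.1 b.
    rewrite -[RHS]mulmx1 -lsum (bigID (fun q => q.1 == b))/= mulmxDr -[LHS]addr0; congr (_ + _).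
    rewrite mulmx_sumr big1_seq// => q /andP[qb ql]; rewrite pq0//.
    by apply: contraNneq qb => <-; rewrite pb.
  rewrite mulmx_sumr big1_seq// => q /andP[/eqP qb ql]; rewrite pq0//.
  by apply: contraNneq pb => ->; rewrite qb.
exists (undup [seq p.1 | p <- l]), pi; split.
- exact: undup_uniq.
- move=> a; rewrite mem_undup => al; rewrite /pi big1_seq// => p /andP[/eqP pa pl].
  by case/negP: al; rewrite -pa map_f.
- rewrite -lsum /pi.
  under eq_bigr do rewrite big_mkcond.
  rewrite exchange_big/= big_seq [RHS]big_seq; apply: eq_bigr => p pl.
  rewrite (bigD1_seq p.1) ?undup_uniq ?mem_undup ?map_f//= eqxx big1 ?addr0// => a.
  by rewrite eq_sym => /negPf->.
- move=> a b; rewrite {1}/pi mulmx_suml.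
  have [ab|ab] := eqVneq a b.
    rewrite -ab /pi big_seq_cond [RHS]big_seq_cond; apply: eq_bigr => p /andP[pl /eqP pa].
    by rewrite p_pi// pa eqxx.
  by rewrite big1_seq// => p /andP[/eqP pa pl]; rewrite p_pi// pa (negPf ab).
- move=> a t th; rewrite /pi mulmx_suml mulmx_sumr big_seq_cond [RHS]big_seq_cond.
  by apply: eq_bigr => p /andP[/lP[[_ pc _] _ _ _] _]; apply: pc.
- move=> a t th; rewrite /pi mulmx_suml big1_seq// => p /andP[/eqP <- /lP[_ _ _]]; exact.
move=> a U Us; rewrite /pi mulmx_sumr big_seq_cond summx_sub// => p /andP[/lP[[_ _ ps] _ _ _] _].
exact: ps.
Qed.

End Existence.
End Weights.

Section NilpFacts.
Variable K : fieldType.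

Lemma nilp_expn n (A : 'M[K]_n) k : A ^+ k = 0 -> A ^+ n = 0.
Proof.
move=> Ak; have [f [B [ff fA AB [Af BA _ _]]]] := fitting A.
have cAB j : (A ^+ n *m B) ^+ j = A ^+ (n * j) *m B ^+ j.
  rewrite mulmxE exprMn_comm ?exprM//; apply: commr_sym; apply: commrX; exact: BA.
have [n0|n0] := posnP n; first exact: mx_dim0.
have := cAB k.+1; rewrite mulnS [in X in _ = X]exprD.
have -> : A ^+ (n * k) = 0 by rewrite mulnC exprM Ak expr0n gtn_eqF.
rewrite mulr0 mul0mx AB.
have idg : (1%:M - f) *m (1%:M - f) = 1%:M - f.
  by rewrite mulmxBr mulmx1 mulmxBl mul1mx ff subrr subr0.
rewrite idem_exp// => /eqP; rewrite subr_eq0 => /eqP f1.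
by rewrite -[LHS]mul1mx f1.
Qed.

Lemma nilp_eigen0 n m (u : 'M[K]_(m, n)) (A : 'M_n) (c d : K) N M :
  u *m (A - c%:M) ^+ N = 0 -> u *m (A - d%:M) ^+ M = 0 -> c != d -> u = 0.
Proof.
move=> uN uM cd; elim: N u uN uM => [|N IH] u; first by rewrite expr0 mulmx1.
rewrite exprS -mulmxE mulmxA => uN uM.
have cm : (A - c%:M) *m (A - d%:M) = (A - d%:M) *m (A - c%:M).
  apply: comm_mxB; last exact: comm_mx_scalar.
  apply: comm_mx_sym; apply: comm_mxB; last exact: comm_mx_scalar.
  exact: comm_mx_refl.
have uA : u *m (A - c%:M) = 0.
  by apply: IH => //; rewrite -mulmxA (mx_exp_comm M cm) mulmxA uM mul0mx.
have : u *m (A - d%:M) = (c - d) *: u.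
  have /eqP := uA; rewrite !mulmxBr !mul_mx_scalar subr_eq0 => /eqP->.
  by rewrite scalerBl.
move=> /(eigen_exp M); rewrite uM => /esym/eqP.
by rewrite scaler_eq0 expf_eq0 subr_eq0 (negPf cd) andbF => /eqP.
Qed.

End NilpFacts.

Section WeightDec.
Variables (K : numClosedFieldType) (g : lieAlgType K) (h : {vspace g}).
Implicit Types (t x y : g).
Notation weight := 'Hom(subvs_of h, K^o).
Implicit Types (a b c : weight).
Variables (n : nat) (rho : {linear g -> 'M[K]_n}) (s : seq weight) (pi : weight -> 'M[K]_n).
Hypothesis D : weight_dec rho s pi.

Lemma wspace_pi a : wspace rho a (pi a).
Proof. by move=> t th; exists n; apply: wdec_nil D a t th. Qed.

Lemma wspace_proj a m (v : 'M[K]_(m, n)) : wspace rho a v -> v *m pi a = v.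
Proof.
move=> va; rewrite -[RHS]mulmx1 -(wdec_sum D).
have v0 b : b != a -> v *m pi b = 0.
  move=> ba; have [t th tab] := wt_neq ba; have [N vN] := va t th.
  apply: (nilp_eigen0 (A := rho t) (N := n) (M := N) _ _ tab).
    by rewrite -mulmxA (wdec_nil D) ?mulmx0.
  rewrite -mulmxA (mx_exp_comm N (B := rho t - (wt a t)%:M)) ?mulmxA ?vN ?mul0mx//.
  by rewrite mulmxBr mulmxBl (wdec_comm D)// scalar_mxC.
have [sa|sa] := boolP (a \in s).
  rewrite (bigD1_seq a) ?(wdec_uniq D)//= mulmxDr mulmx_sumr big1 ?addr0//.
rewrite mulmx_sumr big1_seq ?(wdec0 D) ?mulmx0// => b /andP[_ bs].
by rewrite v0//; apply: contraNneq sa => <-.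
Qed.

Lemma rank_pi a : \tr (pi a) = (\rank (pi a))%:R.
Proof. by rewrite mxtrace_idem// (wdec_mul D) eqxx. Qed.

Lemma pi_comm_exp a t (X : 'M[K]_n) N : t \in h -> pi a *m X = X *m pi a ->
  pi a *m X ^+ N.+1 = (pi a *m X) ^+ N.+1.
Proof.
move=> th pX; have pp : pi a *m pi a = pi a by rewrite (wdec_mul D) eqxx.
by rewrite -[pi a *m X]/(pi a * X) exprMn_comm// (idem_exp pp).
Qed.

Lemma trace_pi a t : t \in h -> \tr (pi a *m rho t) = wt a t * (\rank (pi a))%:R.
Proof.
move=> th; set c := wt a t.
have : \tr (pi a *m (rho t - c%:M)) = 0.
  apply: (@mxtrace_nilp _ _ _ n.+1); rewrite -(pi_comm_exp _ th).
    by rewrite exprSr -mulmxE mulmxA (wdec_nil D)// mul0mx.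
  by rewrite mulmxBr mulmxBl (wdec_comm D)// scalar_mxC.
rewrite mulmxBr linearB/= mul_mx_scalar linearZ/= rank_pi => /eqP.
by rewrite subr_eq0 => /eqP.
Qed.

Lemma trace_pi_sq a t : t \in h -> \tr (pi a *m (rho t *m rho t)) = wt a t ^+ 2 * (\rank (pi a))%:R.
Proof.
move=> th; set c := wt a t; set A := rho t.
have pA : pi a *m A = A *m pi a by apply: (wdec_comm D).
have e : A *m A = (A - c%:M) *m (A + c%:M) + (c ^+ 2)%:M.
  rewrite mulmxDr !mulmxBl mul_scalar_mx mul_mx_scalar -scalar_mxM -expr2.
  by rewrite addrA !subrK.
have cm : (A - c%:M) *m (A + c%:M) = (A + c%:M) *m (A - c%:M).
  apply: comm_mxD; last exact: comm_mx_scalar.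
  apply: comm_mx_sym; apply: comm_mxB; last exact: comm_mx_scalar.
  exact: comm_mx_refl.
have : \tr (pi a *m ((A - c%:M) *m (A + c%:M))) = 0.
  apply: (@mxtrace_nilp _ _ _ n.+1); rewrite -(pi_comm_exp _ th).
    rewrite -[_ *m (A + _)]/((A - c%:M) * (A + c%:M)) exprMn_comm//.
    by rewrite exprSr -!mulmxE -mulmxA mulmxA (wdec_nil D)// !mul0mx.
  apply: comm_mxM; first by apply: comm_mxB => //; apply: comm_mx_scalar.
  by apply: comm_mxD => //; apply: comm_mx_scalar.
move=> tr0; rewrite e mulmxDr linearD/= tr0 add0r mul_mx_scalar linearZ/= rank_pi//.
Qed.

Lemma nilp_of_wt0 t : t \in h -> (forall a, pi a != 0 -> wt a t = 0) -> rho t ^+ n = 0.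
Proof.
move=> th t0; rewrite -[LHS]mul1mx -(wdec_sum D) mulmx_suml big1// => a _.
have [->|pa] := eqVneq (pi a) 0; first by rewrite mul0mx.
by have := wdec_nil D a th; rewrite t0// raddf0 subr0.
Qed.

Section Shift.
Variable r : {vspace g}.
Hypotheses (hr : (h <= r)%VS) (clr : lie_closed r) (rhoP : lie_rep r rho).

Lemma wspace_shift a b m (v : 'M[K]_(m, n)) y : y \in r -> gweight a y ->
  wspace rho b v -> wspace rho (b + a) (v *m rho y).
Proof.
move=> yr ya vb t th; have [N yN] := ya t th; have [M vM] := vb t th.
exists (N + M)%N; apply: mulmx_shift vM.
have tr := subvP hr _ th.
suff -> k : iter k (fun s => s *m (rho t - (wt (b + a) t)%:M) - (rho t - (wt b t)%:M) *m s) (rho y)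
    = rho (iter k (lie_shift a t) y) by rewrite yN linear0.
have ir k' : iter k' (lie_shift a t) y \in r.
  by elim: k' => //= k' IH; rewrite rpredB ?rpredZ// clr.
elim: k => //= k ->; move: (iter k _ y) (ir k) => z zr.
rewrite /lie_shift [RHS]linearB linearZ/= rhoP// wtD.
rewrite mulmxBr mulmxBl mul_mx_scalar mul_scalar_mx scalerDl.
by rewrite opprB opprD !addrA [X in X - _]addrAC subrK addrAC.
Qed.

Lemma pi_shift a b y : y \in r -> gweight a y ->
  pi b *m rho y = pi b *m rho y *m pi (b + a).
Proof.
by move=> yr ya; rewrite wspace_proj//; apply: wspace_shift => //; apply: wspace_pi.
Qed.

Lemma pi_shiftV a c y : y \in r -> gweight a y ->
  rho y *m pi c = pi (c - a) *m rho y.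
Proof.
move=> yr ya; rewrite -[LHS]mul1mx -(wdec_sum D) !mulmx_suml.
have other b : b != c - a -> pi b *m (rho y *m pi c) = 0.
  move=> bc; rewrite mulmxA (pi_shift _ yr ya) -mulmxA (wdec_mul D).
  by rewrite eq_sym -subr_eq eq_sym (negPf bc) mulmx0.
have same : pi (c - a) *m (rho y *m pi c) = pi (c - a) *m rho y.
  by rewrite mulmxA [RHS](pi_shift _ yr ya) subrK.
have [cs|cs] := boolP (c - a \in s).
  by rewrite (bigD1_seq (c - a)) ?(wdec_uniq D)//= big1 ?addr0.
rewrite big1_seq; first by rewrite (wdec0 D cs) mul0mx.
move=> b /andP[_ bs]; rewrite other//; apply: contraNneq cs => <-//.
Qed.

(** [rho y] shifts weights by a, and b, b + a, b + 2a, ... are distinct in characteristic 0, so they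
    leave the finite list [s]. *)
Lemma nilp_gweight a y : a != 0 -> y \in r -> gweight a y -> rho y ^+ n = 0.
Proof.
move=> a0 yr ya; apply: (@nilp_expn _ _ _ (size s).+1).
have step b k : pi b *m rho y ^+ k = rho y ^+ k *m pi (b + a *+ k).
  elim: k => [|k IH]; first by rewrite mulmx1 mul1mx addr0.
  rewrite exprSr -!mulmxE mulmxA IH -!mulmxA (pi_shiftV _ yr ya).
  by rewrite mulrSr addrA addrK.
rewrite -[LHS]mul1mx -(wdec_sum D) mulmx_suml big1// => b _.
have [k ks kb] : exists2 k, (k <= size s)%N & b + a *+ k \notin s.
  apply: contrapT => none.
  have sub : {subset [seq b + a *+ k | k <- iota 0 (size s).+1] <= s}.
    move=> c /mapP[k]; rewrite mem_iota add0n ltnS => /andP[_ ks] ->.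
    by apply/negP => /negP kb; apply: none; exists k.
  have /uniq_leq_size /(_ sub) : uniq [seq b + a *+ k | k <- iota 0 (size s).+1].
    rewrite map_inj_uniq ?iota_uniq// => i j /addrI.
    move=> /eqP; rewrite -!scaler_nat -subr_eq0 -scalerBl scaler_eq0 (negPf a0) orbF.
    by rewrite subr_eq0 eqr_nat => /eqP.
  by rewrite size_map size_iota ltnn.
rewrite -(subnKC (leqW ks)) exprD -mulmxE mulmxA step (wdec0 D kb) mulmx0 mul0mx//.
Qed.

Lemma pi_sum_comm (Q : pred weight) a y : y \in r -> gweight a y ->
  (forall c, Q (c - a) = Q c) -> let sg := \sum_(c <- s | Q c) pi c in
  sg *m rho y = rho y *m sg.
Proof.
move=> yr ya Qa sg; pose sn := \sum_(c <- s | ~~ Q c) pi c.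
have one : sg + sn = 1%:M by rewrite -(wdec_sum D) [RHS](bigID Q).
have sgn : sg *m rho y *m sn = 0.
  rewrite !mulmx_suml big1// => c Qc; rewrite mulmx_sumr big1// => d Qd.
  rewrite -mulmxA (pi_shiftV _ yr ya) mulmxA (wdec_mul D) ifN ?mul0mx//.
  by apply: contraNneq Qd => cd; rewrite -Qa -cd.
have sng : sn *m rho y *m sg = 0.
  rewrite !mulmx_suml big1// => c Qc; rewrite mulmx_sumr big1// => d Qd.
  rewrite -mulmxA (pi_shiftV _ yr ya) mulmxA (wdec_mul D) ifN ?mul0mx//.
  by apply: contraNneq Qc => ->; rewrite Qa.
rewrite -[LHS]mulmx1 -one mulmxDr sgn addr0.
by rewrite -[in RHS](mul1mx (rho y)) -one mulmxDl mulmxDl sng addr0.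
Qed.

(* The trace of [[e, f]] vanishes on the string of weight spaces through [b]
   in the direction [a], whence a rational relation between [b] and [a]. *)
Lemma weight_string a b e f : e \in r -> f \in r -> gweight a e -> gweight (- a) f ->
  'L[e, f] \in h -> pi b != 0 ->
  exists2 q : K, q \is Num.real & wt b 'L[e, f] = q * wt a 'L[e, f].
Proof.
move=> er fr ea fa efh pb0; set t := 'L[e, f].
(* The string runs over all integers k, so that the sum of its projectors commutes with both [rho e]
   and [rho f]. *)
pose on_string c := `[< exists k : int, c = b + a *~ k >].
pose sg := \sum_(c <- s | on_string c) pi c.
have os c : on_string (c - a) = on_string c.
  apply/asboolP/asboolP => -[k ck].
    by exists (k + 1); rewrite mulrzDr mulr1z addrA -ck subrK.
  by exists (k - 1); rewrite ck mulrzBr mulr1z addrA.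
have os' c : on_string (c - - a) = on_string c by rewrite -os opprK addrK.
have sge := pi_sum_comm er ea os; have sgf := pi_sum_comm fr fa os'.
have : \tr (sg *m rho t) = 0.
  rewrite rhoP// mulmxBr linearB/= mulmxA mxtrace_mulC mulmxA -sge -mulmxA.
  by rewrite subrr.
pose N := (\sum_(c <- s | on_string c) \rank (pi c))%N.
have N0 : N%:R != 0 :> K.
  have bs : b \in s by apply: contraR pb0 => /(wdec0 D)/eqP.
  rewrite pnatr_eq0; apply: contra pb0; rewrite sum_nat_seq_eq0 -mxrank_eq0.
  move=> /allP/(_ b bs)/implyP; apply; apply/asboolP; exists 0.
  by rewrite mulr0z addr0.
have [Z eZ] : exists Z : int, \tr (sg *m rho t) = wt b t * N%:R + wt a t * Z%:~R.
  rewrite /sg /N mulmx_suml linear_sum/=.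
  rewrite natr_sum mulr_sumr.
  elim: (s) => [|c l [Z IH]]; first by exists 0; rewrite !big_nil mulr0 addr0.
  rewrite !big_cons; case: ifP => [/asboolP[k ->]|_]; last by exists Z.
  exists (k * (\rank (pi (b + a *~ k)))%:Z + Z); rewrite trace_pi// IH wtD intrD intrM.
  have -> : wt (a *~ k) t = k%:~R * wt a t.
    by case: k => k; rewrite ?NegzE ?mulrNz ?wtN -!pmulrn wtMn -mulr_natl ?mulNr.
  by rewrite -[in RHS]pmulrn; ring.
rewrite eZ => /eqP; rewrite addr_eq0 -mulrN -mulrNz => /eqP /(canRL (mulfK N0)) ->.
exists ((- Z)%:~R / N%:R); last by rewrite -mulrA mulrC.
by rewrite realM// ?realV ?realn// realz.
Qed.

End Shift.
End WeightDec.

(** * The adjoint representation in matrices *)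

Section Adjoint.
Variables (K : fieldType) (g : lieAlgType K).
Implicit Types (x y z t : g).

Lemma v2r_mem (U : {vspace g}) x : (x \in U) = (v2r x <= vs2mx U)%MS.
Proof.
rewrite -[LHS]/(vs2mx (mx2vs (v2r x)) <= vs2mx U)%MS.
by rewrite mx2vsK.
Qed.

Lemma r2v_mem (U : {vspace g}) u : (r2v u \in U) = (u <= vs2mx U)%MS.
Proof. by rewrite v2r_mem r2vK. Qed.

Definition adm x : 'M[K]_(dim g) := lin1_mx (v2r \o lie x \o r2v).

Lemma mul_adm u x : u *m adm x = v2r 'L[x, r2v u].
Proof. by rewrite mul_rV_lin1. Qed.

Lemma v2r_adm x y : v2r y *m adm x = v2r 'L[x, y].
Proof. by rewrite mul_adm v2rK. Qed.

Lemma adm_is_linear : linear adm.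
Proof.
move=> a x y; apply/row_matrixP => i.
by rewrite !rowE mulmxDr -scalemxAr !mul_adm lie_is_linearl linearP.
Qed.

HB.instance Definition _ := GRing.isLinear.Build K g 'M[K]_(dim g) _ adm adm_is_linear.

Lemma mx_stable_vs (U : {vspace g}) (M : 'M[K]_(dim g)) :
  (forall x, x \in U -> (v2r x *m M <= vs2mx U)%MS) -> (vs2mx U *m M <= vs2mx U)%MS.
Proof.
move=> UM; apply/row_subP => i; rewrite row_mul -[row i _]r2vK UM// r2v_mem.
exact: row_sub.
Qed.

End Adjoint.

Section AdjointWeights.
Variables (K : numClosedFieldType) (g : lieAlgType K) (h : {vspace g}).
Implicit Types (x y z t : g).
Notation weight := 'Hom(subvs_of h, K^o).
Implicit Types (a b c : weight).

Lemma adm_rep r : lie_rep r (@adm K g).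
Proof.
move=> x y _ _; apply/row_matrixP => i; rewrite !rowE mulmxBr !mulmxA !mul_adm !v2rK.
by rewrite -linearB/= lie_leibniz addrK.
Qed.

Lemma gweightP a y : gweight a y <-> wspace (h := h) (@adm K g) a (v2r y).
Proof.
have e t k : v2r (iter k (lie_shift a t) y) = v2r y *m (adm t - (wt a t)%:M) ^+ k.
  elim: k => [|k IH]; first by rewrite mulmx1.
  rewrite exprSr -mulmxE mulmxA -IH /= mulmxBr v2r_adm mul_mx_scalar.
  by rewrite linearB linearZ.
by split=> ya t th; have [N yN] := ya t th; exists N; move: yN; rewrite -e => yN;
  [rewrite yN linear0 | apply: v2r_inj; rewrite yN linear0].
Qed.

Lemma gweight_lie a b x y : gweight a x -> gweight (h := h) b y -> gweight (b + a) 'L[x, y].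
Proof.
move=> xa /gweightP yb; apply/gweightP; rewrite -v2r_adm.
apply: (wspace_shift (r := fullv)) => //; rewrite ?subvf ?memvf//.
- by move=> ? ? _ _; rewrite memvf.
- exact: adm_rep.
Qed.

Lemma gweight_lin a (k : K) x y : gweight (h := h) a x -> gweight a y -> gweight a (k *: x + y).
Proof.
move=> xa ya t th; have [N xN] := xa t th; have [M yM] := ya t th.
have lin m u v : iter m (lie_shift a t) (k *: u + v) = k *: iter m (lie_shift a t) u + iter m (lie_shift a t) v.
  elim: m => //= m ->; rewrite /lie_shift linearP/= scalerBr !scalerDr opprD addrACA.
  by rewrite !scalerA [_ * k]mulrC.
have z m : iter m (lie_shift a t) 0 = 0.
  by elim: m => //= m ->; rewrite /lie_shift linear0 scaler0 subr0.
by exists (N + M)%N; rewrite lin [in X in X + _]addnC !iterD xN yM !z scaler0 addr0.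
Qed.

Variables (s : seq weight) (pi : weight -> 'M[K]_(dim g)).
Hypothesis D : weight_dec (@adm K g) s pi.

Definition comp a x : g := r2v (v2r x *m pi a).

Lemma comp_lin a k x y : comp a (k *: x + y) = k *: comp a x + comp a y.
Proof. by rewrite /comp linearP mulmxDl -scalemxAl linearP. Qed.

Lemma comp_sum x : \sum_(a <- s) comp a x = x.
Proof. by rewrite -[RHS]v2rK -[v2r x]mulmx1 -(wdec_sum D) mulmx_sumr linear_sum. Qed.

Lemma comp_gweight a x : gweight a (comp a x).
Proof.
apply/gweightP; rewrite /comp r2vK => t th; exists (dim g).
by rewrite -mulmxA (wdec_nil D) ?mulmx0.
Qed.

Lemma comp_id a b x : gweight a x -> comp b x = if a == b then x else 0.
Proof.
move=> /gweightP xa; rewrite /comp -(wspace_proj D xa) -mulmxA (wdec_mul D).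
by case: eqP => _; rewrite ?mulmx0 ?linear0// (wspace_proj D xa) v2rK.
Qed.

Lemma comp_mem a (U : {vspace g}) x : {in h & U, forall t y, 'L[t, y] \in U} ->
  x \in U -> comp a x \in U.
Proof.
move=> hU; rewrite r2v_mem v2r_mem => xU; apply: submx_trans (submxMr _ xU) _.
apply: (wdec_stable D) => t th; apply: mx_stable_vs => y yU.
by rewrite v2r_adm -v2r_mem hU.
Qed.

Lemma gweight_sum_ind (U : {vspace g}) (Q : g -> Prop) :
  {in h & U, forall t y, 'L[t, y] \in U} ->
  Q 0 -> (forall x y, Q x -> Q y -> Q (x + y)) ->
  (forall a x, x \in U -> gweight a x -> Q x) -> forall x, x \in U -> Q x.
Proof.
move=> hU Q0 QD Qw x xU; rewrite -(comp_sum x); apply: big_ind => // a _.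
by apply: (Qw a); [apply: comp_mem | apply: comp_gweight].
Qed.

End AdjointWeights.

(** * Cartan subalgebras and Cartan's criterion *)

Section Cartan.
Variables (K : numClosedFieldType) (g : lieAlgType K) (r h : {vspace g}).
Implicit Types (x y z t : g).
Notation weight := 'Hom(subvs_of h, K^o).
Implicit Types (a b c : weight).
Hypotheses (clr : lie_closed r) (carh : cartan_subalgebra r h).

Let hr : (h <= r)%VS. Proof. by case: carh. Qed.
Let clh : lie_closed h. Proof. by case: carh. Qed.
Let nilh : nilpotent_lie h. Proof. by case: carh. Qed.

Lemma adm_weight_dec : exists (s : seq weight) pi, weight_dec (@adm K g) s pi.
Proof.
by have := weight_dec_exists clh nilh (adm_rep (r := h)).
Qed.

Lemma gweight0_h y : y \in h -> gweight (0 : weight) y.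
Proof.
move=> yh t th; have [N tN] := nilpotent_iter nilh th yh; exists N.
by rewrite -tN; apply: eq_iter => z; rewrite /lie_shift wt0 scale0r subr0.
Qed.

(** If the zero weight space of r were larger than h, Engel's theorem for h acting on the quotient
    would give an element of r outside h that normalizes h. *)
Lemma cartan_gweight0 x : x \in r -> gweight (0 : weight) x -> x \in h.
Proof.
move=> xr x0; have [s [pi D]] := adm_weight_dec.
set n := dim g in D.
(* Multiplication by [pi 0] makes ad t nilpotent on the whole of g, as Engel's theorem is stated. *)
pose S (m : 'M[K]_n) := exists2 t, t \in h & m = pi 0 *m adm t.
have pp : pi 0 *m pi 0 = pi 0 by rewrite (wdec_mul D) eqxx.
have Snil m : S m -> m ^+ n = 0.
  move=> [t th ->]; apply: (@nilp_expn _ _ _ n.+1).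
  rewrite -(pi_comm_exp D _ th) ?(wdec_comm D)// exprSr -mulmxE mulmxA.
  by have := wdec_nil D 0 th; rewrite wt0 raddf0 subr0 => ->; rewrite mul0mx.
have Scl m m' : S m -> S m' -> S (m' *m m - m *m m').
  move=> [t th ->] [t' th' ->]; exists 'L[t, t']; first exact: clh.
  have e y y' : y \in h -> pi 0 *m adm y *m (pi 0 *m adm y') = pi 0 *m (adm y *m adm y').
    by move=> yh; rewrite mulmxA -(mulmxA (pi 0) (adm y)) -(wdec_comm D)// !mulmxA pp.
  by rewrite !e// (adm_rep (r := h))// mulmxBr.
pose W := vs2mx r *m pi 0.
have hx y : y \in h -> v2r y *m pi 0 = v2r y.
  by move=> /gweight0_h/gweightP yh; apply: (wspace_proj D).
have memW y : y \in r -> (v2r y *m pi 0 <= W)%MS by move=> yr; rewrite submxMr// -v2r_mem.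
apply: contrapT => xh.
have UW : (vs2mx h <= W)%MS.
  apply/row_subP => i; have : r2v (row i (vs2mx h)) \in h by rewrite r2v_mem row_sub.
  by move=> yh; have := memW _ (subvP hr _ yh); rewrite hx// r2vK.
have WU : ~~ (W <= vs2mx h)%MS.
  apply/negP => WU; apply: xh; rewrite v2r_mem.
  have /gweightP/(wspace_proj D) <- := x0; exact: submx_trans (memW _ xr) WU.
have [|v [vW vU vS]] := engel_jacobson Snil Scl UW WU.
  move=> _ [t th ->]; split.
    apply: mx_stable_vs => y yh; rewrite mulmxA hx// v2r_adm -v2r_mem; exact: clh.
  rewrite /W -mulmxA (mulmxA (pi 0)) pp (wdec_comm D)// mulmxA submxMr//.
  apply: mx_stable_vs => y yr; rewrite v2r_adm -v2r_mem clr//; exact: (subvP hr).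
move/negP: vU; apply; rewrite -r2v_mem.
have vp : v *m pi 0 = v.
  by rewrite idem_sub//; apply: submx_trans vW _; rewrite submxMl.
case: carh => _ _ _; apply.
  rewrite r2v_mem; apply: submx_trans vW _; apply: (wdec_stable D) => t th.
  apply: mx_stable_vs => y yr; rewrite v2r_adm -v2r_mem clr//; exact: (subvP hr).
move=> t th; rewrite lieC rpredN v2r_mem -mul_adm.
by have := vS _ (ex_intro2 _ _ t th erefl); rewrite mulmxA vp.
Qed.

Section Criterion.
Variables (I : {vspace g}) (n : nat) (rho : {linear g -> 'M[K]_n}).
Hypotheses (idI : ideal_of r I) (rhoP : lie_rep r rho).
Hypothesis trI : {in I &, forall x y, \tr (rho x *m rho y) = 0}.

Let Ir : {subset I <= r}. Proof. exact: (subvP idI.1). Qed.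
Let hI : {in h & I, forall t y, 'L[t, y] \in I}.
Proof. by move=> t y th; apply: idI.2; apply: (subvP hr). Qed.

(* The weights of [rho] vanish on brackets of opposite weight vectors of [I]:
   by [weight_string] they are real multiples of a single number, and the sum
   of their squares is [tr (rho t) ^ 2 = 0]. *)
Let string0 s pi a e f b : weight_dec rho s pi -> e \in I -> f \in I ->
  gweight (h := h) a e -> gweight (- a) f -> pi b != 0 -> wt b 'L[e, f] = 0.
Proof.
move=> D eI fI ea fa pb0; set t := 'L[e, f].
have tI : t \in I by apply: idI.2 => //; apply: Ir.
have th : t \in h.
  by apply: cartan_gweight0; [apply: Ir | rewrite -(addNr a); apply: gweight_lie].
have wstr c := weight_string D hr clr rhoP (Ir eI) (Ir fI) ea fa th (b := c).
have [a0|a0] := eqVneq (wt a t) 0.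
  by have [q _ ->] := wstr b pb0; rewrite -/t a0 mulr0.
have : \sum_(c <- s) (wt c t / wt a t) ^+ 2 * (\rank (pi c))%:R = 0.
  apply: (mulfI (x := wt a t ^+ 2)); first by rewrite expf_neq0.
  rewrite mulr0 -[RHS](trI tI tI) -[in RHS](mul1mx (_ *m _)) -(wdec_sum D).
  rewrite mulmx_suml linear_sum mulr_sumr; apply: eq_bigr => c _.
  by rewrite [RHS](trace_pi_sq D)// mulrA -exprMn mulrCA mulfV// mulr1.
have bs : b \in s by apply: contraR pb0 => /(wdec0 D)/eqP.
move=> /eqP; rewrite psumr_eq0; last first.
  move=> c _; have [->|pc] := eqVneq (pi c) 0; first by rewrite mxrank0 mulr0.
  have [q qr ->] := wstr c pc; rewrite -/t mulfK//.
  by rewrite mulr_ge0// -realEsqr.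
move=> /allP/(_ b bs); rewrite /= mulf_eq0 pnatr_eq0 mxrank_eq0 (negPf pb0) orbF.
by rewrite expf_eq0/= mulf_eq0 invr_eq0 (negPf a0) orbF => /eqP.
Qed.

(* Cartan's criterion, in the form used for both the Killing form of [g] and
   the trace forms of the modules of [r]. *)
Lemma cartan_criterion : perfect I -> {in I, forall x, rho x = 0}.
Proof.
move=> perI; have [s [pi D]] := weight_dec_exists clh nilh (lie_repS hr rhoP).
have [s' [pi' D']] := adm_weight_dec.
pose S (m : 'M[K]_n) := exists x a, [/\ x \in I, gweight (h := h) a x & m = rho x].
(* Since I = [I, I], the weight 0 component of x is a sum of brackets of opposite weight vectors of
   I, to which [string0] applies. *)
have comp0 x : x \in I -> forall b, pi b != 0 -> wt b (comp pi' 0 x) = 0.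
  rewrite -{1}perI; move: x; apply: (lie_prod_elim (Q := fun x => forall b, pi b != 0 ->
    wt b (comp pi' 0 x) = 0)) => [b _|k u v u0 v0 b pb|].
  - by rewrite /comp linear0 mul0mx linear0 /wt !linear0.
  - by rewrite comp_lin wt_lin u0 ?v0 ?mulr0 ?addr0.
  move=> y z yI zI b pb.
  have ind := gweight_sum_ind D' hI.
  have cD u v : comp pi' 0 (u + v) = comp pi' 0 u + comp pi' 0 v.
    by rewrite -[u + v]/(u + v) -[u in LHS]scale1r comp_lin scale1r.
  have wD u v : wt b (u + v) = wt b u + wt b v by rewrite -[u in LHS]scale1r wt_lin mul1r.
  have c0 : wt b (comp pi' 0 0) = 0 by rewrite /comp linear0 mul0mx linear0 /wt !linear0.
  move: y yI.
  apply: (ind _) => [|y y' yz y'z|a y yI ya]; first by rewrite lie0l.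
    by rewrite lieDl cD wD yz y'z addr0.
  move: z zI; apply: (ind _) => [|z z' yz y'z|c z zI zc]; first by rewrite linear0.
    by rewrite linearD/= cD wD yz y'z addr0.
  rewrite (comp_id D' 0 (gweight_lie ya zc)); case: eqP => [ca|_]; last by rewrite /wt !linear0.
  apply: (string0 D) ya _ pb => //; suff <- : c = - a by [].
  by apply/eqP; rewrite -addr_eq0 ca.
(* A vector of nonzero weight acts nilpotently because it shifts weights; one of weight 0 lies in h,
   and all weights of [rho] vanish on it. *)
have Snil m : S m -> m ^+ n = 0.
  move=> [x [a [xI xa ->]]]; have [a0|a0] := eqVneq a 0; last first.
    by apply: (nilp_gweight D hr clr rhoP a0 _ xa); apply: Ir.
  rewrite a0 in xa; have xh : x \in h by apply: cartan_gweight0 => //; apply: Ir.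
  apply: (nilp_of_wt0 D xh) => b pb; have := comp0 x xI b pb.
  by rewrite (comp_id D' 0 xa) eqxx.
have Scl m m' : S m -> S m' -> S (m' *m m - m *m m').
  move=> [x [a [xI xa ->]]] [y [b [yI yb ->]]]; exists 'L[x, y], (b + a); split.
  - by apply: idI.2 => //; apply: Ir.
  - exact: gweight_lie.
  - by rewrite rhoP//; apply: Ir.
have [Z [N [Z0 ZN ZS]]] := engelian_flag (engel_jacobson Snil Scl).
have deg1 x i : x \in I -> (Z i *m rho x <= Z i.-1)%MS.
  move: x; apply: (gweight_sum_ind D' hI) => [|x y xZ yZ|a x xI xa].
  - by rewrite linear0 mulmx0 sub0mx.
  - by rewrite linearD mulmxDr addmx_sub.
  case: i => [|i]; first by rewrite Z0 mul0mx sub0mx.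
  by apply: (ZS i).2; exists x, a.
(* Writing x by brackets once more lowers the flag by one more step, so perfection improves
   nilpotency to [rho x = 0]. *)
have deg k x : x \in I -> forall i, (Z i *m rho x <= Z (i - k.+1)%N)%MS.
  elim: k x => [|k IH] x; first by move=> xI i; rewrite subn1 deg1.
  rewrite -{1}perI; move: x; apply: (lie_prod_elim (Q := fun x => forall i,
    (Z i *m rho x <= Z (i - k.+2)%N)%MS)) => [i|a u v uZ vZ i|x y xI yI i].
  - by rewrite linear0 mulmx0 sub0mx.
  - by rewrite linearP mulmxDr -scalemxAr addmx_sub// scalemx_sub.
  rewrite rhoP ?Ir// mulmxBr addmx_sub ?eqmx_opp// mulmxA subnS.
    by apply: submx_trans (submxMr _ (IH _ yI i)) _; rewrite deg1.
  by apply: submx_trans (submxMr _ (IH _ xI i)) _; rewrite deg1.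
move=> x xI; apply/eqP; rewrite -submx0 -[rho x]mul1mx -Z0.
apply: submx_trans (submxMr _ ZN) _; have := deg N x xI N.
by rewrite subnS subnn.
Qed.

End Criterion.
End Cartan.

(** * Toral elements of a Cartan subalgebra *)

(** A subspace of maximal dimension inside [Q] is all of it. This lets predicates that are not
    boolean be checked on spanning sets. *)
Lemma vspace_of_prop (K : fieldType) (V : vectType K) (Q : V -> Prop) : Q 0 ->
  (forall (a : K) u v, Q u -> Q v -> Q (a *: u + v)) -> exists U : {vspace V}, forall x, x \in U <-> Q x.
Proof.
move=> Q0 QP; pose good (U : {vspace V}) := forall x, x \in U -> Q x.
have [U [gU Umax]] : exists U, good U /\ forall U', good U' -> (\dim U' <= \dim U)%N.
  pose P k := `[< exists U, good U /\ \dim U = k >].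
  have P0 : exists k, P k.
    by exists 0%N; apply/asboolP; exists 0%VS; rewrite dimv0; split=> // x; rewrite memv0 => /eqP->.
  have Pb k : P k -> (k <= \dim {:V})%N by move=> /asboolP[U [_ <-]]; rewrite dimvS// subvf.
  case: (ex_maxnP P0 Pb) => k /asboolP[U [gU Uk]] kmax; exists U; split=> // U' gU'.
  by rewrite Uk kmax//; apply/asboolP; exists U'.
exists U => x; split=> [/gU//|Qx].
have gUx : good (U + <[x]>)%VS.
  move=> _ /memv_addP[u uU [_ /vlineP[k ->] ->]].
  by rewrite addrC; apply: QP => //; apply: gU.
have /eqP -> : U == (U + <[x]>)%VS by rewrite eqEdim addvSl Umax.
by rewrite (subvP (addvSr _ _))// memv_line.
Qed.

Section Torality.
Variables (K : numClosedFieldType) (g : lieAlgType K) (B : {symmetric g}) (h : {vspace g}).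
Implicit Types (x y z t : g).
Notation weight := 'Hom(subvs_of h, K^o).
Implicit Types (a b c : weight).
Hypotheses (redg : reductive {:g}) (invB : invariant_form B) (ndB : nondegenerate B).
Hypothesis carh : cartan_subalgebra {:g} h.

Lemma formC x y : B x y = B y x.
Proof. by rewrite hermC expr0 mul1r. Qed.

Lemma form_linr z (k : K) x y : B z (k *: x + y) = k * B z x + B z y.
Proof. exact: linearPr. Qed.

Lemma form_linl z (k : K) x y : B (k *: x + y) z = k * B x z + B y z.
Proof. exact: linearPl. Qed.

Lemma form0r z : B z 0 = 0. Proof. exact: linear0r. Qed.
Lemma form0l z : B 0 z = 0. Proof. exact: linear0l. Qed.
Lemma formDl x y z : B (x + y) z = B x z + B y z. Proof. exact: linearDl. Qed.
Lemma formDr x y z : B z (x + y) = B z x + B z y. Proof. exact: linearDr. Qed.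
Lemma formZl k x z : B (k *: x) z = k * B x z. Proof. exact: linearZl_LR. Qed.
Lemma formZr k x z : B z (k *: x) = k * B z x. Proof. exact: linearZr_LR. Qed.
Lemma formNl x z : B (- x) z = - B x z. Proof. exact: linearNl. Qed.
Lemma formNr x z : B z (- x) = - B z x. Proof. exact: linearNr. Qed.

Lemma form_nondeg x : (forall y, B x y = 0) -> x = 0.
Proof.
move=> x0; apply/eqP; rewrite -memv0; have /eqP <- := ndB.
by apply/mem_orthovP => y _.
Qed.

(** By invariance, -(a + b)(t) B(x, y) = B(lie_shift a t x, y) + B(x, lie_shift b t y); induction on
    the sum of the two nilpotency orders makes the right side vanish. *)
Lemma gweight_orth a b x y : gweight a x -> gweight b y -> a + b != 0 -> B x y = 0.
Proof.
move=> xa yb ab; have [t th] := wt_neq ab; rewrite wt0 wtD => tab.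
have [N xN] := xa t th; have [M yM] := yb t th.
have [k] := ubnP (N + M)%N; elim: k N M x y xN yM {xa yb} => // k IH [|N] [|M] x y xN yM lek.
- by rewrite [x]xN form0l.
- by rewrite [x]xN form0l.
- by rewrite [y]yM form0r.
have e1 : B (lie_shift a t x) y = 0.
  by apply: (IH N M.+1); rewrite -?iterSr//; lia.
have e2 : B x (lie_shift b t y) = 0.
  by apply: (IH N.+1 M); rewrite -?iterSr//; lia.
apply: (mulfI tab); rewrite mulr0; apply/eqP; rewrite -oppr_eq0; apply/eqP.
rewrite -[RHS](addr0 0) -{1}e1 -{1}e2.
rewrite /lie_shift formDl formDr formNl formNr formZl formZr (lieC t x) formNl invB.
have key (u v p q : K) : - ((p + q) * v) = - u - p * v + (u - q * v) by ring.
exact: key.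
Qed.

Lemma invBr z x y : B x 'L[z, y] = - B 'L[z, x] y.
Proof. by rewrite -invB (lieC x z) formNl. Qed.

(** On the weight space of b a commutator has trace 0, and this trace is also the weight times the
    dimension. *)
Lemma wt_lie0 s pi b t t' : weight_dec (@adm K g) s pi -> t \in h -> t' \in h -> pi b != 0 ->
  wt b 'L[t, t'] = 0.
Proof.
move=> D th th' pb; have clh : lie_closed h by case: carh.
have := trace_pi D b (clh _ _ th th'); rewrite (adm_rep (r := h))// mulmxBr linearB/=.
have -> : \tr (pi b *m (adm t *m adm t')) = \tr (pi b *m (adm t' *m adm t)).
  by rewrite mulmxA mxtrace_mulC mulmxA -(wdec_comm D)// -mulmxA.
rewrite subrr => /esym/eqP; rewrite mulf_eq0 pnatr_eq0 mxrank_eq0 (negPf pb) orbF.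
by move=> /eqP.
Qed.

Variables (s : seq weight) (pi : weight -> 'M[K]_(dim g)).
Hypothesis D : weight_dec (@adm K g) s pi.

Let clg : lie_closed {:g}. Proof. by move=> x y _ _; apply: memvf. Qed.
Let hr : (h <= {:g})%VS. Proof. exact: subvf. Qed.

Lemma form_pair a x y : gweight a x -> B x y != 0 -> B x (comp pi (- a) y) != 0.
Proof.
move=> xa; rewrite -{1}(comp_sum D y) raddf_sum/=.
apply: contraNneq => xy0; rewrite big1// => b _.
have [->|ab] := eqVneq b (- a); first exact: xy0.
apply: (gweight_orth xa (comp_gweight D b y)); apply: contra ab.
by rewrite addrC addr_eq0 => /eqP->.
Qed.

(* The radical of the Killing form is an ideal on whose derived ideal
   [cartan_criterion] applies; hence it is abelian, and central by reductivity. *)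
Lemma wt0_central x : x \in h -> (forall b, pi b != 0 -> wt b x = 0) -> x \in lie_center {:g}.
Proof.
move=> xh x0; pose kap y z := \tr (adm y *m adm z).
have kapC y z : kap y z = kap z y by rewrite /kap mxtrace_mulC.
have kap_lin z k y y' : kap (k *: y + y') z = k * kap y z + kap y' z.
  by rewrite /kap linearP mulmxDl -scalemxAl linearP.
have [I IP] : exists I : {vspace g}, forall y, y \in I <-> forall z, kap y z = 0.
  apply: vspace_of_prop => [z|k u v u0 v0 z]; first by rewrite /kap linear0 mul0mx linear0.
  by rewrite kap_lin u0 v0 mulr0 addr0.
have idI : ideal_of {:g} I.
  split=> [|z y _ /IP y0]; first exact: subvf.
  apply/IP => w; rewrite /kap (adm_rep (r := fullv)) ?memvf// mulmxBl linearB/=.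
  have := y0 'L[w, z]; rewrite /kap (adm_rep (r := fullv)) ?memvf// mulmxBr linearB/= !mulmxA.
  by move=> <-; rewrite -(mulmxA (adm z)) (mxtrace_mulC (adm z)).
have II0 : lie_prod I I = 0%VS.
  have perI := reductive_perfect redg idI; have idI' := ideal_lie_prod idI.
  have tr0 : {in lie_prod I I &, forall y z, \tr (@adm K g y *m adm z) = 0}.
    by move=> y z /(subvP (ideal_lie_sub idI))/IP y0 _; apply: y0.
  have ad0 := cartan_criterion clg carh idI' (adm_rep (r := fullv)) tr0 perI.
  apply/eqP; rewrite -subv0 -[X in (X <= _)%VS]perI; apply: lie_prod_ind => y z yI zI.
  by rewrite memv0 -[_ == _](inj_eq (@v2r_inj _ _)) -v2r_adm ad0// mulmx0 linear0.
apply: (subvP (abelian_ideal_center redg idI II0)); apply/IP => y.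
apply: (gweight_sum_ind D (U := fullv) (Q := fun y => kap x y = 0) _ _ _ _ (memvf y)) => [? ? _ _||u v xu xv|a {}y _ ya].
- exact: memvf.
- by rewrite /kap linear0 mulmx0 linear0.
- by rewrite kapC -[u]scale1r kap_lin mul1r -!(kapC x) xu xv addr0.
have [a0|a0] := eqVneq a 0.
  have yh : y \in h by apply: (cartan_gweight0 clg carh) => //; [exact: memvf | rewrite -a0].
  (* On h the form [kap] is the sum of the squares of the weights, which does not change when x is
     added to y; polarization gives kap x y = 0. *)
  have q t : t \in h -> kap t t = \sum_(b <- s) wt b t ^+ 2 * (\rank (pi b))%:R.
    move=> th; rewrite /kap -[X in \tr X]mul1mx -(wdec_sum D) mulmx_suml linear_sum/=.
    by apply: eq_bigr => b _; rewrite (trace_pi_sq D).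
  have qxy : kap (x + y) (x + y) = kap y y.
    rewrite !q ?rpredD//; apply: eq_bigr => b _; have [->|pb] := eqVneq (pi b) 0.
      by rewrite mxrank0 !mulr0.
    by rewrite -[x]scale1r wt_lin x0// mulr0 add0r.
  have qx : kap x x = 0.
    rewrite q// big1// => b _; have [->|pb] := eqVneq (pi b) 0; first by rewrite mxrank0 mulr0.
    by rewrite x0// expr0n mul0r.
  have kD u v w : kap (u + v) w = kap u w + kap v w by rewrite -[u in LHS]scale1r kap_lin mul1r.
  move: qxy; rewrite kD kapC kD [kap y (x + y)]kapC kD qx add0r (kapC y x) addrA => /eqP.
  by rewrite -subr_eq0 addrK -mulr2n mulrn_eq0 => /eqP.
(* For a nonzero, ad x preserves weights and ad y shifts them by a, so the diagonal blocks of the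
   product have trace 0. *)
rewrite /kap -[X in \tr X]mul1mx -(wdec_sum D) mulmx_suml linear_sum/= big1// => b _.
have e : pi b *m (adm x *m adm y) = pi b *m (adm x *m adm y) *m pi (b + a).
  rewrite mulmxA (wdec_comm D)// -!mulmxA; congr (_ *m _); rewrite mulmxA.
  by apply: (pi_shift D hr clg (adm_rep (r := fullv))); rewrite ?memvf.
rewrite -[pi b](idem_exp (k := 2)) ?expr2//; last by rewrite (wdec_mul D) eqxx.
rewrite -[_ * _]/(pi b *m pi b) -mulmxA mxtrace_mulC e -(mulmxA _ (pi (b + a))) (wdec_mul D) ifN ?mulmx0 ?linear0//.
by rewrite -subr_eq0 addrAC subrr add0r.
Qed.

(** Engel's theorem for the operators ad t - b(t) on the weight space of b. They are closed under
    commutators because b vanishes on [h, h]. *)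
Lemma weight_eigenvector b : pi b != 0 -> exists2 f, f != 0 &
  forall t, t \in h -> 'L[t, f] = wt b t *: f.
Proof.
move=> pb; set n := dim g.
have clh : lie_closed h by case: carh.
pose S (m : 'M[K]_n) := exists2 t, t \in h & m = pi b *m (adm t - (wt b t)%:M).
have pp : pi b *m pi b = pi b by rewrite (wdec_mul D) eqxx.
have pc t : t \in h -> pi b *m (adm t - (wt b t)%:M) = (adm t - (wt b t)%:M) *m pi b.
  by move=> th; rewrite mulmxBr mulmxBl (wdec_comm D)// scalar_mxC.
have Snil m : S m -> m ^+ n = 0.
  move=> [t th ->]; apply: (@nilp_expn _ _ _ n.+1).
  rewrite -(pi_comm_exp D _ th) ?pc// exprSr -mulmxE mulmxA.
  by rewrite (wdec_nil D)// mul0mx.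
have Scl m m' : S m -> S m' -> S (m' *m m - m *m m').
  move=> [t th ->] [t' th' ->]; exists 'L[t, t']; first exact: clh.
  have e y y' : y \in h -> pi b *m (adm y - (wt b y)%:M) *m (pi b *m (adm y' - (wt b y')%:M)) =
      pi b *m ((adm y - (wt b y)%:M) *m (adm y' - (wt b y')%:M)).
    by move=> yh; rewrite mulmxA -(mulmxA (pi b)) -pc// !mulmxA pp.
  rewrite !e// (wt_lie0 D)// raddf0 subr0 (adm_rep (r := h))// -mulmxBr; congr (_ *m _).
  rewrite !mulmxBl !mulmxBr !mul_scalar_mx !mul_mx_scalar !scale_scalar_mx [wt b t' * _]mulrC.
  have zm (V : zmodType) (x y u v w : V) : x - u - (v - w) - (y - v - (u - w)) = x - y.
    have -> : x - u - (v - w) = x - (u + (v - w)) by rewrite -addrA -opprD.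
    have -> : y - v - (u - w) = y - (u + (v - w)) by rewrite -addrA -opprD addrCA.
    by rewrite opprB addrA subrK.
  exact: zm.
have pb1 : ~~ (pi b <= (0 : 'M_n))%MS by rewrite submx0.
have [|v [vW vU vS]] := engel_jacobson Snil Scl (sub0mx _ _) pb1.
  move=> _ [t th ->]; rewrite mul0mx; split; first by rewrite sub0mx.
  by rewrite mulmxA pp pc// submxMl.
pose f : g := @r2v _ g v.
exists f; first by move: vU; rewrite submx0; apply: contraNneq => v0;
    have := congr1 (@v2r _ g) v0; rewrite r2vK linear0 => ->.
move=> t th; apply: v2r_inj; rewrite -v2r_adm linearZ/= r2vK.
have := vS _ (ex_intro2 _ _ t th erefl); rewrite submx0 mulmxA (idem_sub pp vW).
by rewrite mulmxBr mul_mx_scalar subr_eq0 => /eqP.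
Qed.

Lemma pi_neg a : pi a != 0 -> pi (- a) != 0.
Proof.
move=> pa; have [x x0 ex] := weight_eigenvector pa.
have xa : gweight a x.
  by move=> t th; exists 1%N; rewrite /= /lie_shift ex// subrr.
have [y Bxy] : exists y, B x y != 0.
  apply: contrapT => nB; move/eqP: x0; apply; apply: form_nondeg => y.
  by apply/eqP; apply: contrapT => /negP Bxy; apply: nB; exists y.
have := form_pair xa Bxy; apply: contraNneq => pa0.
by rewrite /comp pa0 mulmx0 linear0 form0r.
Qed.

(* The trace of [[e, f]] on [K f + h + g^a + g^(2a) + ...], a subspace stable
   under [e] and [f], is [a([e, f]) (-1 + dim g^a + 2 dim g^(2a) + ...)]. *)
Lemma rank_pi_le1 a : a != 0 -> (\rank (pi a) <= 1)%N.
Proof.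
move=> a0; have [->|pa] := eqVneq (pi a) 0; first by rewrite mxrank0.
have [f f0 fe] := weight_eigenvector (pi_neg pa).
have fa : gweight (- a) f.
  by move=> t th; exists 1%N; rewrite /= /lie_shift fe// subrr.
have [e ea Bfe] : exists2 e, gweight a e & B f e = 1.
  have [y Bfy] : exists y, B f y != 0.
    apply: contrapT => nB; move/eqP: f0; apply; apply: form_nondeg => y.
    by apply/eqP; apply: contrapT => /negP Bxy; apply: nB; exists y.
  have := form_pair fa Bfy; rewrite opprK; set e' := comp pi a y => Be.
  exists ((B f e')^-1 *: e'); last by rewrite formZr mulVf.
  rewrite -[_ *: _]addr0; apply: gweight_lin; first exact: (comp_gweight D).
  by move=> t th; exists 0%N.
set t := 'L[e, f].
have th : t \in h.
  apply: (cartan_gweight0 clg carh); first exact: memvf.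
  by rewrite -(addNr a); apply: gweight_lie.
have Bt y : y \in h -> B t y = wt a y.
  move=> yh; rewrite /t invB lieC formNr fe// formZr wtN mulNr opprK formC Bfe.
  by rewrite mulr1.
(* If a(t) = 0, every weight vanishes at t by [weight_string], so t is central; being also a bracket
   it is 0, against B(t, y) = a(y). *)
have at0 : wt a t != 0.
  apply/negP => /eqP at0; have tc : t \in lie_center {:g}.
    apply: wt0_central => // b pb.
    have [q _ ->] := weight_string D hr clg (adm_rep (r := fullv)) (memvf e) (memvf f) ea fa th pb.
    by rewrite -/t at0 mulr0.
  have t0 : t = 0.
    by apply: (reductive_center redg clg tc); apply: mem_lie_prod; apply: memvf.
  move/eqP: a0; apply; apply: wt_inj => y yh.
  by rewrite -Bt// t0 form0l wt0.
pose Q c := `[< exists k : nat, c = a *+ k >].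
pose C : 'cV[K]_(dim g) := \col_i B (r2v (row i 1%:M)) e.
have vC y : v2r y *m C = (B y e)%:M.
  rewrite -[y in RHS]v2rK [in RHS](row_sum_delta (v2r y)) linear_sum/=.
  have -> : B (\sum_i r2v (v2r y 0 i *: delta_mx 0 i)) e = \sum_i v2r y 0 i * B (r2v (row i 1%:M)) e.
    elim/big_rec2: _ => [|i u v _ IH]; first by rewrite form0l.
    by rewrite formDl linearZ/= formZl IH row1.
  apply/matrixP => i j; rewrite !ord1 !mxE eqxx mulr1n; apply: eq_bigr => k _.
  by rewrite mxE.
pose sg := C *m v2r f + \sum_(c <- s | Q c) pi c.
have sgE y : r2v (v2r y *m sg) = B y e *: f + \sum_(c <- s | Q c) comp pi c y.
  rewrite mulmxDr mulmxA vC mul_scalar_mx linearD/= linearZ/= v2rK; congr (_ + _).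
  by rewrite mulmx_sumr linear_sum.
pose X y := v2r y *m sg = v2r y.
have Xlin k u v : X u -> X v -> X (k *: u + v).
  by rewrite /X => Xu Xv; rewrite linearP/= mulmxDl -scalemxAl Xu Xv.
have Xw k z : gweight (a *+ k) z -> X z.
  move=> zk; apply: (@r2v_inj _ g); rewrite sgE v2rK.
  rewrite (gweight_orth zk ea) ?scale0r ?add0r; last first.
    rewrite addrC -mulrS -scaler_nat scaler_eq0 pnatr_eq0 negb_or a0 andbT //.
  rewrite -[RHS](comp_sum D) [RHS](bigID Q)/= [X in _ = _ + X]big1 ?addr0// => c Qc.
  rewrite (comp_id D c zk) ifN//; apply: contraNneq Qc => <-.
  by apply/asboolP; exists k.
have Xf : X f.
  apply: (@r2v_inj _ g); rewrite sgE v2rK Bfe scale1r big1 ?addr0// => c /asboolP[k ->].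
  rewrite (comp_id D _ fa) ifN// -subr_eq0 -opprD oppr_eq0 -mulrS.
  by rewrite -scaler_nat scaler_eq0 pnatr_eq0 negb_or a0 andbT.
have Xsg y (Y : g -> Prop) : (forall k u v, Y u -> Y v -> Y (k *: u + v)) -> Y f ->
    (forall k z, gweight (a *+ k) z -> Y z) -> Y (r2v (v2r y *m sg)).
  move=> Ylin Yf Yw; rewrite sgE; apply: (Ylin _) => //.
  have Y0 : Y 0 by apply: (Yw 0%N); move=> u uh; exists 0%N.
  apply: (big_ind Y) => //; first by move=> u v Yu Yv; rewrite -[u]scale1r; apply: Ylin.
  by move=> c /asboolP[k ->]; apply: (Yw k); apply: (comp_gweight D).
have sgsE : sg *m adm e *m sg = sg *m adm e.
  apply/row_matrixP => i; rewrite !rowE !mulmxA -[delta_mx _ _]r2vK.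
  rewrite -[v2r _ *m sg]r2vK v2r_adm.
  apply: (Xsg _ (fun y => X 'L[e, y])) => [k u v Xu Xv||k z zk].
  - by rewrite linearP; apply: Xlin.
  - by apply: (Xw 0%N); rewrite mulr0n; apply: (gweight0_h carh).
  by apply: (Xw k.+1); rewrite mulrSr; apply: gweight_lie.
have sgsF : sg *m adm f *m sg = sg *m adm f.
  apply/row_matrixP => i; rewrite !rowE !mulmxA -[delta_mx _ _]r2vK.
  rewrite -[v2r _ *m sg]r2vK v2r_adm.
  apply: (Xsg _ (fun y => X 'L[f, y])) => [k u v Xu Xv||[|k] z zk].
  - by rewrite linearP; apply: Xlin.
  - by rewrite liexx; apply: (Xw 0%N) => u uh; exists 0%N.
  - rewrite lieC fe ?wtN; last by apply: (cartan_gweight0 clg carh) => //; apply: memvf.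
    by rewrite scaleNr opprK -[_ *: f]addr0; apply: Xlin => //; apply: (Xw 0%N) => u uh; exists 0%N.
  by apply: (Xw k); have := gweight_lie fa zk; rewrite mulrSr addrK.
have tr0 : \tr (sg *m adm t) = 0.
  rewrite (adm_rep (r := fullv)) ?memvf// mulmxBr linearB/= !mulmxA.
  by rewrite -sgsE -sgsF -!(mulmxA (sg *m _)) mxtrace_mulC !mulmxA subrr.
have [N Na eN] : exists2 N : nat, (\rank (pi a) <= N)%N &
    \sum_(c <- s | Q c) \tr (pi c *m adm t) = wt a t * N%:R.
  have sa : a \in s by apply: contraR pa => /(wdec0 D)/eqP.
  have : exists2 N : nat, ((if a \in s then \rank (pi a) else 0) <= N)%N &
    \sum_(c <- s | Q c) \tr (pi c *m adm t) = wt a t * N%:R; last by rewrite sa.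
  elim: (s) => [|c l [N Na eN]]; first by exists 0%N; rewrite // big_nil mulr0.
  rewrite big_cons inE; case: (boolP (Q c)) => [/asboolP[k ck]|Qc]; last first.
    exists N => //; have [ac|//] := eqVneq a c.
    by move/negP: Qc; case; apply/asboolP; exists 1%N; rewrite -ac.
  exists (k * \rank (pi c) + N)%N; last first.
    have wc : wt c t = wt a t * k%:R by rewrite ck wtMn mulr_natr.
    by rewrite (trace_pi D)// eN wc natrD natrM; ring.
  have [ac|ac]/= := eqVneq a c; last by apply: leq_trans Na _; rewrite leq_addl.
  have k0 : (0 < k)%N by rewrite lt0n; apply: contra a0 => /eqP k0; rewrite ac ck k0 mulr0n.
  by rewrite -ac; apply: leq_trans (leq_addr _ _); rewrite leq_pmull.
move: tr0; rewrite /sg mulmxDl linearD/= -mulmxA v2r_adm fe// linearZ/= -scalemxAr linearZ/=.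
rewrite mxtrace_mulC vC Bfe mxtrace1 mulr1n mulr1 wtN mulmx_suml linear_sum/= eN.
move=> /eqP; rewrite -[X in - X + _]mulr1 -mulrN -mulrDr mulf_eq0 (negPf at0)/=.
by rewrite addrC subr_eq0 pnatr_eq1 => /eqP <-.
Qed.

Lemma gweight_line a x y : a != 0 -> gweight a x -> gweight a y -> x != 0 -> exists k, y = k *: x.
Proof.
move=> a0 xa ya x0; have /gweightP/(wspace_proj D) xp := xa; have /gweightP/(wspace_proj D) yp := ya.
have xs : (v2r x <= pi a)%MS by rewrite -xp submxMl.
have px : (pi a <= v2r x)%MS.
  have := mxrank_leqif_sup xs => /leqifP; case: ifP => // _ lt.
  have := leq_trans lt (rank_pi_le1 a0); rewrite ltnS leqn0 mxrank_eq0 => /eqP vx.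
  by case/eqP: x0; apply: v2r_inj; rewrite vx linear0.
have /sub_rVP[k yk] : (v2r y <= v2r x)%MS by rewrite -yp (submx_trans _ px)// submxMl.
by exists k; apply: v2r_inj; rewrite yk linearZ.
Qed.

(** For a nonzero the weight space is a line, where ad t is a scalar and equals its generalized
    eigenvalue. For a = 0 it is h, which is abelian: all weights vanish on [t, x], which is then
    central and a bracket, hence 0. *)
Lemma toral_eigen a x t : gweight a x -> t \in h -> 'L[t, x] = wt a t *: x.
Proof.
move=> xa th; have clh : lie_closed h by case: carh.
have [a0|a0] := eqVneq a 0.
  have xh : x \in h by apply: (cartan_gweight0 clg carh); [exact: memvf | rewrite -a0].
  rewrite a0 wt0 scale0r; apply: (reductive_center redg clg).
    by apply: wt0_central => [|b pb]; [exact: clh | exact: (wt_lie0 D)].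
  by apply: mem_lie_prod; exact: memvf.
have [->|x0] := eqVneq x 0; first by rewrite linear0 scaler0.
have txa : gweight a 'L[t, x].
  by rewrite -[a]addr0; apply: gweight_lie => //; apply: (gweight0_h carh).
have [k tx] := gweight_line a0 xa txa x0; rewrite tx.
have [N] := xa t th; have -> : iter N (lie_shift a t) x = (k - wt a t) ^+ N *: x.
  elim: N => [|N /= ->]; first by rewrite expr0 scale1r.
  by rewrite /lie_shift linearZ/= tx !scalerA -scalerBl exprSr; congr (_ *: _); ring.
by move=> /eqP; rewrite scaler_eq0 (negPf x0) orbF expf_eq0 subr_eq0 => /andP[_ /eqP->].
Qed.

End Torality.

(** * Root spaces *)

Section SeqSpaces.
Variables (K : fieldType) (V : vectType K) (I : eqType).
Implicit Types (l : seq I) (Q : pred I) (F : I -> {vspace V}) (U : {vspace V}).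

Lemma sumv_seq_sup l Q F i : i \in l -> Q i -> (F i <= \sum_(j <- l | Q j) F j)%VS.
Proof.
elim: l => // j l IH; rewrite inE big_cons => /orP[/eqP <- Qi|il Qi].
  by rewrite Qi addvSl.
by case: ifP => _; [apply: subv_trans (addvSr _ _) | ]; apply: IH.
Qed.

Lemma sumv_seq_sub l Q F U : (forall i, i \in l -> Q i -> (F i <= U)%VS) ->
  (\sum_(j <- l | Q j) F j <= U)%VS.
Proof.
elim: l => [|j l IH] FU; first by rewrite big_nil sub0v.
rewrite big_cons; have IH' : (\sum_(j <- l | Q j) F j <= U)%VS.
  by apply: IH => i il; apply: FU; rewrite inE il orbT.
by case: ifP => // Qj; rewrite subv_add IH' FU// mem_head.
Qed.

Lemma mem_bigcapv_seq l F x : reflect (forall i, i \in l -> x \in F i) (x \in \bigcap_(i <- l) F i)%VS.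
Proof.
apply: (iffP idP); elim: l => [|j l IH]; rewrite ?big_nil ?memvf//.
  rewrite big_cons memv_cap => /andP[xj xl] i; rewrite inE => /orP[/eqP->//|].
  exact: IH.
move=> H; rewrite big_cons memv_cap H ?mem_head//=; apply: IH => i il; apply: H.
by rewrite inE il orbT.
Qed.

End SeqSpaces.

Section RootSpaces.
Variables (K : numClosedFieldType) (g : lieAlgType K) (B : {symmetric g}).
Variables (r : lieSubalg g) (h : {vspace g}) (P : seq 'Hom(subvs_of h, K^o)).
Implicit Types (x y z t : g).
Notation weight := 'Hom(subvs_of h, K^o).
Implicit Types (a b c : weight).
Hypotheses (redg : reductive {:g}) (invB : invariant_form B) (ndB : nondegenerate B).
Hypothesis ndr : (r :&: orthov B r)%VS = 0%VS.
Hypotheses (carg : cartan_subalgebra {:g} h) (carr : cartan_subalgebra r h).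
Hypothesis posP : positive_system P.

Let clr : lie_closed r := @lsubalgP _ _ r.
Let clg : lie_closed {:g}. Proof. by move=> x y _ _; apply: memvf. Qed.
Let hr : {subset h <= r}. Proof. by apply/subvP; case: carr. Qed.

Lemma root_space_eigen a x : x \in root_space a <-> forall t, t \in h -> 'L[t, x] = wt a t *: x.
Proof.
have e t : (x \in passmx.leigenspace (linfun (lie t)) (wt a t)) = ('L[t, x] == wt a t *: x).
  by rewrite memv_ker add_lfunE opp_lfunE scale_lfunE id_lfunE lfunE/= subr_eq0.
split=> [/mem_bigcapv_seq xa t th|xa]; last first.
  by apply/mem_bigcapv_seq => t /vbasis_mem th; rewrite e xa.
have xb t' : t' \in vbasis h -> 'L[t', x] = wt a t' *: x by move=> /xa; rewrite e => /eqP.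
rewrite (coord_vbasis th) lieC linear_sum -sumrN /wt.
rewrite linear_sum/= linear_sum/= scaler_suml; apply: eq_bigr => i _.
rewrite [in LHS]linearZ/= -scalerN -lieC xb; last by rewrite mem_nth// size_tuple.
by rewrite /wt [in RHS]linearZ/= [in RHS]linearZ/= scalerA.
Qed.

(** By torality the root spaces of the statement, made of eigenvectors, are the generalized weight
    spaces of the preceding theory. *)
Lemma root_spaceP a x : x \in root_space a <-> gweight a x.
Proof.
have [s [pi D]] := adm_weight_dec carg.
split=> [/root_space_eigen xa t th|xa].
  by exists 1%N; rewrite /= /lie_shift xa// subrr.
by apply/root_space_eigen => t th; apply: (toral_eigen redg invB ndB carg D xa th).
Qed.

Lemma weight_ind (U : {vspace g}) (Q : g -> Prop) :
  {in h & U, forall t y, 'L[t, y] \in U} ->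
  Q 0 -> (forall x y, Q x -> Q y -> Q (x + y)) ->
  (forall a x, x \in U -> x \in root_space a -> Q x) -> forall x, x \in U -> Q x.
Proof.
move=> hU Q0 QD Qw; have [s [pi D]] := adm_weight_dec carg.
by apply: (gweight_sum_ind D hU) => // a x xU /root_spaceP; apply: Qw.
Qed.

Lemma root_space0 x : x \in root_space (0 : weight) -> x \in h.
Proof. by move=> /root_spaceP; apply: (cartan_gweight0 clg carg); apply: memvf. Qed.

Lemma root_space_line a x y : a != 0 -> x \in root_space a -> y \in root_space a -> x != 0 ->
  exists k, y = k *: x.
Proof.
move=> a0 /root_spaceP xa /root_spaceP ya; have [s [pi D]] := adm_weight_dec carg.
exact: (gweight_line redg invB ndB carg D a0 xa ya).
Qed.

Lemma form_root_pair a x y (U : {vspace g}) : {in h & U, forall t y, 'L[t, y] \in U} ->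
  x \in root_space a -> y \in U -> B x y != 0 ->
  exists z, [/\ z \in U, z \in root_space (- a) & B x z != 0].
Proof.
move=> hU /root_spaceP xa yU Bxy; have [s [pi D]] := adm_weight_dec carg.
exists (comp pi (- a) y); split; first exact: (comp_mem D _ hU yU).
  by apply/root_spaceP; apply: (comp_gweight D).
exact: (form_pair invB ndB D xa Bxy).
Qed.

Lemma hr_stable : {in h & r, forall t y, 'L[t, y] \in r}.
Proof. by move=> t y th yr; apply: clr => //; apply: hr. Qed.

Lemma hrperp_stable : {in h & rperp B r, forall t y, 'L[t, y] \in rperp B r}.
Proof.
move=> t y th /mem_orthovP yr; apply/mem_orthovP => z zr.
by rewrite lieC formNl invB yr ?oppr0// hr_stable.
Qed.

Lemma form_r_nondeg x : x \in r -> x != 0 -> exists2 y, y \in r & B x y != 0.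
Proof.
move=> xr x0; apply: contrapT => nB; move/eqP: x0; apply; apply/eqP.
rewrite -memv0 -ndr memv_cap xr; apply/mem_orthovP => y yr.
by apply/eqP; apply: contrapT => /negP Bxy; apply: nB; exists y.
Qed.

Definition off_root a := (root_space a :&: r == 0)%VS.

Lemma off_rootP a : reflect (forall x, x \in root_space a -> x \in r -> x = 0) (off_root a).
Proof.
apply: (iffP eqP) => [E x xa xr|H].
  by apply/eqP; rewrite -memv0 -E memv_cap xa.
by apply/eqP; rewrite -subv0; apply/subvP => x; rewrite memv_cap memv0 => /andP[/H xr /xr->].
Qed.

(** B is nondegenerate on r and pairs weight -a with weight a only, so a nonzero vector of weight -a
    in r has a partner of weight a in r. *)
Lemma off_rootN a : off_root a -> off_root (- a).
Proof.
move=> /off_rootP oa; apply/off_rootP => y ya yr; apply/eqP; apply: contrapT => /negP y0.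
have [z zr Byz] := form_r_nondeg yr y0.
have [w [wr]] := form_root_pair hr_stable ya zr Byz; rewrite opprK => wa Byw.
by move/negP: Byw; apply; rewrite (oa w)// form0r eqxx.
Qed.

Lemma off_root_rperp a x : off_root a -> x \in root_space a -> x \in rperp B r.
Proof.
move=> oa xa; apply/mem_orthovP => y yr; apply/eqP; apply: contrapT => /negP Bxy.
have [w [wr wa Bxw]] := form_root_pair hr_stable xa yr Bxy.
by move/negP: Bxw; apply; have /off_rootP H := off_rootN oa; rewrite (H w)// form0r eqxx.
Qed.

(** A nonzero root space is a line, so it lies in r as soon as it meets r; the zero weight space is
    h, which lies in r since the Cartan subalgebra is common. *)
Lemma on_root_r a x : ~~ off_root a -> x \in root_space a -> x \in r.
Proof.
have [->|a0] := eqVneq a 0; first by move=> _ /root_space0 /hr.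
move=> na xa; have [y [ya yr y0]] : exists y, [/\ y \in root_space a, y \in r & y != 0].
  apply: contrapT => ny; move/negP: na; apply; apply/off_rootP => y ya yr.
  by apply/eqP; apply: contrapT => /negP y0; apply: ny; exists y.
by have [k ->] := root_space_line a0 ya xa y0; rewrite rpredZ.
Qed.

Lemma rperp_root a x : x \in root_space a -> x \in rperp B r -> x != 0 -> off_root a.
Proof.
move=> xa xp x0; apply: contraT => /on_root_r/(_ xa) xr; move: x0.
by rewrite -memv0 -ndr memv_cap xr xp.
Qed.

Lemma off_root_neq0 a x : x \in root_space a -> x != 0 -> off_root a -> a != 0.
Proof.
move=> xa x0 /off_rootP oa; apply: contraNneq x0 => a0; apply/eqP; apply: oa => //.
by apply: hr; apply: root_space0; rewrite -a0.
Qed.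

Lemma off_root_sum a x : x \in root_space a -> off_root a -> x \in (splus P r + sminus P r)%VS.
Proof.
move=> xa oa; have [->|x0] := eqVneq x 0; first exact: mem0v.
have a0 := off_root_neq0 xa x0 oa; case: posP => _ negP _.
have ra : is_root a by rewrite /is_root a0; apply: contraNneq x0 => E; rewrite -memv0 -E.
have [aP|aP] := boolP (a \in P).
  apply: (subvP (addvSl _ _)); exact: (subvP (sumv_seq_sup (Q := off_root) (fun a => root_space a) aP oa)).
apply: (subvP (addvSr _ _)).
have naP : - a \in P by move: aP; rewrite (negP a)// negbK.
apply: (subvP (sumv_seq_sup (Q := off_root) (fun a => root_space (- a)) naP (off_rootN oa))).
by rewrite opprK.
Qed.

Lemma rperp_splus_sminus : (rperp B r <= splus P r + sminus P r)%VS.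
Proof.
apply/subvP; apply: (weight_ind hrperp_stable) => [|x y|a x xp xa].
- exact: mem0v.
- exact: rpredD.
have [->|x0] := eqVneq x 0; first exact: mem0v.
exact: off_root_sum xa (rperp_root xa xp x0).
Qed.

Lemma splus_rperp : (splus P r <= rperp B r)%VS.
Proof. by apply: sumv_seq_sub => a _ oa; apply/subvP => x; apply: off_root_rperp. Qed.

Lemma sminus_rperp : (sminus P r <= rperp B r)%VS.
Proof.
by apply: sumv_seq_sub => a _ /off_rootN oa; apply/subvP => x; apply: off_root_rperp.
Qed.

Lemma h_root_stable a : {in h & root_space a, forall t y, 'L[t, y] \in root_space a}.
Proof. by move=> t y th ya; have /root_space_eigen/(_ t th) -> := ya; rewrite rpredZ. Qed.

Lemma sumv_stable (I : eqType) (l : seq I) (Q : pred I) (F : I -> {vspace g}) t :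
  (forall i y, y \in F i -> 'L[t, y] \in F i) ->
  forall y, y \in (\sum_(i <- l | Q i) F i)%VS -> 'L[t, y] \in (\sum_(i <- l | Q i) F i)%VS.
Proof.
move=> FS y yF; set U := (\sum_(i <- l | Q i) F i)%VS.
suff : y \in (linfun (lie t) @^-1: U)%VS by rewrite -memv_preim lfunE.
apply: (subvP _ _ yF); apply: sumv_seq_sub => i il Qi; apply/subvP => z zF.
by rewrite -memv_preim lfunE/=; apply: (subvP (sumv_seq_sup F il Qi)); apply: FS.
Qed.

Lemma h_splus : {in h & splus P r, forall t y, 'L[t, y] \in splus P r}.
Proof. by move=> t y th; apply: sumv_stable => a z; apply: h_root_stable. Qed.

Lemma h_sminus : {in h & sminus P r, forall t y, 'L[t, y] \in sminus P r}.
Proof. by move=> t y th; apply: sumv_stable => a z; apply: h_root_stable. Qed.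

Lemma splus_isotropic : {in splus P r &, forall x y, B x y = 0}.
Proof.
move=> x y xs; apply: (mem_orthovP (V := splus P r)); apply: (subvP _ _ xs).
apply: sumv_seq_sub => a aP oa; rewrite orthov_sym; apply: sumv_seq_sub => b bP ob.
apply/orthovP => u v /root_spaceP ub /root_spaceP va.
have [s [pi D]] := adm_weight_dec carg.
apply: (gweight_orth invB ndB ub va); apply/negP => ba.
have [rP nP _] := posP; have /eqP ab : b == - a by rewrite -addr_eq0.
have := nP a (rP _ aP); rewrite aP -ab bP//.
Qed.

Lemma splus_nondeg x : x \in splus P r -> {in sminus P r, forall y, B y x = 0} -> x = 0.
Proof.
move=> xs xm; apply: (form_nondeg ndB) => z; rewrite formC.
have xp := subvP splus_rperp _ xs.
apply: (weight_ind (U := fullv) (Q := fun z => B z x = 0)) (memvf z) => [? ? _ _||u v ux vx|a {}z _ za].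
- exact: memvf.
- exact: form0l.
- by rewrite formDl ux vx addr0.
have [oa|na] := boolP (off_root a); last first.
  by rewrite formC; apply: (mem_orthovP xp); apply: on_root_r na za.
have /memv_addP[u us [v vs ->]] := off_root_sum za oa.
by rewrite formDl (splus_isotropic us xs) xm// addr0.
Qed.

(** The pairing of the two halves is nondegenerate on [splus], so a right inverse of its Gram matrix
    yields dual vectors in [sminus]. They serve as annihilation operators on the spin module. *)
Lemma sminus_dual_basis : exists y : 'I_(\dim (splus P r)) -> g,
  (forall i, y i \in sminus P r) /\
  forall u, u \in splus P r -> u = \sum_i B (y i) u *: (vbasis (splus P r))`_i.
Proof.
set n := \dim _; set m := \dim (sminus P r).
set e := vbasis (splus P r); set f := vbasis (sminus P r).
pose M : 'M[K]_(n, m) := \matrix_(k, j) B f`_j e`_k.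
have sumB z (k : nat) (v : 'I_k -> K) (w : seq g) : B z (\sum_(i < k) v i *: w`_i) = \sum_(i < k) v i * B z w`_i.
  by elim/big_rec2: _ => [|i p q _ IH]; rewrite ?form0r// form_linr IH.
have sumBl z (k : nat) (v : 'I_k -> K) (w : seq g) : B (\sum_(i < k) v i *: w`_i) z = \sum_(i < k) v i * B w`_i z.
  by rewrite formC sumB; apply: eq_bigr => i _; rewrite formC.
have ebasis : basis_of (splus P r) e := vbasisP _.
have freeM : row_free M.
  apply: inj_row_free => v vM.
  pose u := \sum_i v 0 i *: e`_i.
  have us : u \in splus P r by apply: rpred_sum => i _; rewrite rpredZ// vbasis_mem// mem_nth// size_tuple.
  have u0 : u = 0.
    apply: (splus_nondeg us) => y ys; rewrite (coord_vbasis ys) sumBl big1// => j _.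
    have := congr1 (fun A : 'rV_m => A 0 j) vM; rewrite !mxE => vMj.
    rewrite sumB (_ : \sum_i _ = 0) ?mulr0// -[RHS]vMj; apply: eq_bigr => i _.
    by rewrite mxE.
  apply/rowP => i; rewrite mxE; move/freeP: (basis_free ebasis); apply; exact: u0.
have [N MN] := row_freeP freeM.
pose y i := \sum_(j < m) N j i *: f`_j.
have yd (i k : 'I_n) : B (y i) e`_k = (k == i)%:R.
  have := congr1 (fun A : 'M_n => A k i) MN; rewrite !mxE => <-.
  by rewrite sumBl; apply: eq_bigr => j _; rewrite !mxE mulrC.
exists y; split=> [i|u us]; first by apply: rpred_sum => j _; rewrite rpredZ// vbasis_mem// mem_nth// size_tuple.
rewrite {1}(coord_vbasis us); apply: eq_bigr => i _; congr (_ *: _).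
rewrite [in RHS](coord_vbasis us) sumB (bigD1 i)//= yd eqxx mulr1 big1 ?addr0// => k ki.
by rewrite yd (negPf ki) mulr0.
Qed.

End RootSpaces.

(** * Complete reducibility *)

Section Restriction.
Variable K : fieldType.

(** Coordinates on the image of an idempotent: an operator A commuting with e restricts to it as R A
    L. *)
Lemma idem_factor n (e : 'M[K]_n) : e *m e = e ->
  exists (L : 'M[K]_(n, \rank e)) (R : 'M[K]_(\rank e, n)), L *m R = e /\ R *m L = 1%:M.
Proof.
move=> ee; exists (col_base e), (row_base e); split; first exact: mulmx_base.
apply: (row_free_inj (row_base_free e)); apply: (row_full_inj (col_base_full e)).
by rewrite mul1mx -mulmxA mulmx_base mulmxA mulmx_base.
Qed.

Lemma idem_rank_lt n (e : 'M[K]_n) : e *m e = e -> e != 1%:M -> (\rank e < n)%N.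
Proof.
move=> ee e1; rewrite ltn_neqAle rank_leq_row andbT; apply: contra e1 => eu.
have eU : e \in unitmx by rewrite -row_free_unit.
by apply/eqP; rewrite -(mulKmx eU e) ee mulVmx.
Qed.

Variables (n k : nat) (L : 'M[K]_(n, k)) (R : 'M[K]_(k, n)).
Hypothesis RL : R *m L = 1%:M.

Lemma restrict_R (A : 'M[K]_n) : L *m R *m A = A *m (L *m R) -> R *m A = R *m A *m L *m R.
Proof. by move=> cA; rewrite -!mulmxA -cA !mulmxA RL mul1mx. Qed.

Lemma restrict_L (A : 'M[K]_n) : L *m R *m A = A *m (L *m R) -> A *m L = L *m (R *m A *m L).
Proof. by move=> cA; rewrite !mulmxA cA -!mulmxA RL mulmx1. Qed.

End Restriction.

Section Cohomology.
Variables (K : numClosedFieldType) (g : lieAlgType K).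
Implicit Types (x y z : g).

(** Invariance of the canonical tensor of two dual bases, seen through an arbitrary bilinear [F]. It
    serves for the Casimir element, for the vector that contracts a cocycle, and for the linear term
    of the Dirac operator. *)
Lemma casimir_invariant (V : lmodType K) (F : g -> g -> V) (T : g -> g) d (b e : 'I_d -> g)
    (M : 'I_d -> 'I_d -> K) :
  (forall z, linear (F z)) -> (forall z, linear (F ^~ z)) ->
  (forall i, T (b i) = \sum_j M i j *: b j) ->
  (forall i, T (e i) = - \sum_j M j i *: e j) ->
  \sum_i (F (T (b i)) (e i) + F (b i) (T (e i))) = 0.
Proof.
move=> Fr Fl Tb Te.
have Fr0 z : F z 0 = 0 by have := Fr z (-1) 0 0; rewrite !scaleN1r !addNr.
have Fl0 z : F 0 z = 0 by have := Fl z (-1) 0 0; rewrite !scaleN1r !addNr.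
have FrZ z k u : F z (k *: u) = k *: F z u by rewrite -[k *: u]addr0 Fr Fr0 addr0.
have FlZ z k u : F (k *: u) z = k *: F u z by rewrite -[k *: u]addr0 Fl Fl0 addr0.
have FrD z u v : F z (u + v) = F z u + F z v by rewrite -[u]scale1r Fr !scale1r.
have FlD z u v : F (u + v) z = F u z + F v z by rewrite -[u]scale1r Fl !scale1r.
have FrS z (u : 'I_d -> g) : F z (\sum_j u j) = \sum_j F z (u j).
  by elim/big_rec2: _ => [|j p q _ <-]; rewrite ?Fr0 ?FrD.
have FlS z (u : 'I_d -> g) : F (\sum_j u j) z = \sum_j F (u j) z.
  by elim/big_rec2: _ => [|j p q _ <-]; rewrite ?Fl0 ?FlD.
rewrite big_split/=.
have -> : \sum_i F (T (b i)) (e i) = \sum_i \sum_j M i j *: F (b j) (e i).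
  by apply: eq_bigr => i _; rewrite Tb FlS; apply: eq_bigr => j _; rewrite FlZ.
have -> : \sum_i F (b i) (T (e i)) = - \sum_i \sum_j M j i *: F (b i) (e j).
  rewrite -sumrN; apply: eq_bigr => i _; rewrite Te -scaleN1r FrZ scaleN1r FrS.
  by congr (- _); apply: eq_bigr => j _; rewrite FrZ.
by rewrite [X in - X]exchange_big/= subrr.
Qed.

Variables (r h : {vspace g}).
Hypotheses (clr : lie_closed r) (redr : reductive r) (carh : cartan_subalgebra r h).

Let idr : ideal_of r r. Proof. by split. Qed.

Lemma restrict_rep n k (L : 'M[K]_(n, k)) (R : 'M[K]_(k, n)) (rho : {linear g -> 'M[K]_n}) :
  R *m L = 1%:M -> lie_rep r rho ->
  {in r, forall x, L *m R *m rho x = rho x *m (L *m R)} ->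
  lie_rep r (mulmxr L \o (mulmx R \o rho)).
Proof.
move=> RL rhoP cR x y xr yr /=; rewrite rhoP// mulmxBr mulmxBl !mulmxA.
by rewrite -(restrict_R RL (cR _ yr)) -(restrict_R RL (cR _ xr)).
Qed.

Lemma rep_trivial n (rho : {linear g -> 'M[K]_n}) : lie_rep r rho ->
  {in lie_center r, forall z, rho z = 0} -> {in r &, forall x y, \tr (rho x *m rho y) = 0} ->
  {in r, forall x, rho x = 0}.
Proof.
move=> rhoP rhoZ tr0 x xr.
have [c cZ [d dr ->]] := reductive_sum redr clr xr.
rewrite linearD rhoZ// add0r.
apply: (cartan_criterion clr carh (ideal_lie_prod idr) rhoP) dr; last exact: reductive_perfect redr idr.
by move=> u v /(subvP (ideal_lie_sub idr)) ur /(subvP (ideal_lie_sub idr)); apply: tr0.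
Qed.

(* Whitehead's lemma: the Casimir element of the trace form contracts the
   cocycle on the Fitting component where it is invertible. *)
Lemma whitehead n (rho : {linear g -> 'M[K]_n}) (dl : {linear g -> 'rV[K]_n}) :
  lie_rep r rho -> {in r &, forall x y, dl 'L[x, y] = dl y *m rho x - dl x *m rho y} ->
  {in lie_center r, forall z, rho z = 0} -> {in lie_center r, forall z, dl z = 0} ->
  exists q, {in r, forall x, dl x = q *m rho x}.
Proof.
have [m] := ubnP n; elim: m n rho dl => // m IH n rho dl; rewrite ltnS => nm rhoP dlP rhoZ dlZ.
pose beta x y := \tr (rho x *m rho y).
have betaC x y : beta x y = beta y x by rewrite /beta mxtrace_mulC.
have beta_lin z k x y : beta z (k *: x + y) = k * beta z x + beta z y.
  by rewrite /beta linearP mulmxDr -scalemxAr linearP.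
have beta0 z : beta z 0 = 0 by rewrite /beta linear0 mulmx0 linear0.
have beta_inv z x y : z \in r -> x \in r -> y \in r -> beta 'L[z, x] y = - beta x 'L[z, y].
  move=> zr xr yr; rewrite /beta !rhoP// mulmxBl mulmxBr !linearB/= !mulmxA opprB.
  by rewrite -(mulmxA (rho z)) (mxtrace_mulC (rho z)).
have [k0 k0P] : exists k0 : {vspace g}, forall x, x \in k0 <-> (x \in r /\ forall y, y \in r -> beta x y = 0).
  apply: vspace_of_prop => [|k u v [ur u0] [vr v0]].
    by split=> [|y yr]; rewrite ?mem0v// betaC beta0.
  split=> [|y yr]; first by rewrite rpredD ?rpredZ.
  by rewrite betaC beta_lin !(betaC y) u0 ?v0// mulr0 addr0.
have idk : ideal_of r k0.
  split; first by apply/subvP => x /k0P[].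
  move=> z x zr /k0P[xr x0]; apply/k0P; split=> [|y yr]; first exact: clr.
  by rewrite beta_inv// x0 ?oppr0//; apply: clr.
(* [J] is complementary to the radical [k0] of the trace form, which is therefore nondegenerate on
   [J]; the Casimir element is formed from dual bases of [J] alone. *)
have [J [[Jr JJ] sJ dJ]] := redr idk.
have Jr' := subvP Jr.
set d := \dim J; set b := vbasis J.
have bJ (i : 'I_d) : b`_i \in J by rewrite vbasis_mem// mem_nth// size_tuple.
have [J0|J0] := eqVneq J 0%VS.
  have rho0 : {in r, forall x, rho x = 0}.
    apply: rep_trivial => // x y; rewrite -{1}sJ J0 addv0 => /k0P[_ x0]; exact: x0.
  exists 0 => x xr; rewrite mul0mx.
  have [c cZ [y yr ->]] := reductive_sum redr clr xr.
  rewrite linearD dlZ// add0r; move: y yr; apply: lie_prod_elim.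
  - by rewrite linear0.
  - by move=> k u v u0 v0; rewrite linearP u0 v0 scaler0 addr0.
  - by move=> u v ur vr; rewrite dlP// !rho0// !mulmx0 subrr.
have betaS z (v : 'I_d -> K) (w : 'I_d -> g) : beta z (\sum_i v i *: w i) = \sum_i v i * beta z (w i).
  by elim/big_rec2: _ => [|i p q _ IHs]; rewrite ?beta0// beta_lin IHs.
pose G := \matrix_(i < d, j < d) beta b`_i b`_j.
have G_unit : G \in unitmx.
  rewrite -row_free_unit; apply: inj_row_free => v vG.
  pose u := \sum_i v 0 i *: b`_i.
  have uJ : u \in J by apply: rpred_sum => i _; rewrite rpredZ.
  have uk : u \in k0.
    apply/k0P; split=> [|y]; first exact: Jr'.
    rewrite -{1}sJ => /memv_addP[c /k0P[cr c0] [w wJ ->]].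
    rewrite -[c]scale1r beta_lin [beta u c]betaC c0 ?mulr0 ?add0r; last exact: Jr'.
    rewrite (coord_vbasis wJ) betaS big1// => j _; rewrite betaC betaS.
    have := congr1 (fun A : 'rV_d => A 0 j) vG; rewrite !mxE => E.
    rewrite (_ : \sum_i _ = 0) ?mulr0// -[RHS]E; apply: eq_bigr => i _.
    by rewrite mxE betaC.
  have u0 : u = 0 by apply/eqP; rewrite -memv0 -dJ memv_cap uk.
  by apply/rowP => i; rewrite mxE; move/freeP: (basis_free (vbasisP J)); apply; exact: u0.
pose e i := \sum_(k < d) (invmx G) k i *: b`_k.
have eJ i : e i \in J by apply: rpred_sum => k _; rewrite rpredZ.
have be (i j : 'I_d) : beta b`_i (e j) = (i == j)%:R.
  have := congr1 (fun A : 'M_d => A i j) (mulmxV G_unit); rewrite !mxE => <-.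
  by rewrite /e betaS; apply: eq_bigr => k _; rewrite !mxE mulrC.
have exb u : u \in J -> u = \sum_j beta u (e j) *: b`_j.
  move=> uJ; rewrite {1}(coord_vbasis uJ); apply: eq_bigr => i _; congr (_ *: _).
  rewrite [in RHS](coord_vbasis uJ) betaC betaS (bigD1 i)//= betaC be eqxx mulr1.
  by rewrite big1 ?addr0// => j ji; rewrite betaC be (negPf ji) mulr0.
have exe u : u \in J -> u = \sum_(j < d) beta b`_j u *: e j.
  move=> uJ; set v := \sum_(j < d) _; apply/eqP; rewrite -subr_eq0.
  have wJ : u - v \in J by rewrite rpredB// rpred_sum// => j _; rewrite rpredZ.
  rewrite [u - v](exb _ wJ) big1// => j _.
  rewrite [e j]/e betaS big1 ?scale0r// => i _; rewrite betaC.
  rewrite -[u]scale1r addrC -scaleN1r beta_lin /v betaS (bigD1 i)//= be eqxx mulr1.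
  rewrite big1 ?addr0 => [|k ki]; last by rewrite be eq_sym (negPf ki) mulr0.
  by rewrite scale1r mulN1r addNr mulr0.
pose M x (i j : 'I_d) := beta 'L[x, b`_i] (e j).
have cas (V : lmodType K) (F : g -> g -> V) x : x \in r -> (forall z, linear (F z)) -> (forall z, linear (F ^~ z)) ->
  \sum_(i < d) (F 'L[x, b`_i] (e i) + F b`_i 'L[x, e i]) = 0.
  move=> xr Fr Fl; apply: (casimir_invariant (T := lie x) (b := fun i => b`_i) (M := M x)) => //= i.
    by apply: exb; apply: JJ.
  rewrite [LHS]exe ?JJ// -sumrN; apply: eq_bigr => j _; rewrite /M (beta_inv _ _ _ xr (Jr' _ (bJ j)) (Jr' _ (eJ i))).
  by rewrite scaleNr opprK.
pose Om := \sum_(i < d) rho (e i) *m rho b`_i.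
(* The trace is the nonzero dimension of [J], so [Om] is not nilpotent and its Fitting null
   component is proper: the induction decreases. *)
have trOm : \tr Om = d%:R.
  rewrite linear_sum/= (eq_bigr (fun=> 1)) ?sumr_const ?card_ord// => i _.
  by rewrite mxtrace_mulC; have := be i i; rewrite eqxx.
have d0 : d != 0%N by rewrite dimv_eq0.
have Omc x : x \in r -> rho x *m Om = Om *m rho x.
  move=> xr; apply/eqP; rewrite eq_sym -subr_eq0; apply/eqP.
  rewrite -[RHS](cas _ (fun u v => rho v *m rho u) x xr) => [|z k u v|z k u v]; first last.
  - by rewrite linearP mulmxDr -scalemxAr.
  - by rewrite linearP mulmxDl -scalemxAl.
  rewrite /Om mulmx_sumr mulmx_suml -sumrB; apply: eq_bigr => i _.
  rewrite (rhoP _ _ xr (Jr' _ (bJ i))) (rhoP _ _ xr (Jr' _ (eJ i))).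
  by rewrite mulmxBr mulmxBl !mulmxA addrA subrK.
(* The Casimir element with one factor replaced by the cocycle; where [Om] is invertible, [w]
   divided by [Om] is the vector sought. *)
pose w := \sum_(i < d) dl (e i) *m rho b`_i.
have wx x : x \in r -> w *m rho x = dl x *m Om.
  move=> xr; apply/eqP; rewrite -subr_eq0; apply/eqP.
  rewrite -[RHS](cas _ (fun u v => dl v *m rho u) x xr) => [|z k u v|z k u v]; first last.
  - by rewrite linearP mulmxDr -scalemxAr.
  - by rewrite linearP mulmxDl -scalemxAl.
  rewrite /w /Om mulmx_sumr mulmx_suml -sumrB; apply: eq_bigr => i _.
  rewrite (rhoP _ _ xr (Jr' _ (bJ i))) (dlP _ _ xr (Jr' _ (eJ i))).
  by rewrite mulmxBr mulmxBl !mulmxA addrA subrK.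
have [f [Bm [ff fA AB [Af BA _ cfB]]]] := fitting Om.
have fR x : x \in r -> rho x *m f = f *m rho x by move=> xr; have [] := cfB _ (Omc x xr).
have f1 : f != 1%:M.
  apply: contra d0 => /eqP f1; have := trOm; rewrite (@mxtrace_nilp _ _ _ n); last first.
    by rewrite -fA f1 mul1mx.
  by move=> /esym/eqP; rewrite pnatr_eq0.
have [L [R [LR RL]]] := idem_factor ff.
have kn := idem_rank_lt ff f1.
have cR : {in r, forall x, L *m R *m rho x = rho x *m (L *m R)}.
  by move=> x xr; rewrite LR fR.
have [|||z zZ|z zZ|q qP] := IH _ (mulmxr L \o (mulmx R \o rho)) (mulmxr L \o dl).
- exact: leq_trans kn nm.
- exact: restrict_rep.
- move=> x y xr yr /=; rewrite dlP// mulmxBl; congr (_ - _); rewrite -mulmxA.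
    by rewrite [in LHS](restrict_L RL (cR _ xr)) !mulmxA.
  by rewrite [in LHS](restrict_L RL (cR _ yr)) !mulmxA.
- by rewrite /= rhoZ// mulmx0 mul0mx.
- by rewrite /= dlZ// mul0mx.
have n0 : (0 < n)%N by apply: leq_ltn_trans kn.
(* On the component 1 - f = Om^n Bm the inverse of [Om] is Om^(n-1) Bm, which gives the first term.
   The second is the solution obtained by induction on the image of f, where [Om] is nilpotent. *)
exists (w *m Om ^+ n.-1 *m Bm + q *m R) => x xr.
have [OmB OmP] : rho x *m Bm = Bm *m rho x /\ rho x *m Om ^+ n.-1 = Om ^+ n.-1 *m rho x.
  by split; [have [] := cfB _ (Omc x xr) | apply: mx_exp_comm; apply: Omc].
rewrite mulmxDl -mulmxA -OmB mulmxA -(mulmxA w) -OmP mulmxA wx//.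
rewrite -(mulmxA (dl x)) mulmxE -exprS prednK// -(mulmxA (dl x)) AB.
rewrite -(mulmxA q) (restrict_R RL (cR _ xr)) !mulmxA.
have := qP x xr; rewrite /= !mulmxA => <-.
by rewrite -mulmxA LR mulmxBr mulmx1 subrK.
Qed.

End Cohomology.

(** * Irreducible representations and Weyl's theorem *)

Lemma mk_linear (K : fieldType) (V W : lmodType K) (f : V -> W) : linear f ->
  exists F : {linear V -> W}, F =1 f.
Proof.
by move=> fl; exists (HB.pack f (GRing.isLinear.Build K V W _ f fl) : {linear V -> W}).
Qed.

(** Irreducible modules as matrices acting on row vectors. [imx] is linear on all of g, but only its
    values on r are constrained. *)
Record irrep (K : numClosedFieldType) (g : lieAlgType K) (r : {vspace g}) := Irrep {
  idim : nat;
  imx : {linear g -> 'M[K]_idim};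
  irr_rep : lie_rep r imx;
  irr_gt0 : (0 < idim)%N;
  irr_simple : forall U : 'M[K]_idim, {in r, forall x, stablemx U (imx x)} -> U = 0 \/ row_full U
}.

Record summand (K : numClosedFieldType) (g : lieAlgType K) (r : {vspace g}) n
    (rho : g -> 'M[K]_n) := Summand {
  sm_irr :> irrep r;
  sm_in : 'M[K]_(idim sm_irr, n);
  sm_out : 'M[K]_(n, idim sm_irr);
  sm_inK : sm_in *m sm_out = 1%:M;
  sm_inP : {in r, forall x, sm_in *m rho x = imx sm_irr x *m sm_in};
  sm_outP : {in r, forall x, rho x *m sm_out = sm_out *m imx sm_irr x}
}.

Section Weyl.
Variables (K : numClosedFieldType) (g : lieAlgType K) (r h : {vspace g}).
Hypotheses (clr : lie_closed r) (redr : reductive r) (carh : cartan_subalgebra r h).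
Implicit Types (x y z : g).

Lemma split_basis n (U : 'M[K]_n) : exists (u w : nat) (PU : 'M[K]_(u, n)) (PW : 'M[K]_(w, n))
    (QU : 'M[K]_(n, u)) (QW : 'M[K]_(n, w)),
  [/\ (PU :=: U)%MS, PU *m QU = 1%:M, PU *m QW = 0, PW *m QU = 0 &
      PW *m QW = 1%:M /\ QU *m PU + QW *m PW = 1%:M].
Proof.
pose PU := row_base U; pose PW := row_base U^C%MS.
pose P := col_mx PU PW.
have rkP : \rank P = n.
  apply/eqP; rewrite eqn_leq rank_leq_col -[X in (X <= _)%N](mxrank1 K n) mxrankS//.
  rewrite /P -addsmxE submx_full// -sub1mx.
  by rewrite (adds_eqmx (eq_row_base _) (eq_row_base _)) sub1mx addsmx_compl_full.
have n_eq : (\rank U + \rank U^C = n)%N by rewrite mxrank_compl subnKC// rank_leq_row.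
have /row_freeP[Q PQ] : row_free P by rewrite /row_free rkP n_eq.
have QP : Q *m P = 1%:M.
  have /row_fullP[C CP] : row_full P by rewrite /row_full rkP.
  suff -> : Q = C by [].
  by rewrite -[C]mulmx1 -PQ mulmxA CP mul1mx.
have QP' : lsubmx Q *m PU + rsubmx Q *m PW = 1%:M by rewrite -mul_row_col hsubmxK.
have PQ' : P *m row_mx (lsubmx Q) (rsubmx Q) = 1%:M by rewrite hsubmxK.
exists _, _, PU, PW, (lsubmx Q), (rsubmx Q); move: PQ'.
rewrite /P mul_col_row scalar_mx_block => /eq_block_mx[e1 e2 e3 e4].
by split=> //; apply: eq_row_base.
Qed.

(** In a basis adapted to U the representation is block triangular, with diagonal blocks A and D and
    corner E. The corner is a cocycle for the action F -> F A - D F, on which the center acts by 0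
    because it has the same scalar on both blocks. Whitehead's lemma gives F with E = F A - D F, and
    shearing the projector by F makes it commute with r. *)
Lemma stable_projector n (rho : {linear g -> 'M[K]_n}) (U : 'M[K]_n) : lie_rep r rho ->
  {in lie_center r, forall z, exists c, rho z = c%:M} ->
  {in r, forall x, stablemx U (rho x)} ->
  exists p : 'M[K]_n, [/\ p *m p = p, (p :=: U)%MS & {in r, forall x, p *m rho x = rho x *m p}].
Proof.
move=> rhoP rhoZ stU; have [u [w [PU [PW [QU [QW [eqU e11 e12 e21 [e22 e1]]]]]]]] := split_basis U.
pose A x := PU *m rho x *m QU; pose D x := PW *m rho x *m QW; pose E x := PW *m rho x *m QU.
have UW x : x \in r -> PU *m rho x *m QW = 0.
  move=> xr; have /submxP[Y ->] : (PU *m rho x <= PU)%MS by rewrite !(eqmxMr _ eqU, eqU) stU.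
  by rewrite -mulmxA e12 mulmx0.
have insert m1 m2 (X : 'M[K]_(m1, n)) (Y : 'M[K]_(n, m2)) x y : X *m (rho y *m rho x) *m Y =
    X *m rho y *m QU *m (PU *m rho x *m Y) + X *m rho y *m QW *m (PW *m rho x *m Y).
  rewrite -[rho y in LHS]mulmx1 -e1 mulmxDr mulmxDl mulmxDr mulmxDl.
  by rewrite !mulmxA.
have Al x y : x \in r -> y \in r -> A 'L[x, y] = A y *m A x - A x *m A y.
  by move=> xr yr; rewrite /A rhoP// mulmxBr mulmxBl !insert !UW// !mul0mx !addr0.
have Dl x y : x \in r -> y \in r -> D 'L[x, y] = D y *m D x - D x *m D y.
  by move=> xr yr; rewrite /D rhoP// mulmxBr mulmxBl !insert !UW// !mulmx0 !add0r.
have El x y : x \in r -> y \in r ->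
    E 'L[x, y] = E y *m A x + D y *m E x - (E x *m A y + D x *m E y).
  by move=> xr yr; rewrite /E rhoP// mulmxBr mulmxBl !insert.
have [sg sgE] : exists sg : {linear g -> 'M[K]_(w * u)}, forall x,
    sg x = lin_mulmxr (A x) - lin_mulmx (D x).
  apply: mk_linear => k x y; have lA : A (k *: x + y) = k *: A x + A y.
    by rewrite /A linearP mulmxDr -scalemxAr mulmxDl -scalemxAl.
  have lD : D (k *: x + y) = k *: D x + D y.
    by rewrite /D linearP mulmxDr -scalemxAr mulmxDl -scalemxAl.
  apply/row_matrixP => i; rewrite !rowE -[delta_mx _ _]vec_mxK; set F := vec_mx _.
  have TE z : mxvec F *m (lin_mulmxr (A z) - lin_mulmx (D z)) = mxvec (F *m A z - D z *m F).
    by rewrite mulmxBr !mul_vec_lin/= linearB.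
  rewrite [RHS]mulmxDr -scalemxAr !TE lA lD -linearP/=; congr mxvec.
  by rewrite mulmxDr mulmxDl -scalemxAr -scalemxAl scalerBr opprD addrACA.
have [dl dlE] : exists dl : {linear g -> 'rV[K]_(w * u)}, forall x, dl x = mxvec (E x).
  apply: mk_linear => k x y; rewrite /E linearP mulmxDr -scalemxAr mulmxDl -scalemxAl.
  by rewrite linearP.
have sgv F x : mxvec F *m sg x = mxvec (F *m A x - D x *m F).
  by rewrite sgE mulmxBr !mul_vec_lin/= linearB.
have ZA z : z \in lie_center r -> [/\ E z = 0 & exists c, A z = c%:M /\ D z = c%:M].
  move=> /rhoZ[c zc]; rewrite /E /A /D zc !mul_mx_scalar -!scalemxAl e21 e11 e22 scaler0.
  by split=> //; exists c; rewrite !scalemx1.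
have [x y xr yr|x y xr yr|z zZ|z zZ|q qP] := whitehead clr redr carh (rho := sg) (dl := dl).
- apply/row_matrixP => i; rewrite !rowE -[delta_mx _ _]vec_mxK; set F := vec_mx _.
  rewrite mulmxBr !mulmxA !sgv -linearB/=; congr mxvec; rewrite Al// Dl//.
  rewrite !mulmxBl !mulmxBr !mulmxA.
  move: (F *m A y *m A x) (F *m A x *m A y) (D y *m D x *m F) (D x *m D y *m F)
    (D y *m F *m A x) (D x *m F *m A y) => p1 p2 p3 p4 p5 p6.
  by apply/matrixP => i' j'; rewrite !mxE; ring.
- rewrite !dlE !sgv -linearB/= El//; congr mxvec.
  move: (E y *m A x) (D y *m E x) (E x *m A y) (D x *m E y) => p1 p2 p3 p4.
  by apply/matrixP => i' j'; rewrite !mxE; ring.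
- apply/row_matrixP => i; rewrite !rowE -[delta_mx _ _]vec_mxK mulmx0 sgv.
  by have [_ [c [-> ->]]] := ZA z zZ; rewrite scalar_mxC subrr linear0.
- by rewrite dlE; have [-> _] := ZA z zZ; rewrite linear0.
pose F := vec_mx q.
have EF x : x \in r -> E x = F *m A x - D x *m F.
  by move=> xr; apply: (can_inj mxvecK); rewrite -dlE qP// -[q]vec_mxK sgv.
exists ((QU + QW *m F) *m PU).
have PQ : PU *m (QU + QW *m F) = 1%:M by rewrite mulmxDr e11 mulmxA e12 mul0mx addr0.
split.
- by rewrite -mulmxA (mulmxA PU) PQ mul1mx.
- apply/eqmxP/andP; split; first by rewrite -eqU submxMl.
  have UPU : (U <= PU)%MS by rewrite eqU.
  by apply: submx_trans UPU _; apply/submxP; exists PU; rewrite mulmxA PQ mul1mx.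
move=> x xr.
have UA : PU *m rho x = A x *m PU.
  by rewrite -[LHS]mulmx1 -e1 mulmxDr !mulmxA UW// mul0mx addr0.
have rQU : rho x *m QU = QU *m A x + QW *m E x.
  by rewrite -[LHS]mul1mx -e1 mulmxDl /A /E !mulmxA.
have rQW : rho x *m QW = QW *m D x.
  rewrite -[LHS]mul1mx -e1 mulmxDl -!mulmxA (mulmxA PU) UW// mulmx0 add0r.
  by rewrite /D !mulmxA.
rewrite -mulmxA UA mulmxA [RHS]mulmxA; congr (_ *m _).
rewrite mulmxDr rQU (mulmxA (rho x)) rQW mulmxDl EF//.
move: (A x) (D x) => Ax Dx; rewrite mulmxBr -addrA; congr (_ + _).
by rewrite !mulmxA subrK.
Qed.

Definition completely_reducible n (rho : g -> 'M[K]_n) := exists l : seq (summand r rho),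
  \sum_(s <- l) sm_out s *m sm_in s = 1%:M /\
  pairwise (fun s t => (sm_in s *m sm_out t == 0) && (sm_in t *m sm_out s == 0)) l.

(** The matrices of the list need not be idempotent or independent; in this weak form the property
    passes to summands and tensor products by plain multiplication. *)
Definition diagonalizable_center n (rho : g -> 'M[K]_n) := {in lie_center r, forall z,
  exists l : seq (K * 'M[K]_n), \sum_(p <- l) p.2 = 1%:M /\
    forall p, p \in l -> p.2 *m rho z = p.1 *: p.2}.

Lemma completely_reducible_split n (rho : {linear g -> 'M[K]_n}) (e : 'M[K]_n) :
  lie_rep r rho -> e *m e = e -> {in r, forall x, e *m rho x = rho x *m e} ->
  diagonalizable_center rho ->
  (forall m (sg : {linear g -> 'M[K]_m}), (m = \rank e \/ m = \rank (1%:M - e)) -> lie_rep r sg ->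
    diagonalizable_center sg -> completely_reducible sg) ->
  completely_reducible rho.
Proof.
move=> rhoP ee ec dz cr.
(* Membership is expressed by [List.In] because [summand] carries no decidable equality. *)
have part (f : 'M[K]_n) : f *m f = f -> {in r, forall x, f *m rho x = rho x *m f} ->
   (\rank f = \rank e \/ \rank f = \rank (1%:M - e)) ->
   exists l : seq (summand r rho), \sum_(s <- l) sm_out s *m sm_in s = f /\
     (forall s, List.In s l -> sm_in s *m f = sm_in s /\ f *m sm_out s = sm_out s) /\
     pairwise (fun s t => (sm_in s *m sm_out t == 0) && (sm_in t *m sm_out s == 0)) l.
  move=> ff fc; move: (idem_factor ff); move: (\rank f) => k [L [R [LR RL]]] rf.
  have cR : {in r, forall x, L *m R *m rho x = rho x *m (L *m R)} by move=> x xr; rewrite LR fc.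
  have [||l [l1 lo]] := cr _ (mulmxr L \o (mulmx R \o rho)) rf.
  - exact: restrict_rep.
  - move=> z zZ; have [l [l1 lz]] := dz z zZ; exists [seq (p.1, R *m p.2 *m L) | p <- l].
    rewrite big_map -mulmx_suml -mulmx_sumr l1 mulmx1 RL; split=> // _ /mapP[p pl ->] /=.
    have /lie_centerP[zr _] := zZ.
    have sE : L *m (R *m rho z *m L) = rho z *m L by rewrite [RHS](restrict_L RL (cR _ zr)).
    by rewrite -(mulmxA _ L) sE mulmxA -(mulmxA R) lz// -scalemxAr -scalemxAl.
  have fL : f *m L = L by rewrite -LR -mulmxA RL mulmx1.
  have Rf : R *m f = R by rewrite -LR mulmxA RL mul1mx.
  have lift1 (s : summand r (mulmxr L \o (mulmx R \o rho))) :
      (sm_in s *m R) *m (L *m sm_out s) = 1%:M.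
    by rewrite mulmxA -(mulmxA _ R) RL mulmx1 sm_inK.
  have lift2 (s : summand r (mulmxr L \o (mulmx R \o rho))) :
      {in r, forall x, sm_in s *m R *m rho x = imx s x *m (sm_in s *m R)}.
    move=> x xr; rewrite mulmxA -(sm_inP s xr)/= -mulmxA [in LHS](restrict_R RL (cR _ xr)).
    by rewrite !mulmxA.
  have lift3 (s : summand r (mulmxr L \o (mulmx R \o rho))) :
      {in r, forall x, rho x *m (L *m sm_out s) = L *m sm_out s *m imx s x}.
    move=> x xr; rewrite mulmxA (restrict_L RL (cR _ xr)) -!mulmxA; congr (_ *m _).
    by rewrite !mulmxA; apply: sm_outP.
  pose lift s := Summand (lift1 s) (lift2 s) (lift3 s).
  exists [seq lift s | s <- l]; split; last split.
  - rewrite big_map /= -[RHS]LR -[L in RHS]mulmx1 -l1 mulmx_sumr mulmx_suml.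
    by apply: eq_bigr => s _; rewrite !mulmxA.
  - elim: (l) => //= s l' IH t [<-|/IH//]; by rewrite /= -mulmxA Rf mulmxA fL.
  rewrite pairwise_map; apply: sub_pairwise lo => s t /andP[/eqP e1 /eqP e2] /=.
  by rewrite !mulmxA -!(mulmxA _ R L) RL !mulmx1 e1 e2 !eqxx.
have gg : (1%:M - e) *m (1%:M - e) = 1%:M - e.
  by rewrite mulmxBr mulmx1 mulmxBl mul1mx ee subrr subr0.
have gc : {in r, forall x, (1%:M - e) *m rho x = rho x *m (1%:M - e)}.
  by move=> x xr; rewrite mulmxBr mulmxBl mulmx1 mul1mx ec.
have [l1 [s1 [f1 o1]]] := part e ee ec (or_introl erefl).
have [l2 [s2 [f2 o2]]] := part _ gg gc (or_intror erefl).
exists (l1 ++ l2); split; first by rewrite big_cat/= s1 s2 addrC subrK.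
rewrite pairwise_cat o1 o2 !andbT.
elim: l1 {s1 o1} f1 => // s l1 IH f1; rewrite allrel_consl IH => [|t tl]; last by apply: f1; right.
rewrite andbT; have [se1 se2] := f1 s (or_introl erefl).
elim: l2 {s2 o2 IH} f2 => //= t l2 IH2 f2; rewrite IH2 => [|u ul]; last by apply: f2; right.
have [te1 te2] := f2 t (or_introl erefl); rewrite andbT.
have eg : e *m (1%:M - e) = 0 by rewrite mulmxBr mulmx1 ee subrr.
have ge : (1%:M - e) *m e = 0 by rewrite mulmxBl mul1mx ee subrr.
apply/andP; split; apply/eqP.
  by rewrite -se1 -te2 -mulmxA (mulmxA e) eg mul0mx mulmx0.
by rewrite -te1 -se2 -mulmxA (mulmxA (_ - e)) ge mul0mx mulmx0.
Qed.

(** [stable_projector] needs the center to act by scalars. If a central z does not, the Fitting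
    projector of z minus one of its eigenvalues splits the module; if all do, every stable subspace
    has a stable complement. *)
Theorem weyl n (rho : {linear g -> 'M[K]_n}) : lie_rep r rho -> diagonalizable_center rho ->
  completely_reducible rho.
Proof.
have [d] := ubnP n; elim: d n rho => // d IH n rho; rewrite ltnS => nd rhoP dz.
have split (e : 'M[K]_n) : e *m e = e -> e != 0 -> e != 1%:M ->
    {in r, forall x, e *m rho x = rho x *m e} -> completely_reducible rho.
  move=> ee e0 e1 ec; apply: (completely_reducible_split rhoP ee ec dz) => m sg mE.
  apply: IH; case: mE => ->; apply: leq_trans nd; apply: idem_rank_lt => //.
    by rewrite mulmxBr mulmx1 mulmxBl mul1mx ee subrr subr0.
  by apply: contra e0; rewrite subr_eq addrC -subr_eq subrr eq_sym.
have [n0|n0] := posnP n.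
  by exists [::]; rewrite big_nil; split=> //; apply: mx_dim0.
have [scal|] := pselect {in lie_center r, forall z, exists c, rho z = c%:M}; last first.
  move=> /existsNP[z /not_implyP[zZ nz]]; have /lie_centerP[zr zc] := zZ.
  have [l [l1 lz]] := dz z zZ.
  have [p pl p0] : exists2 p, p \in l & p.2 != 0.
    apply: contrapT => np; have /eqP : (1%:M : 'M[K]_n) = 0.
      rewrite -l1 big1_seq// => p /andP[_ pl]; apply/eqP; apply: contrapT => /negP p0.
      by apply: np; exists p.
    by rewrite -mxrank_eq0 mxrank1 gtn_eqF.
  have [f [B [ff fA AB [Af BA _ cfB]]]] := fitting (rho z - p.1%:M).
  apply: (split f) => //.
  - apply: contra p0 => /eqP f0; have : p.2 *m (1%:M - f) = 0.
      rewrite -AB mulmxA (eigen_exp (c := 0)) ?expr0n ?gtn_eqF// ?scale0r ?mul0mx//.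
      by rewrite mulmxBr lz// mul_mx_scalar subrr.
    by rewrite f0 subr0 mulmx1 => ->.
  - apply/eqP => f1; apply: nz; exists p.1; rewrite -[LHS]mul1mx -l1 mulmx_suml.
    rewrite -[RHS]mul1mx -l1 mulmx_suml big_seq [RHS]big_seq; apply: eq_bigr => q ql.
    rewrite lz// mul_mx_scalar; have [->//|qp] := eqVneq q.1 p.1.
    suff -> : q.2 = 0 by rewrite !scaler0.
    have : q.2 *m (rho z - p.1%:M) ^+ n = 0 by rewrite -[_ ^+ n]mul1mx -f1 fA mulmx0.
    rewrite (eigen_exp (c := q.1 - p.1)); last by rewrite mulmxBr lz// mul_mx_scalar scalerBl.
    by move=> /eqP; rewrite scaler_eq0 expf_eq0 subr_eq0 (negPf qp) andbF => /eqP.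
  move=> x xr; have [] // := cfB (rho x) _.
  rewrite mulmxBr mulmxBl scalar_mxC; congr (_ - _).
  apply/eqP; rewrite -subr_eq0 -rhoP//; apply/eqP.
  by rewrite lieC zc// oppr0 linear0.
have [irr|/existsNP[U /not_implyP[stU /not_orP[U0 U1]]]] := pselect (forall U : 'M[K]_n,
    {in r, forall x, stablemx U (rho x)} -> U = 0 \/ row_full U).
  pose X := Irrep rhoP n0 irr.
  exists [:: Summand (rho := rho) (sm_irr := X) (sm_in := 1%:M) (sm_out := 1%:M) (mulmx1 _)
    (fun x _ => etrans (mul1mx _) (esym (mulmx1 _))) (fun x _ => etrans (mulmx1 _) (esym (mul1mx _)))].
  by rewrite big_seq1 /= mulmx1.
have [e [ee eU ec]] := stable_projector rhoP scal stU.
apply: (split e) => //.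
  by apply/eqP => e0; apply: U0; apply/eqP; rewrite -submx0 -eU e0 sub0mx.
by apply/eqP => e1; apply: U1; rewrite -sub1mx -eU e1 submx1.
Qed.

End Weyl.

(** * Exterior algebra and Clifford algebra *)

Section Exterior.
Variables (K : fieldType) (W : vectType K) (E : exteriorAlg W).
Local Notation io := (ext_in E).
Implicit Types (x y : W) (w : E).

Lemma ext_sq x : io x * io x = 0.
Proof. by have [H _] := ext_universal E; apply: H. Qed.

Lemma ext_anti x y : io x * io y = - (io y * io x).
Proof.
apply/eqP; rewrite -addr_eq0; have := ext_sq (x + y).
by rewrite linearD mulrDl !mulrDr !ext_sq add0r addr0 => ->.
Qed.

Lemma ext_endo_id (F : {lrmorphism E -> E}) : (forall x, F (io x) = io x) -> F =1 id.
Proof.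
move=> Fx; have [_ /(_ E io ext_sq)[G [_ Gu]]] := ext_universal E.
by move=> w; rewrite (Gu F)// -(Gu idfun).
Qed.

(** By universality the identity of E factors through the subalgebra generated by W. *)
Lemma ext_gen : agenv (limg (linfun io)) = fullv.
Proof.
set A := agenv_aspace (limg (linfun io)).
have A1 : 1 \in A by rewrite memvE sub1_agenv.
have xA x : io x \in A by apply: (subvP (sub_agenv _)); rewrite -lfunE memv_img// memvf.
have iid : algid A = 1 := (eqP (etrans (algid_eq1 A) A1)).
have [f fE] : exists f : {linear W -> subvs_of A}, forall x, vsval (f x) = io x.
  have fl : linear (fun x => vsproj A (io x)) by move=> k x y; rewrite !linearP.
  have [F FE] := mk_linear fl; exists F => x; rewrite FE; exact: vsprojK.
have [_ /(_ (subvs_of A) f)[|F [Fi _]]] := ext_universal E.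
  by move=> x; apply: val_inj; rewrite /= !fE ext_sq.
have Gm : monoid_morphism (fun w => vsval (F w)).
  by split=> [|x y]; rewrite ?rmorph1 ?rmorphM//=.
have Gl : linear (fun w => vsval (F w)) by move=> k x y; rewrite !linearP.
pose G : {lrmorphism E -> E} := HB.pack (fun w => vsval (F w))
  (GRing.isLinear.Build K E E _ _ Gl) (GRing.isMonoidMorphism.Build E E _ Gm).
apply/eqP; rewrite eqEsubv subvf; apply/subvP => w _.
have -> : w = G w by rewrite (@ext_endo_id G)// => x; rewrite /= -[RHS]fE; congr vsval; exact: Fi.
exact: subvsP.
Qed.

Lemma ext_ind (Q : E -> Prop) : Q 1 -> (forall k u v, Q u -> Q v -> Q (k *: u + v)) ->
  (forall x w, Q w -> Q (io x * w)) -> forall w, Q w.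
Proof.
move=> Q1 QP QM; have Q0 : Q 0 by rewrite -(addNr 1) -scaleN1r; apply: QP.
have [U UQ] := vspace_of_prop Q0 QP.
suff : (agenv (limg (linfun io)) <= U)%VS by rewrite ext_gen => /subvP s w; apply/UQ/s/memvf.
apply: agenv_sub_modl; first by rewrite -memvE; apply/UQ.
apply/prodvP => _ w /memv_imgP[x _ ->] /UQ wU; apply/UQ; rewrite lfunE; exact: QM.
Qed.

Lemma ext_sign_exists : exists th : {lrmorphism E -> E}, forall x, th (io x) = - io x.
Proof.
have [f fE] : exists f : {linear W -> E}, forall x, f x = - io x.
  by apply: mk_linear => k x y; rewrite linearP opprD scalerN.
have [_ /(_ E f)[x|th [thf _]]] := ext_universal E; first by rewrite fE mulrNN ext_sq.
by exists th => x; rewrite -fE; have := thf x.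
Qed.

(** With X the line of x and L the span of the other vectors, X X = 0 and L X is contained in X L,
    so (X + L)^(m+1) lies in X L^m + L^(m+1). *)
Lemma ext_powers_vanish (s : seq W) : (<<map io s>> ^+ (size s).+1)%VS = 0%VS.
Proof.
elim: s => [|x s IH]; first by rewrite /= span_nil expv1.
set L := <<map io s>>%VS in IH; set X := <[io x]>%VS.
have comm : (L * X <= X * L)%VS.
  have LX : (L <= amulr (io x) @^-1: (X * L))%VS.
    apply/span_subvP => _ /mapP[y ys ->]; rewrite -memv_preim lfunE/= ext_anti rpredN memv_mul//.
      exact: memv_line.
    by apply: memv_span; apply: map_f.
  apply/prodvP => u v /(subvP LX); rewrite -memv_preim lfunE/= => uL /vlineP[k ->].
  by rewrite -scalerAr rpredZ.
have XX : (X * X = 0)%VS by rewrite prodv_line ext_sq; apply/eqP; rewrite -subv0; apply/subvP => u /vlineP[k ->]; rewrite scaler0 mem0v.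
have pow m : ((X + L) ^+ m.+1 <= X * L ^+ m + L ^+ m.+1)%VS.
  elim: m => [|m IHm]; first by rewrite !expv1 expv0 prodv1.
  rewrite expvSl; apply: subv_trans (prodvSr _ IHm) _.
  rewrite prodvDl !prodvDr !prodvA XX prod0v add0v !subv_add -prodvA -expvSl addvSl/=.
  rewrite addvSr andbT prodvA; apply: subv_trans (prodvSl _ comm) _.
  by rewrite -prodvA -expvSl addvSl.
have -> : <<map io (x :: s)>>%VS = (X + L)%VS by rewrite /= span_cons.
apply/eqP; rewrite -subv0; apply: subv_trans (pow _) _.
by rewrite /= (expvSl L (size s).+1) IH !prodv0 addv0.
Qed.

(** [ext_parity] stops at degree dim W, so the product of a vector with a top degree element has to
    vanish for parity to be shifted. *)
Lemma ext_top : (limg (linfun io) ^+ (\dim {:W}).+1)%VS = 0%VS.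
Proof.
have := ext_powers_vanish (vbasis {:W}); rewrite size_tuple => <-; congr (_ ^+ _)%VS.
rewrite -{1}(span_basis (vbasisP {:W})) limg_span; congr span.
by apply: eq_map => x; rewrite lfunE.
Qed.

Definition is_sign (th : {lrmorphism E -> E}) := forall x, th (io x) = - io x.

Variable th : {lrmorphism E -> E}.
Hypothesis thP : is_sign th.

Lemma signK w : th (th w) = w.
Proof.
pose G : {lrmorphism E -> E} := th \o th.
by rewrite -[RHS](@ext_endo_id G)// => x; rewrite /= thP linearN/= thP opprK.
Qed.

Lemma sign_pow k w : w \in (limg (linfun io) ^+ k)%VS -> th w = (-1) ^+ k *: w.
Proof.
elim: k w => [|k IH] w; first by rewrite expv0 => /vlineP[c ->]; rewrite linearZ/= rmorph1 scale1r.
have [|c u v uE vE|U UP] := @vspace_of_prop _ _ (fun u => th u = (-1) ^+ k.+1 *: u).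
- by rewrite linear0 scaler0.
- by rewrite linearP/= uE vE scalerDr !scalerA mulrC.
rewrite expvSl => wL; apply/UP; apply: subvP w wL.
apply/prodvP => _ v /memv_imgP[x _ ->] /IH tv; apply/UP; rewrite rmorphM/= lfunE/= thP tv.
by rewrite exprS mulN1r scaleNr mulNr -scalerAr.
Qed.

Lemma ext_parityD w : exists u v, [/\ u \in ext_parity E false, v \in ext_parity E true & w = u + v].
Proof.
elim/ext_ind: w => [|k u1 u2 [e1 [o1 [e1P o1P ->]]] [e2 [o2 [e2P o2P ->]]]|x w [e [o [eP oP ->]]]].
- exists 1, 0; rewrite mem0v addr0; split=> //.
  rewrite /ext_parity; apply: (subvP (sumv_sup ord0 _ _)) => //.
  by rewrite expv0 memv_line.
- exists (k *: e1 + e2), (k *: o1 + o2); rewrite !rpredD ?rpredZ// scalerDr addrACA.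
  by [].
have shift p u : u \in ext_parity E p -> io x * u \in ext_parity E (~~ p).
  rewrite /ext_parity => /memv_sumP[f fP ->]; rewrite mulr_sumr; apply: rpred_sum => k kp.
  have := fP _ kp => fk.
  have xf : io x * f k \in (limg (linfun io) ^+ k.+1)%VS.
    by rewrite expvSl memv_mul// -lfunE memv_img// memvf.
  have [kn|kn] := ltnP k.+1 (\dim {:W}).+1.
    apply: (subvP _ _ xf); apply: (sumv_sup (Ordinal kn)) => //=.
    by rewrite (eqP kp); case: (p).
  have kE : k.+1 = (\dim {:W}).+1 by apply/eqP; rewrite eqn_leq kn ltn_ord.
  by move: xf; rewrite kE ext_top memv0 => /eqP->; rewrite mem0v.
exists (io x * o), (io x * e); rewrite mulrDr addrC; split=> //.
  exact: (shift true).
exact: (shift false).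
Qed.

Lemma ext_parityP (charK : 2%:R != 0 :> K) (p : bool) w :
  reflect (th w = (-1) ^+ p *: w) (w \in ext_parity E p).
Proof.
have par q u : u \in ext_parity E q -> th u = (-1) ^+ q *: u.
  move=> /memv_sumP[f fP ->]; rewrite linear_sum/= scaler_sumr; apply: eq_bigr => k kp.
  by rewrite (sign_pow (fP _ kp)) -signr_odd (eqP kp).
apply: (iffP idP) => [|tw]; first exact: par.
have [u [v [up vp wE]]] := ext_parityD w.
have z0 (z : E) : 2%:R *: z = 0 -> z = 0 by move/eqP; rewrite scaler_eq0 (negPf charK) => /eqP.
move: tw; rewrite wE linearD/= (par _ _ up) (par _ _ vp) expr0 expr1 scale1r scaleN1r.
case: (p) => /= tw.
  rewrite (z0 u) ?add0r// scaler_nat mulr2n; apply/eqP; rewrite addr_eq0.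
  by move: tw; rewrite expr1 scaleN1r opprD => /addIr/eqP.
rewrite (z0 v) ?addr0// scaler_nat mulr2n; apply/eqP; rewrite addr_eq0.
by move: tw; rewrite expr0 scale1r => /addrI/eqP; rewrite eq_sym.
Qed.

End Exterior.

(** * Ordered products and Chevalley's antisymmetrization *)

Section OrderedProducts.
Variables (K : fieldType) (A : algType K) (I : eqType).
Implicit Types (y : I -> A) (l : seq I).

Lemma prod_slot l y j : uniq l -> j \in l ->
  exists p q, forall u, \prod_(i <- l) (if i == j then u else y i) = p * u * q.
Proof.
move=> lu /splitPr jl; case: jl lu => l1 l2; rewrite cat_uniq /= => /and3P[_ /norP[j1 l12] /andP[j2 _]].
exists (\prod_(i <- l1) y i), (\prod_(i <- l2) y i) => u.
rewrite big_cat big_cons /= eqxx mulrA; congr (_ * _ * _); apply: eq_big_seq => i il.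
  by case: eqP il j1 => // -> ->.
by case: eqP il j2 => // -> ->.
Qed.

Lemma prod_commutator l y (a : A) : uniq l ->
  a * (\prod_(i <- l) y i) - (\prod_(i <- l) y i) * a =
  \sum_(j <- l) \prod_(i <- l) (if i == j then a * y j - y j * a else y i).
Proof.
elim: l => [|k l IH] /=; first by rewrite !big_nil mulr1 mul1r subrr.
case/andP=> kl lu; rewrite !big_cons eqxx.
rewrite (eq_big_seq y) => [|i il]; last by case: eqP il kl => // -> ->.
rewrite [X in _ = _ + X](eq_big_seq (fun j => y k * \prod_(i <- l) (if i == j then a * y j - y j * a else y i))).
  by rewrite -mulr_sumr -IH// mulrBl mulrBr !mulrA addrA subrK.
by move=> j jl; rewrite big_cons; case: eqP jl kl => // -> ->.
Qed.

End OrderedProducts.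

(** A change of basis mixes indices and destroys the condition i < j < k, so the cubic term is
    handled as a sum over all triples, where each unordered triple is counted 3! times. *)
Lemma sum_triple (V : nmodType) N (F : 'I_N -> 'I_N -> 'I_N -> V) :
  (forall i j k, F j i k = F i j k) -> (forall i j k, F i k j = F i j k) ->
  (forall i k, F i i k = 0) ->
  \sum_i \sum_j \sum_k F i j k =
    (\sum_(i < N) \sum_(j < N | (i < j)%N) \sum_(k < N | (j < k)%N) F i j k) *+ 6.
Proof.
move=> F12 F23 F0; pose T (i j k : 'I_N) := if (i < j < k)%N then F i j k else 0.
have -> : \sum_(i < N) \sum_(j < N | (i < j)%N) \sum_(k < N | (j < k)%N) F i j k =
    \sum_i \sum_j \sum_k T i j k.
  apply: eq_bigr => i _; rewrite big_mkcond; apply: eq_bigr => j _; rewrite /T.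
  by case: ltnP => //= _; [rewrite big_mkcond | rewrite big1].
have F0' i k : F i k i = 0 by rewrite (F23 i i k).
have F0'' i k : F i k k = 0 by rewrite (F12 k i k).
have FT i j k : F i j k = T i j k + T i k j + T j i k + T j k i + T k i j + T k j i.
  have F1 : F i k j = F i j k by [].
  have F2 : F j i k = F i j k by [].
  have F3 : F j k i = F i j k by rewrite F23.
  have F4 : F k i j = F i j k by rewrite F12.
  have F5 : F k j i = F i j k by rewrite F12.
  rewrite /T F1 F2 F3 F4 F5.
  have [ij|ij|/val_inj ij] := ltngtP i j; have [jk|jk|/val_inj jk] := ltngtP j k;
    have [ik|ik|/val_inj ik] := ltngtP i k; rewrite ?andbF ?andbT /= ?addr0 ?add0r //; 
    do ?[by exfalso; subst; lia]; subst; rewrite ?F0 ?F0' ?F0''//.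
rewrite (eq_bigr (fun i => \sum_j (\sum_k T i j k + \sum_k T i k j + \sum_k T j i k +
   \sum_k T j k i + \sum_k T k i j + \sum_k T k j i))) => [|i _]; last first.
  by apply: eq_bigr => j _; rewrite -!big_split; apply: eq_bigr => k _; rewrite FT.
under eq_bigr => i _ do rewrite !big_split/=.
rewrite !big_split/=.
have e1 : \sum_i \sum_j \sum_k T i k j = \sum_i \sum_j \sum_k T i j k.
  by apply: eq_bigr => i _; rewrite exchange_big.
have e2 : \sum_i \sum_j \sum_k T j i k = \sum_i \sum_j \sum_k T i j k by rewrite exchange_big.
have e3 : \sum_i \sum_j \sum_k T j k i = \sum_i \sum_j \sum_k T i j k.
  by rewrite exchange_big/=; apply: eq_bigr => i _; rewrite exchange_big.
have e4 : \sum_i \sum_j \sum_k T k i j = \sum_i \sum_j \sum_k T i j k.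
  by rewrite -[RHS]e2; apply: eq_bigr => i _; apply: exchange_big.
have e5 : \sum_i \sum_j \sum_k T k j i = \sum_i \sum_j \sum_k T i j k.
  by rewrite -[RHS]e3; apply: eq_bigr => i _; apply: exchange_big.
by rewrite e1 e2 e3 e4 e5 !mulrS mulr0n addr0 !addrA.
Qed.

Section ChevalleyCalculus.
Variables (K : numClosedFieldType) (W : vectType K) (form : W -> W -> K) (C : cliffordAlg form).
Local Notation cl := (cliff_in C).

Lemma chevalley_slot k (x : 'I_k -> W) (j : 'I_k) : exists Q : C -> C,
  (forall a u v, Q (a *: u + v) = a *: Q u + Q v) /\
  forall (t : k.-tuple W) w, tnth t =1 (fun i => if i == j then w else x i) ->
    chevalley C t = Q (cl w).
Proof.
have slot (s : 'S_k) : exists pq : C * C, forall u,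
    \prod_(i < k) (if i == (s^-1)%g j then u else cl (x (s i))) = pq.1 * u * pq.2.
  have [] := @prod_slot _ C _ (index_enum 'I_k) (fun i => cl (x (s i))) ((s^-1)%g j).
  - exact: index_enum_uniq.
  - exact: mem_index_enum.
  by move=> p [q pq]; exists (p, q).
have [f fE] := choice slot.
exists (fun u => k`!%:R^-1 *: \sum_(s : 'S_k) (-1) ^+ s *: ((f s).1 * u * (f s).2)); split.
  move=> a u v; rewrite scalerA mulrC -scalerA -scalerDr; congr (_ *: _).
  rewrite scaler_sumr -big_split /=; apply: eq_bigr => s _.
  by rewrite mulrDr mulrDl -scalerAr -scalerAl /= scalerDr !scalerA [a * _]mulrC.
move=> t w tE; rewrite /chevalley; congr (_ *: _); apply: eq_bigr => s _; rewrite -fE.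
congr (_ *: _); apply: eq_bigr => i _; rewrite tE (can2_eq (permK s) (permKV s)).
by case: ifP.
Qed.

Lemma chevalley_perm k (s : 'S_k) (t t' : k.-tuple W) : (forall i, tnth t' i = tnth t (s i)) ->
  chevalley C t' = (-1) ^+ s *: chevalley C t.
Proof.
move=> tE; rewrite /chevalley scalerA [_ * _]mulrC -scalerA; congr (_ *: _).
rewrite scaler_sumr (reindex_inj (mulIg (s^-1)%g)) /=; apply: eq_bigr => u _.
rewrite odd_permM odd_permV scalerA -signr_addb addbC; congr (_ *: _).
by apply: eq_bigr => i _; rewrite tE permM permKV.
Qed.

Lemma chevalley_commutator k (t : k.-tuple W) (a : C) (T : W -> W) :
  (forall v, a * cl v - cl v * a = cl (T v)) ->
  a * chevalley C t - chevalley C t * a =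
  \sum_j chevalley C [tuple (if i == j then T (tnth t i) else tnth t i) | i < k].
Proof.
move=> aT; rewrite /chevalley -scalerAr -scalerAl -scalerBr -scaler_sumr; congr (_ *: _).
rewrite mulr_sumr mulr_suml -sumrB exchange_big/=; apply: eq_bigr => s _.
rewrite -scalerAr -scalerAl -scalerBr -scaler_sumr; congr (_ *: _).
rewrite prod_commutator ?index_enum_uniq// [RHS](reindex_inj (@perm_inj _ s)).
apply: eq_bigr => j _; apply: eq_bigr => i _; rewrite tnth_mktuple (inj_eq (@perm_inj _ s)).
by case: eqP => // ->; rewrite aT.
Qed.

Definition ch3 u v w : C := chevalley C [tuple u; v; w].

Lemma ch3_lin1 v w a u u' : ch3 (a *: u + u') v w = a *: ch3 u v w + ch3 u' v w.
Proof.
have [Q [QP QE]] := chevalley_slot (tnth [tuple u; v; w]) ord0.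
have E z : ch3 z v w = Q (cl z) by apply: QE => -[[|[|[|?]]] ?].
by rewrite !E linearP QP.
Qed.

Lemma ch3_swap12 u v w : ch3 v u w = - ch3 u v w.
Proof.
rewrite /ch3 (@chevalley_perm _ (tperm ord0 (Ordinal (isT : 1 < 3)%N)) [tuple u; v; w]).
  by rewrite odd_tperm /= expr1 scaleN1r.
by move=> -[[|[|[|?]]] ?] //; rewrite permE.
Qed.

Lemma ch3_swap23 u v w : ch3 u w v = - ch3 u v w.
Proof.
rewrite /ch3 (@chevalley_perm _ (tperm (Ordinal (isT : 1 < 3)%N) ord_max) [tuple u; v; w]).
  by rewrite odd_tperm /= expr1 scaleN1r.
by move=> -[[|[|[|?]]] ?] //; rewrite permE.
Qed.

Lemma ch3_commutator (a : C) (T : W -> W) u v w :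
  (forall v, a * cl v - cl v * a = cl (T v)) ->
  a * ch3 u v w - ch3 u v w * a = ch3 (T u) v w + ch3 u (T v) w + ch3 u v (T w).
Proof.
move=> aT; rewrite (chevalley_commutator _ aT) !big_ord_recl big_ord0 addr0 addrA.
by congr (_ + _ + _); congr (chevalley C _); apply: eq_from_tnth;
  move=> -[[|[|[|?]]] ?] //; rewrite tnth_mktuple.
Qed.

Lemma ch3_diag u w : ch3 u u w = 0.
Proof.
apply/eqP; have /eqP := ch3_swap12 u u w; rewrite -addr_eq0 -mulr2n -scaler_nat scaler_eq0.
by rewrite pnatr_eq0.
Qed.

(* [d] and [b] transform contragrediently under [T], so an invariant trilinear
   form evaluated on the [b i] contracts with the [d i] to an invariant. *)
Lemma cubic_commutes N (d : 'I_N -> W) (beta : 'I_N -> 'I_N -> 'I_N -> K) (M : 'I_N -> 'I_N -> K)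
    (a : C) (T : W -> W) :
  (forall v, a * cl v - cl v * a = cl (T v)) ->
  (forall i, T (d i) = \sum_l M i l *: d l) ->
  (forall i j k, beta j i k = - beta i j k) -> (forall i j k, beta i k j = - beta i j k) ->
  (forall i j k, \sum_l (M l i * beta l j k + M l j * beta i l k + M l k * beta i j l) = 0) ->
  let kap := \sum_(i < N) \sum_(j < N | (i < j)%N) \sum_(k < N | (j < k)%N)
    beta i j k *: ch3 (d i) (d j) (d k) in a * kap = kap * a.
Proof.
move=> aT Td b12 b23 binv kap.
have F6 : kap *+ 6 = \sum_i \sum_j \sum_k beta i j k *: ch3 (d i) (d j) (d k).
  rewrite sum_triple// => [i j k|i j k|i k].
  - by rewrite b12 ch3_swap12 scalerN scaleNr opprK.
  - by rewrite b23 ch3_swap23 scalerN scaleNr opprK.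
  by rewrite ch3_diag scaler0.
apply/eqP; rewrite -subr_eq0; have : (a * kap - kap * a) *+ 6 = 0.
  rewrite mulrnBl -mulrnAr -mulrnAl F6 mulr_sumr mulr_suml -sumrB.
  (* Each of [S1], [S2], [S3] collects the terms in which [T] hits one factor, with the expanded
     vector as free index; so grouped, the coefficients add up to the invariance relation of
     [beta]. *)
  pose S1 := \sum_l \sum_j \sum_k \sum_i (M i l * beta i j k) *: ch3 (d l) (d j) (d k).
  pose S2 := \sum_i \sum_l \sum_k \sum_j (M j l * beta i j k) *: ch3 (d i) (d l) (d k).
  pose S3 := \sum_i \sum_j \sum_l \sum_k (M k l * beta i j k) *: ch3 (d i) (d j) (d l).
  transitivity (S1 + S2 + S3); last first.
    rewrite /S1 /S2 /S3 -!big_split big1//= => i _; rewrite -!big_split big1//= => j _.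
    rewrite -!big_split big1//= => k _; rewrite -!big_split/= -[RHS](scale0r (ch3 (d i) (d j) (d k))) -(binv i j k).
    by rewrite scaler_suml; apply: eq_bigr => l _; rewrite -!scalerDl.
  have sum1 (f : 'I_N -> K) v w : ch3 (\sum_l f l *: d l) v w = \sum_l f l *: ch3 (d l) v w.
    elim/big_rec2: _ => [|l p q _ <-]; last by rewrite ch3_lin1.
    by rewrite -(addNr v) -scaleN1r ch3_lin1 scaleN1r addNr.
  have sum2 (f : 'I_N -> K) v w : ch3 v (\sum_l f l *: d l) w = \sum_l f l *: ch3 v (d l) w.
    by rewrite -[LHS]opprK -ch3_swap12 sum1 -sumrN; apply: eq_bigr => l _; rewrite -scalerN -ch3_swap12.
  have sum3 (f : 'I_N -> K) v w : ch3 v w (\sum_l f l *: d l) = \sum_l f l *: ch3 v w (d l).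
    by rewrite -[LHS]opprK -ch3_swap23 sum2 -sumrN; apply: eq_bigr => l _; rewrite -scalerN -ch3_swap23.
  have -> : S1 = \sum_i \sum_j \sum_k \sum_l (M i l * beta i j k) *: ch3 (d l) (d j) (d k).
    rewrite /S1 [RHS]exchange_big/= [LHS]exchange_big; apply: eq_bigr => j _ /=.
    rewrite [RHS]exchange_big/= [LHS]exchange_big; apply: eq_bigr => k _ /=.
    by rewrite exchange_big.
  have -> : S2 = \sum_i \sum_j \sum_k \sum_l (M j l * beta i j k) *: ch3 (d i) (d l) (d k).
    rewrite /S2; apply: eq_bigr => i _.
    rewrite [RHS]exchange_big/= [LHS]exchange_big; apply: eq_bigr => k _ /=.
    by rewrite exchange_big.
  have -> : S3 = \sum_i \sum_j \sum_k \sum_l (M k l * beta i j k) *: ch3 (d i) (d j) (d l).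
    by rewrite /S3; apply: eq_bigr => i _; apply: eq_bigr => j _; rewrite exchange_big.
  rewrite -!big_split; apply: eq_bigr => i _ /=; rewrite mulr_sumr mulr_suml -sumrB -!big_split.
  apply: eq_bigr => j _ /=; rewrite mulr_sumr mulr_suml -sumrB -!big_split; apply: eq_bigr => k _ /=.
  rewrite -scalerAr -scalerAl -scalerBr (ch3_commutator _ _ _ aT) !Td sum1 sum2 sum3 !scalerDr !scaler_sumr.
  by congr (_ + _ + _); apply: eq_bigr => l _; rewrite scalerA mulrC.
by move/eqP; rewrite -scaler_nat scaler_eq0 pnatr_eq0.
Qed.

End ChevalleyCalculus.

(** * The spin module: parity and weights *)

Section Spin.
Variables (K : numClosedFieldType) (g : lieAlgType K) (B : {symmetric g}).
Variables (r : lieSubalg g) (h : {vspace g}) (P : seq 'Hom(subvs_of h, K^o)).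
Hypotheses (redg : reductive {:g}) (invB : invariant_form B) (ndB : nondegenerate B).
Hypothesis ndr : (r :&: orthov B r)%VS = 0%VS.
Hypotheses (carg : cartan_subalgebra {:g} h) (carr : cartan_subalgebra r h).
Hypothesis posP : positive_system P.
Variables (C : cliffordAlg (@rperp_form _ _ B r)) (S : exteriorAlg (subvs_of (splus P r))).
Variables (alpha : {linear subvs_of r -> C}) (cS : algModule C S).
Hypotheses (alphaP : is_alpha alpha) (spinP : is_spin_module cS).
Local Notation cl := (cliff_in C).
Local Notation pr := (vsproj (rperp B r)).
Local Notation io := (ext_in S).
Implicit Types (x y : g) (v : subvs_of (rperp B r)) (w : S) (z : subvs_of r).

Lemma cS1 w : cS 1 w = w. Proof. exact: algm_act1. Qed.
Lemma cSM (a b : C) w : cS (a * b) w = cS a (cS b w). Proof. exact: algm_actM. Qed.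
Lemma cSDl (a b : C) w : cS (a + b) w = cS a w + cS b w. Proof. exact: linearDl. Qed.
Lemma cSBl (a b : C) w : cS (a - b) w = cS a w - cS b w. Proof. exact: linearBl. Qed.
Lemma cSZl k (a : C) w : cS (k *: a) w = k *: cS a w. Proof. exact: linearZl_LR. Qed.
Lemma cSl k (a b : C) w : cS (k *: a + b) w = k *: cS a w + cS b w. Proof. exact: linearPl. Qed.
Lemma cSr k (a : C) w w' : cS a (k *: w + w') = k *: cS a w + cS a w'. Proof. exact: linearPr. Qed.
Lemma cSZr k (a : C) w : cS a (k *: w) = k *: cS a w. Proof. exact: linearZr_LR. Qed.
Lemma cSDr (a : C) w w' : cS a (w + w') = cS a w + cS a w'. Proof. exact: linearDr. Qed.

Lemma clifford_anti v v' w :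
  cS (cl v) (cS (cl v') w) = - cS (cl v') (cS (cl v) w) + (- 2 * B (vsval v) (vsval v')) *: w.
Proof.
have [/(_ v v') rel _] := cliff_universal C.
have := congr1 (fun a => cS a w) rel; rewrite /= cSDl !cSM cSZl cS1 => e.
by rewrite -[_ *: w]e [X in - _ + X]addrC addrA addNr add0r.
Qed.

Lemma rperp_split v : exists (x : subvs_of (splus P r)) (y : g),
  y \in sminus P r /\ cl v = cl (pr (vsval x)) + cl (pr y).
Proof.
have /memv_addP[x xs [y ys e]] := subvP (rperp_splus_sminus redg invB ndB ndr carg carr posP) _ (subvsP v).
exists (vsproj _ x), y; split=> //; rewrite vsprojK// -!linearD -e; congr (cl _).
exact/esym/vsvalK.
Qed.

Lemma spin_plus (x : subvs_of (splus P r)) w : cS (cl (pr (vsval x))) w = io x * w.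
Proof. by have [->] := spinP. Qed.

Lemma spin_minus1 y : y \in sminus P r -> cS (cl (pr y)) 1 = 0.
Proof. by have [_] := spinP; apply. Qed.

Lemma spin_minus y (x : subvs_of (splus P r)) w : y \in sminus P r ->
  cS (cl (pr y)) (io x * w) = - (io x * cS (cl (pr y)) w) + (- 2 * B y (vsval x)) *: w.
Proof.
move=> ys; rewrite -spin_plus clifford_anti spin_plus !vsprojK//.
  exact: (subvP (splus_rperp P redg invB ndB ndr carg carr)) (subvsP x).
exact: (subvP (sminus_rperp P redg invB ndB ndr carg carr)) ys.
Qed.

Variable th : {lrmorphism S -> S}.
Hypothesis thP : is_sign th.

(** Vectors of [splus] act by left multiplication; those of [sminus] kill 1 and satisfy the
    antiderivation rule [spin_minus]. Both kinds anticommute with the sign. *)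
Lemma clifford_sign v w : cS (cl v) (th w) = - th (cS (cl v) w).
Proof.
have [x [y [ys ->]]] := rperp_split v; rewrite !cSDl linearD opprD/= !spin_plus.
rewrite rmorphM/= thP mulNr opprK; congr (_ + _).
elim/ext_ind: w => [|k u u' uE u'E|x' w wE].
- by rewrite rmorph1 spin_minus1// linear0 oppr0.
- by rewrite linearP/= !cSr uE u'E linearP/= opprD scalerN.
rewrite rmorphM/= thP mulNr linearNr !spin_minus// wE.
by rewrite rmorphD rmorphN rmorphM/= thP linearZ/= mulrN !mulNr !opprK.
Qed.

Lemma chevalley_sign k (t : k.-tuple (subvs_of (rperp B r))) w :
  cS (chevalley C t) (th w) = (-1) ^+ k *: th (cS (chevalley C t) w).
Proof.
have prod_sign (l : seq 'I_k) (f : 'I_k -> subvs_of (rperp B r)) : cS (\prod_(i <- l) cl (f i)) (th w) =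
    (-1) ^+ size l *: th (cS (\prod_(i <- l) cl (f i)) w).
  elim: l => [|i l IH]; first by rewrite !big_nil !cS1 scale1r.
  by rewrite !big_cons !cSM IH cSZr clifford_sign exprS mulN1r scaleNr scalerN.
rewrite /chevalley !cSZl linearZ/= scalerA mulrC -scalerA; congr (_ *: _).
have sumE (F : 'S_k -> C) u : cS (\sum_s F s) u = \sum_s cS (F s) u.
  by elim/big_rec2: _ => [|s p q _ <-]; [exact: linear0l | exact: cSDl].
rewrite !sumE linear_sum scaler_sumr; apply: eq_bigr => s _ /=.
rewrite !cSZl linearZ/= prod_sign scalerA mulrC -scalerA.
by congr (_ ^+ _ *: _); rewrite -[RHS]card_ord -sum1_card sum1_size.
Qed.

Lemma alpha_sign z w : cS (alpha z) (th w) = th (cS (alpha z) w).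
Proof.
have [_ /(_ z)[n [x [y ->]]] _] := alphaP.
have sumE (F : 'I_n -> C) u : cS (\sum_s F s) u = \sum_s cS (F s) u.
  by elim/big_rec2: _ => [|s p q _ <-]; [exact: linear0l | exact: cSDl].
rewrite !sumE linear_sum; apply: eq_bigr => i _ /=.
by rewrite chevalley_sign sqrrN expr1n scale1r.
Qed.

Local Notation ps := (vsproj (splus P r)).

Lemma spin_alpha_io z (x : subvs_of (splus P r)) w : vsval z \in h ->
  cS (alpha z) (io x * w) = io x * cS (alpha z) w + io (ps 'L[vsval z, vsval x]) * w.
Proof.
move=> zh; have [_ _ /(_ z (pr (vsval x))) com] := alphaP.
have xs := subvsP x; have xr := subvP (splus_rperp P redg invB ndB ndr carg carr) _ xs.
rewrite -!spin_plus vsprojK ?h_splus//.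
rewrite -!cSM -cSDl; congr (cS _ _); apply/eqP; rewrite addrC -subr_eq com.
by rewrite vsprojK.
Qed.

Lemma spin_alpha_minus z y w : vsval z \in h -> y \in sminus P r ->
  cS (cl (pr y)) (cS (alpha z) w) = cS (alpha z) (cS (cl (pr y)) w) - cS (cl (pr 'L[vsval z, y])) w.
Proof.
move=> zh ys; have [_ _ /(_ z (pr y)) com] := alphaP.
rewrite -!cSM -cSBl; congr (cS _ _); apply/eqP; rewrite eq_sym subr_eq addrC -subr_eq com.
by rewrite vsprojK// (subvP (sminus_rperp P redg invB ndB ndr carg carr)).
Qed.

(** A product of two Clifford vectors sends 1 to a sum of terms of degree 0 and 2. *)
Lemma spin_quadratic z : exists k w, cS (alpha z) 1 = k *: 1 + w /\ w \in (limg (linfun io) ^+ 2)%VS.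
Proof.
set L2 := (_ ^+ 2)%VS.
suff : cS (alpha z) 1 \in (1 + L2)%VS.
  by case/memv_addP => _ /vlineP[k ->] [w wL e]; exists k, w.
have quad u v : cS (cl u) (cS (cl v) 1) \in (1 + L2)%VS.
  have [x [y [ys ->]]] := rperp_split v.
  rewrite cSDl (spin_minus1 ys) addr0 spin_plus mulr1.
  have [x' [y' [ys' ->]]] := rperp_split u.
  have io1 : io x = io x * 1 by rewrite mulr1.
  rewrite cSDl spin_plus {2}io1 (spin_minus _ _ ys') (spin_minus1 ys') mulr0 oppr0 add0r addrC.
  apply: memv_add; first by rewrite rpredZ// memv_line.
  by rewrite /L2 expv2; apply: memv_mul; rewrite -[io _]lfunE memv_img// memvf.
have [_ /(_ z)[n [x [y ->]]] _] := alphaP.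
have sumE (I : finType) (F : I -> C) u : cS (\sum_s F s) u = \sum_s cS (F s) u.
  by elim/big_rec2: _ => [|s p q _ <-]; [exact: linear0l | exact: cSDl].
rewrite sumE; apply: rpred_sum => i _; rewrite /chevalley cSZl rpredZ// sumE.
apply: rpred_sum => s _; rewrite cSZl rpredZ//.
by rewrite !big_ord_recl big_ord0 mulr1 cSM; apply: quad.
Qed.

(** The degree 2 part of [cS (alpha z) 1] is killed by all of [sminus], since [sminus] kills 1 and
    is normalized by h. But the number operator [N] is -4 on degree 2, two factors each contributing
    the Clifford constant -2, so this part is 0. *)
Lemma spin_alpha1 z : vsval z \in h -> exists k, cS (alpha z) 1 = k *: 1.
Proof.
move=> zh; have [k [w [zE wL]]] := spin_quadratic z; exists k.
suff w0 : w = 0 by rewrite zE w0 addr0.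
have [y [ys yE]] := sminus_dual_basis redg invB ndB ndr carg carr posP.
have yw i : cS (cl (pr (y i))) w = 0.
  have := spin_alpha_minus 1 zh (ys i).
  rewrite (spin_minus1 (ys i)) (spin_minus1 (h_sminus zh (ys i))) subr0 linear0r zE cSDr cSZr.
  by rewrite (spin_minus1 (ys i)) scaler0 add0r.
pose e (i : 'I_(\dim (splus P r))) := ps (vbasis (splus P r))`_i.
have num (x : subvs_of (splus P r)) : \sum_i (B (y i) (vsval x)) *: io (e i) = io x.
  rewrite -[in RHS](vsvalK x) [in RHS](yE _ (subvsP x)) !linear_sum /=; apply: eq_bigr => i _.
  by rewrite !linearZ.
pose N u := \sum_i io (e i) * cS (cl (pr (y i))) u.
have [|c u v uE vE|U UP] := @vspace_of_prop _ _ (fun u => N u = - 4%:R *: u).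
- by rewrite scaler0 /N big1// => i _; rewrite linear0r mulr0.
- rewrite scalerDr scalerA mulrC -scalerA -uE -vE /N scaler_sumr -big_split.
  by apply: eq_bigr => i _; rewrite cSr mulrDr scalerAr.
have : w \in U.
  move: w wL {zE yw}; apply/subvP; rewrite expv2; apply/prodvP => _ _ /memv_imgP[x _ ->] /memv_imgP[x' _ ->].
  apply/UP; rewrite /N !lfunE /=.
  rewrite (eq_bigr (fun i => - 2%:R *: ((B (y i) (vsval x) *: io (e i)) * io x' -
    (B (y i) (vsval x') *: io (e i)) * io x))).
    rewrite -scaler_sumr sumrB -!mulr_suml !num (ext_anti S x' x) opprK -mulr2n -scaler_nat scalerA.
    by congr (_ *: _); ring.
  move=> i _; have io1 : io x' = io x' * 1 by rewrite mulr1.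
  rewrite spin_minus// {1}io1 spin_minus// spin_minus1// mulr0 oppr0 add0r.
  rewrite -(scalerAr _ (io x)) mulr1 mulrDr mulrN -!scalerAr -!scalerAl scalerBr !scalerA.
  by rewrite addrC.
move/UP; rewrite /N big1 => [|i _]; last by rewrite yw mulr0.
by move/esym/eqP; rewrite scaler_eq0 oppr_eq0 pnatr_eq0 => /eqP.
Qed.

(** Multiplication by a root vector of [splus] raises eigenvalues of [alpha z] by the value of the
    root, so products of root vectors applied to 1 are eigenvectors, and they span S. *)
Lemma spin_alpha_diag z w : vsval z \in h -> exists l : seq (K * S),
  w = \sum_(p <- l) p.2 /\ forall p, p \in l -> cS (alpha z) p.2 = p.1 *: p.2.
Proof.
move=> zh; pose Q w := exists l : seq (K * S),
  w = \sum_(p <- l) p.2 /\ forall p, p \in l -> cS (alpha z) p.2 = p.1 *: p.2.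
have Q0 : Q 0 by exists [::]; rewrite big_nil.
have QP k (u v : S) : Q u -> Q v -> Q (k *: u + v).
  move=> [l [-> lP]] [l' [-> lP']]; exists ([seq (p.1, k *: p.2) | p <- l] ++ l').
  rewrite big_cat big_map scaler_sumr; split=> // p; rewrite mem_cat => /orP[/mapP[q ql ->] /=|/lP'//].
  by rewrite cSZr lP// scalerA mulrC -scalerA.
have Qs (l : seq (K * S)) : (forall p, p \in l -> Q p.2) -> Q (\sum_(p <- l) p.2).
  elim: l => [|p l IH] lQ; first by rewrite big_nil.
  rewrite big_cons -[p.2]scale1r; apply: QP; first by apply: lQ; rewrite mem_head.
  by apply: IH => q ql; apply: lQ; rewrite inE ql orbT.
have [|k x y Hx Hy w' w'Q|U UP] := @vspace_of_prop _ _ (fun x => forall w, Q w -> Q (io (ps x) * w)).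
- by move=> w' _; rewrite !linear0 mul0r.
- by rewrite !linearP mulrDl -scalerAl; apply: QP; [apply: Hx | apply: Hy].
have sU : (splus P r <= U)%VS.
  apply: sumv_seq_sub => a aP oa; apply/subvP => x xa; apply/UP => w' [l [-> lP]].
  rewrite mulr_sumr -(big_map (fun p => (p.1 + wt a (vsval z), io (ps x) * p.2)) predT snd).
  apply: Qs => _ /mapP[p pl ->]; exists [:: (p.1 + wt a (vsval z), io (ps x) * p.2)].
  rewrite big_seq1; split=> // _ /[!inE]/eqP-> /=.
  have xs : x \in splus P r by apply: (subvP (sumv_seq_sup _ aP oa)) xa.
  rewrite spin_alpha_io// lP// vsprojK// ((root_space_eigen _ _).1 xa)//.
  by rewrite !linearZ/= scalerDl -scalerAr -scalerAl.
elim/ext_ind: w => [|k u v|x w wQ]; last 2 first.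
- exact: QP.
- by have /UP := subvP sU _ (subvsP x); rewrite -/(Q _) => /(_ _ wQ); rewrite vsvalK.
have [k kE] := spin_alpha1 zh; exists [:: (k, 1)]; rewrite big_seq1; split=> //.
by move=> _ /[!inE]/eqP->.
Qed.

End Spin.

(** * The Dirac operator on V (x) S *)

Section LinearMaps.
Variables (K : fieldType) (V W : lmodType K) (f : V -> W).
Hypothesis fl : linear f.

Lemma linear_map0 : f 0 = 0.
Proof. by have := fl (-1) 0 0; rewrite scaler0 addr0 scaleN1r addNr. Qed.

Lemma linear_mapD u v : f (u + v) = f u + f v.
Proof. by rewrite -[u]scale1r fl !scale1r. Qed.

Lemma linear_mapZ k u : f (k *: u) = k *: f u.
Proof. by rewrite -[k *: u]addr0 fl linear_map0 addr0. Qed.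

Lemma linear_mapN u : f (- u) = - f u.
Proof. by rewrite -scaleN1r linear_mapZ scaleN1r. Qed.

Lemma linear_mapB u v : f (u - v) = f u - f v.
Proof. by rewrite linear_mapD linear_mapN. Qed.

Lemma linear_map_sum (I : Type) (l : seq I) (Q : pred I) (F : I -> V) :
  f (\sum_(i <- l | Q i) F i) = \sum_(i <- l | Q i) f (F i).
Proof. by elim/big_rec2: _ => [|i p q _ <-]; rewrite ?linear_map0 ?linear_mapD. Qed.

End LinearMaps.

Section Tensors.
Variables (K : fieldType) (V : lmodType K) (S : vectType K).
Implicit Types (t : tensor V S) (v : V) (s : S).

Lemma tens_linl k v v' s : tens (k *: v + v') s = k *: tens v s + tens v' s.
Proof. by apply/ffunP => i; rewrite !ffunE scalerDr !scalerA mulrC. Qed.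

Lemma tens_linr k v s s' : tens v (k *: s + s') = k *: tens v s + tens v s'.
Proof. by apply/ffunP => i; rewrite !ffunE linearP scalerDl scalerA. Qed.

Lemma tensDl v v' s : tens (v + v') s = tens v s + tens v' s.
Proof. by rewrite -[v]scale1r tens_linl !scale1r. Qed.
Lemma tensDr v s s' : tens v (s + s') = tens v s + tens v s'.
Proof. by rewrite -[s]scale1r tens_linr !scale1r. Qed.
Lemma tens0l s : tens (0 : V) s = 0.
Proof. by apply/ffunP => i; rewrite !ffunE scaler0. Qed.
Lemma tens0r v : tens v (0 : S) = 0.
Proof. by apply/ffunP => i; rewrite !ffunE linear0 scale0r. Qed.
Lemma tensZl k v s : tens (k *: v) s = k *: tens v s.
Proof. by rewrite -[k *: v]addr0 tens_linl tens0l addr0. Qed.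
Lemma tensZr k v s : tens v (k *: s) = k *: tens v s.
Proof. by rewrite -[k *: s]addr0 tens_linr tens0r addr0. Qed.
Lemma tensNl v s : tens (- v) s = - tens v s.
Proof. by rewrite -scaleN1r tensZl scaleN1r. Qed.
Lemma tensNr v s : tens v (- s) = - tens v s.
Proof. by rewrite -scaleN1r tensZr scaleN1r. Qed.
Lemma tens_suml (I : Type) (l : seq I) (F : I -> V) s : tens (\sum_(i <- l) F i) s = \sum_(i <- l) tens (F i) s.
Proof. by elim/big_rec2: _ => [|i p q _ <-]; rewrite ?tens0l ?tensDl. Qed.
Lemma tens_sumr (I : Type) (l : seq I) (F : I -> S) v : tens v (\sum_(i <- l) F i) = \sum_(i <- l) tens v (F i).
Proof. by elim/big_rec2: _ => [|i p q _ <-]; rewrite ?tens0r ?tensDr. Qed.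

Lemma tens_basis t : t = \sum_i tens (t i) (vbasis {:S})`_i.
Proof.
apply/ffunP => j; rewrite sum_ffunE (bigD1 j)//= big1 => [|i ij]; rewrite !ffunE.
  by rewrite coord_free ?(basis_free (vbasisP _))// eqxx scale1r addr0.
by rewrite coord_free ?(basis_free (vbasisP _))// (negPf ij) scale0r.
Qed.

Lemma tensor_ind (Q : tensor V S -> Prop) : (forall k t t', Q t -> Q t' -> Q (k *: t + t')) ->
  (forall v s, Q (tens v s)) -> forall t, Q t.
Proof.
move=> QP Qt t; rewrite (tens_basis t); elim/big_rec: _ => [|i p _ Qp].
  by rewrite -(tens0l 0); apply: Qt.
by rewrite -[tens _ _]scale1r; apply: QP.
Qed.

Lemma tens_subP (W : {vspace S}) t : tens_sub W t <->
  exists l : seq (V * S), (forall p, p \in l -> p.2 \in W) /\ t = \sum_(p <- l) tens p.1 p.2.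
Proof.
split=> [[n [v [s [sW ->]]]]|[l [lW ->]]].
  exists [seq (v i, s i) | i <- enum 'I_n]; rewrite big_map big_enum; split=> // _ /mapP[i _ ->].
  exact: sW.
exists (size l), (fun i => (nth (0, 0) l i).1), (fun i => (nth (0, 0) l i).2).
by rewrite (big_nth (0, 0)) big_mkord; split=> // i; apply: lW; apply: mem_nth.
Qed.

Lemma tens_sub_subspace (W : {vspace S}) : is_subspace (tens_sub (V := V) W).
Proof.
split=> [|a u v /tens_subP[l [lW ->]] /tens_subP[l' [lW' ->]]]; apply/tens_subP.
  by exists [::]; rewrite big_nil.
exists ([seq (p.1, a *: p.2) | p <- l] ++ l'); rewrite big_cat big_map scaler_sumr.
split=> [p|]; last by congr (_ + _); apply: eq_bigr => p _; rewrite tensZr.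
by rewrite mem_cat => /orP[/mapP[q ql ->]|/lW'//]; rewrite rpredZ// lW.
Qed.

Variables (A : algType K) (C : falgType K) (aV : algModule A V) (cS : algModule C S).

Lemma tensor_act_linl k (w w' : tensor A C) t :
  tensor_act aV cS (k *: w + w') t = k *: tensor_act aV cS w t + tensor_act aV cS w' t.
Proof.
rewrite /tensor_act scaler_sumr -big_split; apply: eq_bigr => i _ /=.
rewrite scaler_sumr -big_split; apply: eq_bigr => j _ /=.
by rewrite !ffunE linearPl/= tens_linl.
Qed.

Lemma tensor_actDl (w w' : tensor A C) t :
  tensor_act aV cS (w + w') t = tensor_act aV cS w t + tensor_act aV cS w' t.
Proof. by rewrite -[w]scale1r tensor_act_linl !scale1r. Qed.

Lemma tensor_act0l t : tensor_act aV cS 0 t = 0.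
Proof.
by rewrite -(addNr 0) -scaleN1r tensor_act_linl scaleN1r addNr.
Qed.

Lemma tensor_act_tens (a : A) (c : C) v s :
  tensor_act aV cS (tens a c) (tens v s) = tens (aV a v) (cS c s).
Proof.
rewrite /tensor_act; under eq_bigr => i _ do under eq_bigr => j _ do rewrite !ffunE.
rewrite {2}(coord_vbasis (memvf c)) {2}(coord_vbasis (memvf s)).
have sumE (I : finType) (F : I -> C) u : cS (\sum_s F s) u = \sum_s cS (F s) u.
  by elim/big_rec2: _ => [|i p q _ <-]; [exact: linear0l | exact: linearDl].
rewrite sumE tens_sumr; apply: eq_bigr => i _.
rewrite linear_sumr tens_sumr; apply: eq_bigr => j _.
by rewrite !linearZl_LR !linearZr_LR !tensZl !tensZr.
Qed.

End Tensors.

Section DiracAction.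
Variables (K : numClosedFieldType) (g : lieAlgType K) (B : {symmetric g}).
Variables (r : lieSubalg g) (h : {vspace g}) (P : seq 'Hom(subvs_of h, K^o)).
Hypotheses (redg : reductive {:g}) (invB : invariant_form B) (ndB : nondegenerate B).
Hypothesis ndr : (r :&: orthov B r)%VS = 0%VS.
Hypotheses (carg : cartan_subalgebra {:g} h) (carr : cartan_subalgebra r h).
Hypothesis posP : positive_system P.
Variables (U : envelopingAlg g) (C : cliffordAlg (@rperp_form _ _ B r)).
Variables (S : exteriorAlg (subvs_of (splus P r))).
Variables (alpha : {linear subvs_of r -> C}) (cS : algModule C S).
Variables (b d : 'I_(\dim (rperp B r)) -> subvs_of (rperp B r)).
Hypotheses (bdP : dual_bases b d) (alphaP : is_alpha alpha) (spinP : is_spin_module cS).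
Variables (V : lmodType K) (uV : algModule U V).
Local Notation cl := (cliff_in C).
Local Notation pr := (vsproj (rperp B r)).
Local Notation T := (tensor V S).
Local Notation D := (tensor_act uV cS (dirac U C b d)).
Local Notation act := (diag_act uV cS alpha).
Implicit Types (x y : g) (v : V) (s : S) (z : subvs_of r) (t : T).

Lemma rperp_r_stable z y : y \in rperp B r -> 'L[vsval z, y] \in rperp B r.
Proof.
move=> /mem_orthovP yr; apply/mem_orthovP => x xr.
by rewrite lieC formNl invB yr ?oppr0//; apply: lsubalgP => //; apply: subvsP.
Qed.

Lemma dual_expand n (e f : 'I_n -> subvs_of (rperp B r)) y :
  basis_of fullv [seq e i | i : 'I_n] -> (forall i j, B (vsval (e i)) (vsval (f j)) = (i == j)%:R) ->
  y \in rperp B r -> y = \sum_i B y (vsval (f i)) *: vsval (e i).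
Proof.
move=> eb ef yr.
have [|k u v uE vE|W WP] := @vspace_of_prop _ _ (fun u : subvs_of (rperp B r) => vsval u = \sum_i B (vsval u) (vsval (f i)) *: vsval (e i)).
- by rewrite linear0 big1// => i _; rewrite form0l scale0r.
- rewrite linearP/= {1}uE {1}vE scaler_sumr -big_split; apply: eq_bigr => i _ /=.
  by rewrite form_linl scalerDl scalerA.
suff /WP : pr y \in W by rewrite vsprojK.
have : pr y \in fullv by apply: memvf.
apply: subvP; rewrite -(span_basis eb); apply/span_subvP => _ /mapP[i _ ->]; apply/WP.
rewrite (bigD1 i)//= big1 => [|j ji]; rewrite ef; first by rewrite eqxx scale1r addr0.
by rewrite eq_sym (negPf ji) scale0r.
Qed.

Lemma dual_expand_b y : y \in rperp B r -> y = \sum_i B y (vsval (d i)) *: vsval (b i).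
Proof. by have [bb _ bd] := bdP; apply: dual_expand. Qed.

Lemma dual_expand_d y : y \in rperp B r -> y = \sum_i B y (vsval (b i)) *: vsval (d i).
Proof.
have [_ dd bd] := bdP; apply: dual_expand => // i j.
by rewrite formC eq_sym; apply: bd.
Qed.

Definition cubic : C := \sum_(i < \dim (rperp B r)) \sum_(j < \dim (rperp B r) | (i < j)%N)
    \sum_(k < \dim (rperp B r) | (j < k)%N)
    B 'L[vsval (b i), vsval (b j)] (vsval (b k)) *: ch3 C (d i) (d j) (d k).

(** B([x, y], z) is an alternating trilinear form invariant under r, and b and d are dual, so its
    contraction is invariant. *)
Lemma cubicC z : alpha z * cubic = cubic * alpha z.
Proof.
have [_ _ com] := alphaP.
(* [M] is the matrix of ad z on the vectors d, written through b by invariance of B; its negative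
   transpose is the matrix of ad z on the vectors b. *)
pose M i l := - B 'L[vsval z, vsval (b l)] (vsval (d i)).
apply: (cubic_commutes (M := M) (com z)) => [i|i j k|i j k|i j k].
- apply: val_inj; rewrite /= vsprojK ?rperp_r_stable ?subvsP// linear_sum /=.
  rewrite {1}(dual_expand_d (rperp_r_stable z (subvsP (d i)))).
  by apply: eq_bigr => l _; rewrite /M -(invBr invB) formC.
- by rewrite lieC formNl.
- by rewrite invB lieC formNr -invB.
have e1 (f : g -> K) m : (forall c x y, f (c *: x + y) = c * f x + f y) ->
    \sum_l M l m * f (vsval (b l)) = - f 'L[vsval z, vsval (b m)].
  move=> fl; have f0 : f 0 = 0 by have := fl (-1) 0 0; rewrite scaler0 addr0 mulN1r addNr.
  rewrite [in RHS](dual_expand_b (rperp_r_stable z (subvsP (b m)))).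
  rewrite /M; elim/big_rec2: _ => [|l p q _ IH]; first by rewrite f0 oppr0.
  by rewrite fl opprD -IH mulNr.
rewrite !big_split/=.
rewrite (e1 (fun x => B 'L[x, vsval (b j)] (vsval (b k)))); last first.
  by move=> c x y; rewrite lie_is_linearl form_linl.
rewrite (e1 (fun x => B 'L[vsval (b i), x] (vsval (b k)))); last first.
  by move=> c x y; rewrite lie_is_linearr form_linl.
rewrite (e1 (fun x => B 'L[vsval (b i), vsval (b j)] x)); last first.
  by move=> c x y; rewrite form_linr.
rewrite -!opprD; apply/eqP; rewrite oppr_eq0 -formDl -lie_leibniz invBr// formC subrr.
by [].
Qed.

Lemma uV1 v : uV 1 v = v. Proof. exact: algm_act1. Qed.

Lemma env_lie x y v :
  uV (env_in U 'L[x, y]) v = uV (env_in U x) (uV (env_in U y) v) - uV (env_in U y) (uV (env_in U x) v).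
Proof. by have [-> _] := env_universal U; rewrite linearBl !algm_actM. Qed.

Lemma diag_tens z v s :
  act z (tens v s) = tens (uV (env_in U (vsval z)) v) s + tens v (cS (alpha z) s).
Proof. by rewrite /diag_act tensor_actDl !tensor_act_tens uV1 cS1. Qed.

Lemma diag_linear z : linear (act z).
Proof. exact: tensor_act_is_linear. Qed.

Lemma diagD z t t' : act z (t + t') = act z t + act z t'.
Proof. by rewrite -[t]scale1r diag_linear !scale1r. Qed.

Lemma diag_linearl t : linear (act ^~ t).
Proof.
move=> k z z'; rewrite /diag_act -tensor_act_linl; congr (tensor_act _ _ _ _).
by rewrite !linearP tens_linl tens_linr scalerDr addrACA.
Qed.

Lemma diag_lie z z' t : act 'L[z, z'] t = act z (act z' t) - act z' (act z t).
Proof.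
elim/tensor_ind: t => [k t t' e e'|v s].
  by rewrite !diag_linear e e' scalerBr addrACA opprD.
have [al _ _] := alphaP.
rewrite !diag_tens !diagD !diag_tens.
rewrite (_ : vsval 'L[z, z'] = 'L[vsval z, vsval z']) ?vsval_sub_lie//.
rewrite env_lie tensDl tensNl al cSBl !cSM tensDr tensNr.
move: (tens (uV _ (uV _ v)) s) (tens (uV _ (uV _ v)) s) (tens v _) (tens v _) => p q p' q'.
move: (tens _ _) (tens _ _) => o o'.
rewrite !opprD [RHS]((@GRing.add T).[AC ((2*2)*(2*2)) ((1*5)*(4*8)*((2*7)*(3*6)))]) /=.
by rewrite !subrr !addr0.
Qed.

Lemma dirac_linear : linear D.
Proof. exact: tensor_act_is_linear. Qed.

Lemma dirac_tens v s : D (tens v s) =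
  \sum_i tens (uV (env_in U (vsval (b i))) v) (cS (cl (d i)) s) + tens v (cS (2%:R^-1 *: cubic) s).
Proof.
have sumE (I : Type) (l : seq I) (F : I -> tensor U C) t :
    tensor_act uV cS (\sum_(i <- l) F i) t = \sum_(i <- l) tensor_act uV cS (F i) t.
  by elim/big_rec2: _ => [|i p q _ <-]; rewrite ?tensor_act0l ?tensor_actDl.
rewrite /dirac tensor_actDl sumE; congr (_ + _).
  by apply: eq_bigr => i _; rewrite tensor_act_tens.
rewrite (_ : _ *: _ = tens 1 (2%:R^-1 *: cubic)); first by rewrite tensor_act_tens uV1.
rewrite tensZr /cubic; congr (_ *: _).
rewrite tens_sumr; apply: eq_bigr => i _.
rewrite big_mkcond [X in tens 1 X]big_mkcond tens_sumr; apply: eq_bigr => j _; case: ifP => _; last by rewrite tens0r.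
rewrite big_mkcond [X in tens 1 X]big_mkcond tens_sumr; apply: eq_bigr => k _; case: ifP => _; last by rewrite tens0r.
exact/esym/tensZr.
Qed.

Lemma dirac_diag z t : D (act z t) = act z (D t).
Proof.
elim/tensor_ind: t => [k t t' e e'|v s]; first by rewrite !(diag_linear, dirac_linear) e e'.
rewrite diag_tens linearD/= !dirac_tens.
rewrite diagD (linear_map_sum (@diag_linear z)) diag_tens.
have kc : cS (2%:R^-1 *: cubic) (cS (alpha z) s) = cS (alpha z) (cS (2%:R^-1 *: cubic) s).
  by rewrite -!cSM -scalerAl -cubicC scalerAr.
rewrite kc addrACA; congr (_ + _).
under [RHS]eq_bigr => i _ do rewrite diag_tens.
rewrite -big_split/=; apply/eqP; rewrite -subr_eq0 -sumrB; apply/eqP.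
(* On the linear term, the commutator with r is the variation of the canonical tensor of b and d,
   taken through this bilinear map. *)
pose F y y' := - tens (uV (env_in U y) v) (cS (cl (pr y')) s).
pose M i j := B 'L[vsval z, vsval (b i)] (vsval (d j)).
have [_ _ com] := alphaP.
rewrite -[RHS](@casimir_invariant _ g _ F (lie (vsval z)) _ (vsval \o b) (vsval \o d) M) /=.
- apply: eq_bigr => i _; rewrite /F env_lie tensDl tensNl.
  rewrite -com cSBl !cSM !vsvalK tensDr tensNr.
  move: (tens (uV _ (uV _ v)) _) (tens (uV _ (uV _ v)) _) (tens _ (cS (alpha z) _)) (tens _ (cS (cl _) (cS _ _))) => p q p' q'.
  by rewrite !opprB opprD addrACA.
- by move=> y k x x'; rewrite /F !linearP cSl tens_linr opprD scalerN.
- by move=> y k x x'; rewrite /F !linearP linearPl tens_linl opprD scalerN.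
- by move=> i; exact: (dual_expand_b (rperp_r_stable z (subvsP (b i)))).
move=> i; rewrite {1}(dual_expand_d (rperp_r_stable z (subvsP (d i)))) -sumrN.
by apply: eq_bigr => l _; rewrite /M -scaleNr -(invBr invB) formC.
Qed.

Variable th : {lrmorphism S -> S}.
Hypothesis thP : is_sign th.

Definition tsign (t : T) : T := \sum_i tens (t i) (th (vbasis {:S})`_i).

Lemma tsign_linear : linear tsign.
Proof.
move=> k t t'; rewrite /tsign scaler_sumr -big_split; apply: eq_bigr => i _ /=.
by rewrite !ffunE tens_linl.
Qed.

Lemma tsign_tens v s : tsign (tens v s) = tens v (th s).
Proof.
rewrite /tsign [in RHS](coord_vbasis (memvf s)) linear_sum tens_sumr; apply: eq_bigr => i _ /=.
by rewrite ffunE linearZ/= tensZl tensZr.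
Qed.

Lemma tsignK t : tsign (tsign t) = t.
Proof.
elim/tensor_ind: t => [k t t' e e'|v s]; first by rewrite !tsign_linear e e'.
by rewrite !tsign_tens (signK thP).
Qed.

Lemma tsign_diag z t : tsign (act z t) = act z (tsign t).
Proof.
elim/tensor_ind: t => [k t t' e e'|v s]; first by rewrite !(diag_linear, tsign_linear) e e'.
rewrite tsign_tens !diag_tens (linear_mapD tsign_linear) !tsign_tens; congr (_ + tens _ _).
by rewrite (alpha_sign redg invB ndB ndr carg carr posP alphaP spinP thP).
Qed.

Lemma tsign_dirac t : tsign (D t) = - D (tsign t).
Proof.
elim/tensor_ind: t => [k t t' e e'|v s].
  by rewrite !(dirac_linear, tsign_linear) e e' scalerN -opprD.
rewrite tsign_tens !dirac_tens (linear_mapD tsign_linear) (linear_map_sum tsign_linear) tsign_tens opprD -sumrN.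
congr (_ + _).
  apply: eq_bigr => i _; rewrite tsign_tens -tensNr.
  by rewrite (clifford_sign redg invB ndB ndr carg carr posP spinP thP) opprK.
rewrite -tensNr; congr (tens v _); rewrite !cSZl linearZ/= -scalerN; congr (_ *: _).
have sumE (I : Type) (l : seq I) (F : I -> C) u : cS (\sum_(i <- l) F i) u = \sum_(i <- l) cS (F i) u.
  by elim/big_rec2: _ => [|i p q _ <-]; [exact: linear0l | exact: cSDl].
have tr (c : C) : (th (cS c s) == - cS c (th s)) -> th (cS c s) = - cS c (th s) by move/eqP.
have Q0 : th (cS 0 s) = - cS 0 (th s) by rewrite !linear0l linear0 oppr0.
have QD (c c' : C) : th (cS c s) = - cS c (th s) -> th (cS c' s) = - cS c' (th s) ->
    th (cS (c + c') s) = - cS (c + c') (th s).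
  by move=> e e'; rewrite !cSDl linearD/= e e' opprD.
rewrite /cubic; elim/big_rec: _ => [//|i c _ IH]; apply: (QD) => //.
elim/big_rec: _ => [//|j c' _ IH']; apply: (QD) => //.
elim/big_rec: _ => [//|k c'' _ IH'']; apply: (QD) => //.
have := chevalley_sign redg invB ndB ndr carg carr posP spinP thP [tuple d i; d j; d k] s.
rewrite -/(ch3 C (d i) (d j) (d k)); move: (ch3 C _ _ _) => c3.
rewrite -signr_odd /= expr1 scaleN1r !cSZl linearZ/= => ->.
by rewrite scalerN opprK.
Qed.

(** Replaces the existential description of the parity halves by an eigenvalue equation, whose
    behaviour under r and D is immediate. *)
Lemma tens_sub_sign (p : bool) t : tens_sub (ext_parity S p) t <-> tsign t = (-1) ^+ p *: t.
Proof.
have c2 : 2%:R != 0 :> K by rewrite pnatr_eq0.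
split=> [/tens_subP[l [lP ->]]|tE].
  elim: l lP => [|q l IH] lP; first by rewrite big_nil (linear_map0 tsign_linear) scaler0.
  rewrite big_cons (linear_mapD tsign_linear) scalerDr; congr (_ + _).
    by rewrite tsign_tens (ext_parityP thP c2 _ _ (lP q (mem_head _ _))) tensZr.
  by apply: IH => q' ql; apply: lP; rewrite inE ql orbT.
have [s0 sP] := tens_sub_subspace V (ext_parity S p).
have half u : tens_sub (ext_parity S p) (u + (-1) ^+ p *: tsign u).
  elim/tensor_ind: u => [k u u' e e'|v s].
    rewrite tsign_linear scalerDr !scalerA [_ * k]mulrC -scalerA addrACA -scalerDr.
    exact: sP.
  rewrite tsign_tens -tensZr -tensDr; exists 1%N, (fun=> v), (fun=> s + (-1) ^+ p *: th s).
  split=> [_|]; last by rewrite big_ord1.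
  apply/(ext_parityP thP c2); rewrite linearD linearZ/= (signK thP) scalerDr scalerA addrC.
  by rewrite -expr2 sqrr_sign scale1r.
have := sP 2%:R^-1 _ _ (half t) s0; rewrite addr0 tE scalerA -expr2 sqrr_sign scale1r.
by rewrite -mulr2n -scaler_nat scalerA mulVf// scale1r.
Qed.

End DiracAction.

(** * Isotypic decompositions *)

(** Classical equality and choice on types: one representative can be picked per isomorphism class,
    and finite lists of types can be made duplicate-free. *)
HB.instance Definition _ (K : numClosedFieldType) (g : lieAlgType K) (r : {vspace g}) :=
  gen_eqMixin (irrep r).
HB.instance Definition _ (K : numClosedFieldType) (g : lieAlgType K) (r : {vspace g}) :=
  gen_choiceMixin (irrep r).

Section Schur.
Variables (K : numClosedFieldType) (g : lieAlgType K) (r : {vspace g}).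
Implicit Types (c : irrep r).

Definition intertwines c c' (F : 'M[K]_(idim c, idim c')) :=
  {in r, forall x, imx c x *m F = F *m imx c' x}.

Definition irr_iso c c' := exists (f : 'M[K]_(idim c, idim c')) (f' : 'M[K]_(idim c', idim c)),
  [/\ f *m f' = 1%:M, f' *m f = 1%:M & intertwines f].

Lemma irr_iso_refl c : irr_iso c c.
Proof. by exists 1%:M, 1%:M; split; rewrite ?mulmx1// => x _; rewrite mulmx1 mul1mx. Qed.

Lemma irr_iso_sym c c' : irr_iso c c' -> irr_iso c' c.
Proof.
move=> [f [f' [e1 e2 ff]]]; exists f', f; split=> // x xr.
by rewrite -[LHS]mul1mx -e2 -mulmxA (mulmxA f) -ff// -!mulmxA e1 mulmx1.
Qed.

Lemma irr_iso_trans c c' c'' : irr_iso c c' -> irr_iso c' c'' -> irr_iso c c''.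
Proof.
move=> [f [f' [e1 e2 ff]]] [k [k' [e3 e4 kk]]]; exists (f *m k), (k' *m f'); split.
- by rewrite mulmxA -(mulmxA f) e3 mulmx1.
- by rewrite mulmxA -(mulmxA k') e2 mulmx1.
by move=> x xr; rewrite mulmxA ff// -mulmxA kk// mulmxA.
Qed.

Lemma schur_free c c' (F : 'M[K]_(idim c, idim c')) : intertwines F -> F != 0 ->
  row_free F /\ row_full F.
Proof.
move=> FF F0.
have kst : {in r, forall x, stablemx (kermx F) (imx c x)}.
  by move=> x xr; apply/sub_kermxP; rewrite -mulmxA FF// mulmxA mulmx_ker mul0mx.
have gst : {in r, forall x, stablemx <<F>>%MS (imx c' x)}.
  by move=> x xr; rewrite (eqmxMr _ (genmxE F)) genmxE -FF// submxMl.
split.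
  have [kF|kF] := irr_simple kst; first by rewrite -kermx_eq0 kF.
  by case/negP: F0; apply/eqP; rewrite -[F]mul1mx; apply/sub_kermxP; rewrite sub1mx.
have [gF|gF] := irr_simple gst; first by case/negP: F0; rewrite -submx0 -genmxE gF.
by rewrite -sub1mx -(genmxE F) sub1mx.
Qed.

Lemma schur_iso c c' (F : 'M[K]_(idim c, idim c')) : intertwines F -> F != 0 -> irr_iso c c'.
Proof.
move=> FF F0; have [/row_freeP[G FG] /row_fullP[G' GF]] := schur_free FF F0.
by exists F, G; split=> //; rewrite -[G]mul1mx -GF -(mulmxA G') FG mulmx1.
Qed.

Lemma schur_scalar c (F : 'M[K]_(idim c)) : intertwines F -> exists a, F = a%:M.
Proof.
move=> FF; have [a] : exists a, root (char_poly F) a.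
  by apply/closed_rootP; rewrite size_char_poly eqSS -lt0n irr_gt0.
rewrite -eigenvalue_root_char => /eigenvalueP[v vF v0].
exists a; apply/eqP; rewrite -subr_eq0; apply: contraT => Fa.
have [|/row_freeP[G FG] _] := schur_free _ Fa.
  by move=> x xr; rewrite mulmxBr mulmxBl FF// scalar_mxC.
case/negP: v0; rewrite -[v]mulmx1 -FG mulmxA mulmxBr vF mul_mx_scalar subrr mul0mx.
by [].
Qed.

Definition irr_class c : irrep r :=
  xchoose (ex_intro (fun c' => `[< irr_iso c c' >]) c (asboolT (irr_iso_refl c))).

Lemma irr_class_iso c : irr_iso c (irr_class c).
Proof. by apply/asboolP; apply: (xchooseP (ex_intro (fun c' => `[< irr_iso c c' >]) c _)). Qed.

Lemma irr_class_eq c c' : irr_iso c c' -> irr_class c = irr_class c'.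
Proof.
move=> cc; apply: eq_xchoose => c''; apply: asbool_equiv_eq.
by split; [apply: irr_iso_trans; apply: irr_iso_sym | apply: irr_iso_trans].
Qed.

Lemma irr_classK c : irr_class (irr_class c) = irr_class c.
Proof. by apply/esym/irr_class_eq/irr_class_iso. Qed.

Lemma irr_class_inj c c' : irr_class c = c -> irr_class c' = c' -> irr_iso c c' -> c = c'.
Proof. by move=> e e' /irr_class_eq; rewrite e e'. Qed.

End Schur.

Lemma mx_of_prop (K : fieldType) n (Q : 'rV[K]_n -> Prop) : Q 0 ->
  (forall a u v, Q u -> Q v -> Q (a *: u + v)) -> exists U : 'M[K]_n, forall v, (v <= U)%MS <-> Q v.
Proof.
move=> Q0 QP; have [W WP] := vspace_of_prop Q0 QP.
have sW : (\dim W <= n)%N by rewrite (leq_trans (dimvS (subvf W)))// dimvf /dim /= mul1n.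
exists (\matrix_i (vbasis W)`_i) => v; split=> [/submxP[a ->]|/WP vW].
  rewrite mulmx_sum_row; apply/WP; apply: rpred_sum => i _; rewrite rowK rpredZ//.
  have [iW|iW] := ltnP i (\dim W); first by rewrite vbasis_mem// mem_nth// size_tuple.
  by rewrite nth_default ?mem0v// size_tuple.
rewrite (coord_vbasis vW); apply: summx_sub => i _; apply: scalemx_sub.
by rewrite -(rowK (fun j : 'I_n => (vbasis W)`_j) (widen_ord sW i)) row_sub.
Qed.

(** * Coordinates on irreducible modules *)

Section RowModel.
Variables (K : numClosedFieldType) (g : lieAlgType K) (r : lieSubalg g).
Implicit Types (M N : premodule (subvs_of r : lieAlgType K)) (c : irrep r).

Definition row_model M c (phi : 'rV[K]_(idim c) -> M) :=
  [/\ linear phi, injective phi, carrier M = range phi &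
      forall x v, action M x (phi v) = phi (v *m imx c (vsval x))].

Lemma row_model_finite_dim M c (phi : 'rV[K]_(idim c) -> M) : row_model phi -> finite_dim M.
Proof.
move=> [lp ip Mp _]; exists (idim c), (fun i => phi (delta_mx 0 i)).
rewrite Mp; apply/seteqP; split=> _ /= [v _ <-].
  exists (v 0) => //; rewrite [in RHS](row_sum_delta v) (linear_map_sum lp).
  by apply: eq_bigr => i _; rewrite (linear_mapZ lp).
exists (\row_i v i) => //; rewrite [LHS](_ : _ = phi (\sum_i v i *: delta_mx 0 i)).
  by rewrite (linear_map_sum lp); apply: eq_bigr => i _; rewrite (linear_mapZ lp).
by congr phi; rewrite [LHS]row_sum_delta; apply: eq_bigr => i _; rewrite mxE.
Qed.

Lemma row_model_irreducible M c (phi : 'rV[K]_(idim c) -> M) : row_model phi -> irreducible M.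
Proof.
move=> [lp ip Mp ap]; have p0 := linear_map0 lp; split=> [M0|W [[W0 WP] WM Wx]].
  have : carrier M (phi (delta_mx 0 (Ordinal (irr_gt0 c)))) by rewrite Mp; exists (delta_mx 0 (Ordinal (irr_gt0 c))).
  rewrite M0 /= -p0 => /ip /matrixP /(_ 0 (Ordinal (irr_gt0 c))) /eqP.
  by rewrite !mxE !eqxx oner_eq0.
have [|a u v Wu Wv|U UP] := @mx_of_prop _ _ (fun v => W (phi v)); first by rewrite p0.
  by rewrite lp; apply: WP.
have stU : {in r, forall x, stablemx U (imx c x)}.
  move=> x xr; apply/row_subP => i; rewrite row_mul; apply/UP.
  rewrite -(vsprojK xr) -ap; apply: Wx; apply/UP; exact: row_sub.
have [U0|Uf] := irr_simple stU; [left | right]; apply/seteqP; split=> u /= Wu.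
- have := WM u Wu; rewrite Mp => -[v _ vu]; move: Wu; rewrite -vu => /UP.
  by rewrite U0 submx0 => /eqP->.
- by rewrite Wu.
- exact: WM.
- by move: Wu; rewrite Mp => -[v _ <-]; apply/UP; apply: submx_full.
Qed.

Lemma row_model_isoP M N c c' (phi : 'rV[K]_(idim c) -> M) (psi : 'rV[K]_(idim c') -> N) :
  row_model phi -> row_model psi -> isomorphic M N <-> irr_iso c c'.
Proof.
move=> [lp ip Mp ap] [lq iq Nq aq]; split=> [[f [fl [f_in f_inj _] fa]]|[F [F' [e1 e2 FF]]]].
  have Mphi v : carrier M (phi v) by rewrite Mp; exists v.
  have ex v : exists w, f (phi v) = psi w.
    by have := f_in _ (Mphi v); rewrite Nq => -[w _ <-]; exists w.
  have [G GP] := choice ex.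
  have Gl : linear G by move=> a u v; apply: iq; rewrite lq -!GP lp fl.
  have [G' GE] := mk_linear Gl.
  have G1 v : v *m lin1_mx G' = G v by rewrite mul_rV_lin1/= GE.
  apply: (@schur_iso _ _ _ c c' (lin1_mx G')) => [x xr|].
    apply/row_matrixP => i; rewrite !rowE !mulmxA !G1; apply: iq.
    by rewrite -GP -(vsprojK xr) -ap fa// GP aq.
  apply/eqP => G0; have : phi (delta_mx 0 (Ordinal (irr_gt0 c))) = phi 0.
    apply: f_inj; rewrite ?inE//=; rewrite !GP -!G1 G0 !mulmx0//.
  by move/ip/matrixP/(_ 0 (Ordinal (irr_gt0 c)))/eqP; rewrite !mxE !eqxx oner_eq0.
have ex u : exists v, carrier M u -> phi v = u.
  by have [uM|//] := pselect (carrier M u); [move: uM; rewrite Mp => -[v _ <-]; exists v | exists 0].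
have [k kP] := choice ex.
have kK v : k (phi v) = v by apply: ip; rewrite kP// Mp; exists v.
exists (fun u => psi (k u *m F)); split.
- move=> a u v; rewrite Mp => -[u' _ <-] [v' _ <-]; rewrite -lp !kK.
  by rewrite mulmxDl -scalemxAl lq.
- split=> [u|u v|u].
  + by move=> _ /=; rewrite Nq; exists (k u *m F).
  + rewrite !inE /= Mp => -[u' _ <-] [v' _ <-]; rewrite !kK => /iq e.
    by rewrite -[u']mulmx1 -e1 mulmxA e -mulmxA e1 mulmx1.
  rewrite Nq => -[w _ <-] /=; exists (phi (w *m F')); first by rewrite Mp; exists (w *m F').
  by rewrite kK -mulmxA e2 mulmx1.
move=> x u; rewrite Mp => -[u' _ <-]; rewrite ap !kK aq.
by rewrite -!mulmxA FF// subvsP.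
Qed.

Lemma row_model_exists M : is_module M -> irreducible M -> finite_dim M ->
  exists c (phi : 'rV[K]_(idim c) -> M), row_model phi.
Proof.
move=> [[[M0 MP] _ Mx] ml mr mlie] [nz simp] fd.
(* [finite_dim] only provides a spanning family; a shortest one is free. *)
have [N eN minN] : exists2 N, (exists e : 'I_N -> M, carrier M = range (fun k : 'I_N -> K => \sum_i k i *: e i)) &
    forall l, (exists e : 'I_l -> M, carrier M = range (fun k : 'I_l -> K => \sum_i k i *: e i)) -> (N <= l)%N.
  have ex : exists N : nat, `[< exists e : 'I_N -> M, carrier M = range (fun k : 'I_N -> K => \sum_i k i *: e i) >].
    by have [N [e eE]] := fd; exists N; apply/asboolP; exists e.
  exists (ex_minn ex); case: ex_minnP => N /asboolP // eN mN l eN'.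
  by apply: mN; apply/asboolP.
have [e eE] := eN.
pose phi (v : 'rV[K]_N) := \sum_i v 0 i *: e i.
have lp : linear phi.
  move=> a u v; rewrite /phi scaler_sumr -big_split; apply: eq_bigr => i _ /=.
  by rewrite !mxE scalerDl scalerA.
have Mp : carrier M = range phi.
  rewrite eE; apply/seteqP; split=> _ /= [v _ <-].
    by exists (\row_i v i) => //; apply: eq_bigr => i _; rewrite mxE.
  by exists (v 0).
have ip : injective phi.
  move=> u v; rewrite -[u](subrK v) (linear_mapD lp) => /eqP.
  rewrite -[X in _ == X]add0r (inj_eq (addIr _)); move: (u - v) => w /eqP w0.
  suff -> : w = 0 by rewrite add0r.
  apply/rowP => i; rewrite mxE; apply/eqP; apply: contraT => wi.
  have Npos : (0 < N)%N by apply: leq_ltn_trans (ltn_ord i).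
  suff /minN : exists e : 'I_N.-1 -> M, carrier M = range (fun k : 'I_N.-1 -> K => \sum_i k i *: e i).
    by rewrite leqNgt prednK// leqnn.
  have phiE v' : phi v' = \sum_i v' 0 i *: e i by [].
  move: i e phi phiE lp Mp w w0 wi {eE}; rewrite -(prednK Npos) /= => i e phi phiE lp Mp w w0 wi.
  exists (fun j => e (lift i j)).
  rewrite Mp; apply/seteqP; split=> _ /= [t _ <-].
    pose t' := t - (t 0 i / w 0 i) *: w.
    exists (fun j => t' 0 (lift i j)) => //.
    have -> : phi t = phi t'.
      by rewrite /t' (linear_mapB lp) (linear_mapZ lp) w0 scaler0 subr0.
    rewrite phiE (bigD1_ord i)//= [t' 0 i](_ : _ = 0) ?scale0r ?add0r//.
    by rewrite !mxE divfK// subrr.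
  exists (\row_j (if unlift i j is Some k then t k else 0)) => //.
  rewrite phiE (bigD1_ord i)//= mxE unlift_none scale0r add0r.
  by apply: eq_bigr => j _; rewrite mxE liftK.
have Mphi v : carrier M (phi v) by rewrite Mp; exists v.
have ex u : exists v, carrier M u -> phi v = u.
  by have [uM|//] := pselect (carrier M u); [move: uM; rewrite Mp => -[v _ <-]; exists v | exists 0].
have [k kP] := choice ex.
have kK v : k (phi v) = v by apply: ip; rewrite kP// Mp; exists v.
(* The projection onto r extends the action linearly to g, where [irrep] wants its matrices
   defined. *)
pose Y (x : g) : 'M[K]_N := \matrix_i k (action M (vsproj r x) (phi (delta_mx 0 i))).
have Yv x v : phi (v *m Y x) = action M (vsproj r x) (phi v).
  have al : linear (fun v => action M (vsproj r x) (phi v)) by move=> a u w; rewrite lp ml.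
  rewrite {2}(row_sum_delta v) (linear_map_sum al) mulmx_sum_row (linear_map_sum lp).
  apply: eq_bigr => i _; rewrite (linear_mapZ lp) (linear_mapZ al) rowK kP//.
  exact: Mx.
have Yl : linear Y.
  move=> a x y; apply/row_matrixP => i; rewrite !rowE mulmxDr -scalemxAr; apply: ip.
  by rewrite lp !Yv linearP mr.
have [Z ZE] := mk_linear Yl.
have Zr : lie_rep r Z.
  move=> x y xr yr; rewrite !ZE; apply/row_matrixP => i; rewrite !rowE mulmxBr; apply: ip.
  rewrite (linear_mapB lp) !mulmxA !Yv -mlie//; congr (action M _ _).
  by apply: val_inj; rewrite [RHS]vsval_sub_lie /= !vsprojK// lsubalgP.
have Ngt : (0 < N)%N.
  rewrite lt0n; apply/eqP => N0; apply: nz; rewrite eE; apply/seteqP; split=> u /=.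
    by move=> [v _ <-]; rewrite big1// => -[i iN]; exfalso; move: iN; rewrite N0.
  by move=> ->; exists (fun=> 0) => //; rewrite big1// => i _; rewrite scale0r.
have Zs (U : 'M[K]_N) : {in r, forall x, stablemx U (Z x)} -> U = 0 \/ row_full U.
  move=> stU; pose W : set M := fun u => exists2 v, (v <= U)%MS & phi v = u.
  have sW : is_submodule W.
    split.
    - split=> [|a _ _ [u uU <-] [v vU <-]]; first by exists 0; rewrite ?sub0mx ?(linear_map0 lp).
      by exists (a *: u + v); rewrite ?lp// addmx_sub// scalemx_sub.
    - by move=> _ [v _ <-].
    move=> x _ [v vU <-]; exists (v *m Z (vsval x)); last by rewrite ZE Yv vsvalK.
    by apply: submx_trans (submxMr _ vU) _; apply: stU; apply: subvsP.
  have [W0|WM] := simp W sW; [left | right].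
    apply/row_matrixP => i; rewrite row0; apply: ip; rewrite (linear_map0 lp).
    have : W (phi (row i U)) by exists (row i U); rewrite ?row_sub.
    by rewrite W0.
  rewrite -sub1mx; apply/row_subP => i; have : W (phi (row i 1%:M)) by rewrite WM.
  by move=> [v vU /ip <-].
exists (Irrep Zr Ngt Zs), phi; split=> // x v /=.
by rewrite ZE Yv vsvalK.
Qed.

End RowModel.

(** * Isotypic components and multiplicities *)

Section Multiplicities.
Variables (K : numClosedFieldType) (g : lieAlgType K) (r : lieSubalg g).
Notation irr := (irrep r).
Notation premod := (premodule (subvs_of r : lieAlgType K)).
Implicit Types (c : irr) (s t : seq irr) (m : irr -> nat).

(** Multiplicities live on the chosen representatives only, so that no isomorphism class is split
    over several types. *)
Definition on_classes m := forall c, (0 < m c)%N -> irr_class c = c.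

(* [Phi c] identifies the isotypic component of type [c] with [m c] copies of the dual
   description of [c]: each column of a matrix is a vector of the irreducible [c]. *)
Definition mdec (M : premod) m (Phi : forall c, 'M[K]_(idim c, m c) -> M) :=
  [/\ forall c, linear (Phi c), forall c A, carrier M (Phi c A),
      forall c x A, action M x (Phi c A) = Phi c ((imx c (vsval x))^T *m A),
      forall u, carrier M u -> exists s (A : forall c, 'M[K]_(idim c, m c)),
        uniq s /\ u = \sum_(c <- s) Phi c (A c) &
      forall s (A : forall c, 'M[K]_(idim c, m c)), uniq s ->
        \sum_(c <- s) Phi c (A c) = 0 -> forall c, c \in s -> A c = 0].

Section Coordinates.
Variables (M : premod) (m : irr -> nat) (Phi : forall c, 'M[K]_(idim c, m c) -> M).
Hypotheses (modM : is_module M) (MP : mdec Phi).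

Let Phil c : linear (Phi (c := c)). Proof. by case: MP. Qed.
Let Phi0 c : Phi (0 : 'M_(idim c, m c)) = 0 := linear_map0 (@Phil c).

(** Requiring [A] to vanish off [s] makes it depend on u alone, so decompositions with different
    supports can be compared. *)
Definition coords (u : M) s (A : forall c, 'M[K]_(idim c, m c)) :=
  [/\ uniq s, forall c, c \notin s -> A c = 0 & u = \sum_(c <- s) Phi (A c)].

Lemma coords_exist u : carrier M u -> exists s A, coords u s A.
Proof.
case: MP => _ _ _ sp _ /sp[s [A [us ->]]].
exists s, (fun c => if c \in s then A c else 0); split=> // [c /negPf->//|].
by apply: eq_big_seq => c ->.
Qed.

Lemma coords_widen u s t A : coords u s A -> uniq t -> {subset s <= t} ->
  u = \sum_(c <- t) Phi (A c).
Proof.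
move=> [us As ->] ut st; rewrite [RHS](bigID (mem s)) /= [X in _ + X]big1 => [|c /As->]; last exact: Phi0.
rewrite addr0 -[RHS]big_filter; apply: perm_big; apply: uniq_perm => //; first exact: filter_uniq.
by move=> c; rewrite mem_filter andbC; case: (boolP (c \in s)) => [/st->|]; rewrite ?andbF.
Qed.

Lemma coords_linear a u v s t A B : coords u s A -> coords v t B ->
  coords (a *: u + v) (undup (s ++ t)) (fun c => a *: A c + B c).
Proof.
move=> cu cv; have uu := undup_uniq (s ++ t); split=> // [c|].
  rewrite mem_undup mem_cat => /norP[cs ct]; have [_ -> // _] := cu; have [_ -> // _] := cv.
  by rewrite scaler0 addr0.
rewrite {1}(coords_widen cu uu) => [|c cs]; last by rewrite mem_undup mem_cat cs.
rewrite {1}(coords_widen cv uu) => [|c ct]; last by rewrite mem_undup mem_cat ct orbT.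
by rewrite scaler_sumr -big_split; apply: eq_bigr => c _; rewrite Phil.
Qed.

Lemma coords_unique u s t A B : coords u s A -> coords u t B -> forall c, A c = B c.
Proof.
move=> cu cv c; have [uu off e] := coords_linear (-1) cu cv.
have [cst|/off e0] := boolP (c \in undup (s ++ t)); last first.
  by apply/esym/eqP; rewrite -subr_eq0 addrC -scaleN1r e0.
have [_ _ _ _ ind] := MP.
have := ind _ (fun c => -1 *: A c + B c) uu; rewrite -e scaleN1r addNr => /(_ erefl _ cst)/eqP.
by rewrite scaleN1r addrC subr_eq0 => /eqP.
Qed.

Lemma coords_action x u s A : coords u s A ->
  coords (action M x u) s (fun c => (imx c (vsval x))^T *m A c).
Proof.
move=> [us As ->]; split=> // [c /As->|]; first by rewrite mulmx0.
have [[[M0 MD] _ _] ml _ _] := modM; have [_ Pc Pa _ _] := MP.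
have ml0 : action M x 0 = 0.
  by have := ml x (-1) 0 0 M0 M0; rewrite scaler0 addr0 scaleN1r addNr.
elim: s {us As} => [|c s IH]; first by rewrite !big_nil.
rewrite !big_cons -[Phi (A c)]scale1r ml//; first by rewrite scale1r IH Pa.
elim: (s) => [|c' s' IHs]; rewrite ?big_nil// big_cons -[Phi _]scale1r.
exact: MD.
Qed.

Lemma coords_one c (A : 'M_(idim c, m c)) :
  coords (Phi A) [:: c] (dfwith (fun d => 0 : 'M_(idim d, m d)) A).
Proof.
split=> // [c'|]; last by rewrite big_seq1 dfwith_in.
by rewrite inE eq_sym => cc; rewrite dfwith_out.
Qed.

Lemma Phi_inj c (A : 'M_(idim c, m c)) : Phi A = 0 -> A = 0.
Proof.
move=> A0; have [_ _ _ _ ind] := MP.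
have := ind [:: c] (dfwith (fun d => 0 : 'M_(idim d, m d)) A) isT; rewrite big_seq1 dfwith_in.
by move=> /(_ A0 c (mem_head _ _)); rewrite dfwith_in.
Qed.

Definition copy (q : {c : irr & 'I_(m c)}) : set M :=
  [set u | exists a : 'cV_(idim (tag q)), Phi (a *m delta_mx 0 (tagged q)) = u].

Lemma copy_row_model (q : {c : irr & 'I_(m c)}) :
  @row_model _ _ _ (submodule (copy q)) (tag q) (fun v => Phi (v^T *m delta_mx 0 (tagged q))).
Proof.
have [_ _ Pa _ _] := MP; have el : linear (fun v : 'rV_(idim (tag q)) => Phi (v^T *m delta_mx 0 (tagged q))).
  by move=> a u v; rewrite linearP mulmxDl -scalemxAl Phil.
split=> //.
- move=> u v /eqP; rewrite -subr_eq0 -(linear_mapB el) => /eqP /Phi_inj e.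
  apply/eqP; rewrite -subr_eq0; apply/eqP/rowP => i.
  by move/matrixP: e => /(_ i (tagged q)); rewrite !mxE big_ord1 !mxE !eqxx mulr1.
- apply/seteqP; split=> [_ [a <-]|_ [a _ <-]] /=; last by exists a^T.
  by exists a^T => //; rewrite trmxK.
by move=> x v /=; rewrite Pa mulmxA -trmx_mul.
Qed.

Lemma mdec_semisimple : on_classes m -> semisimple_admissible M.
Proof.
move=> cm; split=> //; exists {c : irr & 'I_(m c)}, copy; split; last 2 first.
- move=> q; have qm := copy_row_model q.
  by split; [apply: row_model_irreducible qm | apply: row_model_finite_dim qm].
- move=> q; apply: (@sub_finite_set _ _ [set` [seq Tagged (fun c => 'I_(m c)) j | j <- enum 'I_(m (tag q))]]).
    move=> q' /= /(row_model_isoP (copy_row_model q) (copy_row_model q')) iso.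
    have qE (p : {c : irr & 'I_(m c)}) : irr_class (tag p) = tag p.
      by apply: cm; apply: leq_ltn_trans (ltn_ord (tagged p)).
    have := irr_class_inj (qE q) (qE q') iso; case: q' {iso} => c' j /= cc; subst c'.
    by apply: map_f; rewrite mem_enum.
  exact: finite_seq.
have [_ Pc Pa sp ind] := MP; split.
- move=> q; split.
  + split; first by exists 0; rewrite mul0mx Phi0.
    by move=> a _ _ [u <-] [v <-]; exists (a *: u + v); rewrite mulmxDl -scalemxAl Phil.
  + by move=> _ [a <-]; apply: Pc.
  by move=> x _ [a <-]; exists ((imx (tag q) (vsval x))^T *m a); rewrite Pa mulmxA.
- move=> u /sp[s [A [us ->]]].
  exists [seq Tagged (fun c => 'I_(m c)) j | c <- s, j <- enum 'I_(m c)].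
  exists (fun q => Phi (col (tagged q) (A (tag q)) *m delta_mx 0 (tagged q))).
  split; first by move=> q; exists (col (tagged q) (A (tag q))).
  rewrite big_allpairs_dep; apply: eq_bigr => c _; rewrite big_enum /=.
  rewrite -(linear_map_sum (@Phil c)); congr Phi; apply/matrixP => i j.
  rewrite summxE (bigD1 j)//= big1 => [|k kj]; rewrite !mxE big_ord1 !mxE.
    by rewrite !eqxx mulr1 addr0.
  by rewrite [j == k]eq_sym (negPf kj) andbF mulr0.
move=> s w us wF w0.
have [b bE] : exists b : forall q : {c : irr & 'I_(m c)}, 'cV[K]_(idim (tag q)), forall q, Phi (b q *m delta_mx 0 (tagged q)) = w q.
  exists (fun q => sval (cid (wF q))) => q; exact: (svalP (cid (wF q))).
pose A c : 'M[K]_(idim c, m c) :=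
  \sum_(j < m c | Tagged (fun c => 'I_(m c)) j \in s) (b (Tagged (fun c => 'I_(m c)) j) : 'cV_(idim c)) *m delta_mx 0 j.
have := ind (undup (map tag s)) A (undup_uniq _).
rewrite (_ : \sum_(c <- _) _ = \sum_(q <- s) w q) => [/(_ w0) Az q qs|].
  rewrite -bE (_ : b q *m _ = 0) ?Phi0//; have := Az (tag q).
  rewrite mem_undup map_f// => /(_ isT) A0.
  have : A (tag q) *m delta_mx (tagged q) (tagged q) = 0 by rewrite A0 mul0mx.
  rewrite /A mulmx_suml (bigD1 (tagged q))/=; last by case: (q) qs.
  rewrite big1 => [|j /andP[_ jq]]; last by rewrite -mulmxA mul_delta_mx_0 ?mulmx0.
  by rewrite addr0 -mulmxA mul_delta_mx; case: (q).
transitivity (\sum_(q <- [seq Tagged (fun c => 'I_(m c)) j | c <- undup (map tag s), j <- enum 'I_(m c)] | q \in s) w q).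
  rewrite [RHS]big_mkcond [RHS]big_allpairs_dep; apply: eq_bigr => c _; rewrite [RHS]big_enum /=.
  rewrite /A (linear_map_sum (@Phil c)) [LHS]big_mkcond; apply: eq_bigr => j _.
  by case: ifP => // _; rewrite -bE.
rewrite -[LHS]big_filter; apply: perm_big; apply: uniq_perm => //.
  apply: filter_uniq; apply: allpairs_uniq_dep => [|c _|]; rewrite ?undup_uniq ?enum_uniq//.
  by move=> [c j] [c' j'] _ _ /= e; have := congr1 tag e => /= ?; subst; move/eqP: e; rewrite eq_Tagged /= => /eqP->.
move=> q; rewrite mem_filter; case: (boolP (q \in s)) => //= qs.
apply/allpairsPdep; exists (tag q), (tagged q); rewrite mem_undup map_f// mem_enum.
by case: (q).
Qed.

End Coordinates.

Lemma mdec_isomorphic (M N : premod) m (Phi : forall c, 'M[K]_(idim c, m c) -> M)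
    (Psi : forall c, 'M[K]_(idim c, m c) -> N) :
  is_module M -> is_module N -> mdec Phi -> mdec Psi -> isomorphic M N.
Proof.
move=> mM mN MP NP.
have ex u : exists v, carrier M u -> exists s A, coords Phi u s A /\ coords Psi v s A.
  have [/(coords_exist MP)[s [A cA]]|//] := pselect (carrier M u); last by exists 0.
  exists (\sum_(c <- s) Psi c (A c)) => _; exists s, A; split=> //.
  by case: cA => us As _; split.
have [f fP] := choice ex.
have fE u s A : carrier M u -> coords Phi u s A -> coords Psi (f u) s A.
  move=> uM cA; have [t [B [cB cfu]]] := fP u uM.
  have AB := coords_unique MP cA cB; have [us As _] := cA; split=> //.
  have [ut Bt _] := cB.
  have c' : coords Psi (f u) t A.
    by case: cfu => _ _ ->; split=> // [c /Bt <-|]; [exact: AB | apply: eq_bigr => c _; rewrite AB].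
  have uu := undup_uniq (s ++ t).
  rewrite (coords_widen NP c' uu) => [|c ct]; last by rewrite mem_undup mem_cat ct orbT.
  have c'' : coords Psi (\sum_(c <- s) Psi c (A c)) s A by split.
  by rewrite [RHS](coords_widen NP c'' uu)// => c cs; rewrite mem_undup mem_cat cs.
have Psi_car s A : carrier N (\sum_(c <- s) Psi c (A c)).
  have [[[N0 ND] _ _] _ _ _] := mN; have [_ Pc _ _ _] := NP.
  by elim: s => [|c s IH]; rewrite ?big_nil// big_cons -[Psi _ _]scale1r; apply: ND.
have Phi_car s A : carrier M (\sum_(c <- s) Phi c (A c)).
  have [[[N0 ND] _ _] _ _ _] := mM; have [_ Pc _ _ _] := MP.
  by elim: s => [|c s IH]; rewrite ?big_nil// big_cons -[Phi _ _]scale1r; apply: ND.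
have [[[M0 MD] _ Mx] _ _ _] := mM.
exists f; split.
- move=> a u v uM vM.
  have [s [A cA]] := coords_exist MP uM; have [t [B cB]] := coords_exist MP vM.
  have [_ _ ->] := fE _ _ _ (MD a _ _ uM vM) (coords_linear MP a cA cB).
  by have [_ _ <-] := coords_linear NP a (fE _ _ _ uM cA) (fE _ _ _ vM cB).
- split=> [u /= uM|u v|v /= vN].
  + by have [s [A cA]] := coords_exist MP uM; have [_ _ ->] := fE _ _ _ uM cA.
  + rewrite !inE => uM vM fuv.
    have [s [A cA]] := coords_exist MP uM; have [t [B cB]] := coords_exist MP vM.
    have := fE _ _ _ uM cA; rewrite fuv => /(coords_unique NP (fE _ _ _ vM cB)) BA.
    have uu := undup_uniq (s ++ t).
    rewrite (coords_widen MP cA uu) => [|c cs]; last by rewrite mem_undup mem_cat cs.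
    rewrite (coords_widen MP cB uu) => [|c ct]; last by rewrite mem_undup mem_cat ct orbT.
    by apply: eq_bigr => c _; rewrite BA.
  have [s [A [us As vE]]] := coords_exist NP vN.
  exists (\sum_(c <- s) Phi c (A c)) => //.
  have cA : coords Phi (\sum_(c <- s) Phi c (A c)) s A by [].
  by have [_ _ ->] := fE _ _ _ (Phi_car s A) cA.
move=> x u uM; have [s [A cA]] := coords_exist MP uM.
have [_ _ ->] := fE _ _ _ (Mx x u uM) (coords_action mM MP x cA).
by have [_ _ <-] := coords_action mN NP x (fE _ _ _ uM cA).
Qed.

Lemma dsum_module (M N : premod) : is_module M -> is_module N -> is_module (dsum M N).
Proof.
move=> [[[M0 MD] _ Mx] ml mr mL] [[[N0 ND] _ Nx] nl nr nL]; split.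
- split=> //; last by move=> x u [/= uM uN]; split; [apply: Mx | apply: Nx].
  by split=> // a u v [uM uN] [vM vN]; split; [apply: MD | apply: ND].
- by move=> x a u v [uM uN] [vM vN] /=; rewrite ml// nl.
- by move=> u [uM uN] a x y /=; rewrite mr// nr.
by move=> x y u [uM uN] /=; rewrite mL// nL.
Qed.

Lemma mdec_dsum (M N : premod) m n (Phi : forall c, 'M[K]_(idim c, m c) -> M)
    (Psi : forall c, 'M[K]_(idim c, n c) -> N) : mdec Phi -> mdec Psi ->
  mdec (M := dsum M N) (m := fun c => (m c + n c)%N) (fun c A => (Phi c (lsubmx A), Psi c (rsubmx A))).
Proof.
move=> MP NP; have [pl pc pa ps pi] := MP; have [ql qc qa qs qi] := NP; split.
- by move=> c a A B; rewrite !linearP /= pl ql.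
- by move=> c A; split; [apply: pc | apply: qc].
- move=> c x A /=; rewrite pa qa; congr (Phi c _, Psi c _).
    by rewrite -[in RHS](hsubmxK A) mul_mx_row row_mxKl.
  by rewrite -[in RHS](hsubmxK A) mul_mx_row row_mxKr.
- move=> [u v] [/= uM vN]; have [s [A cA]] := coords_exist MP uM; have [t [B cB]] := coords_exist NP vN.
  have uu := undup_uniq (s ++ t); exists (undup (s ++ t)), (fun c => row_mx (A c) (B c)); split=> //.
  rewrite [LHS](_ : _ = (\sum_(c <- undup (s ++ t)) Phi c (A c), \sum_(c <- undup (s ++ t)) Psi c (B c))).
    by elim: (undup _) => [|c w IH]; rewrite ?big_nil// !big_cons -IH row_mxKl row_mxKr.
  congr (_, _).
    by apply: (coords_widen MP cA uu) => c cs; rewrite mem_undup mem_cat cs.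
  by apply: (coords_widen NP cB uu) => c cs; rewrite mem_undup mem_cat cs orbT.
move=> s A us e c cs.
have sumE w : \sum_(c <- w) (Phi c (lsubmx (A c)), Psi c (rsubmx (A c))) =
    (\sum_(c <- w) Phi c (lsubmx (A c)), \sum_(c <- w) Psi c (rsubmx (A c))).
  by elim: w => [|d w IH]; rewrite ?big_nil// !big_cons IH.
have e1 : \sum_(c <- s) Phi c (lsubmx (A c)) = 0 by have := congr1 fst e; rewrite sumE.
have e2 : \sum_(c <- s) Psi c (rsubmx (A c)) = 0 by have := congr1 snd e; rewrite sumE.
rewrite -[A c]hsubmxK (pi s (fun c => lsubmx (A c)) us e1 c cs) (qi s (fun c => rsubmx (A c)) us e2 c cs).
by rewrite row_mx0.
Qed.

Definition zero_module : premod := Premodule K^o (fun _ _ => 0) [set 0].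

Lemma zero_moduleP : is_module zero_module.
Proof.
split; first split=> //.
- by split=> // a u v /= -> ->; rewrite scaler0 addr0.
- by move=> x a u v _ _; rewrite scaler0 addr0.
- by move=> u _ a x y; rewrite scaler0 addr0.
by move=> x y u _; rewrite subrr.
Qed.

Lemma mdec_zero : mdec (M := zero_module) (m := fun=> 0%N) (fun c A => 0).
Proof.
split=> //.
- by move=> c a u v; rewrite scaler0 addr0.
- by move=> u /= ->; exists [::], (fun=> 0); rewrite big_nil.
by move=> s A _ _ c _; apply/matrixP => i [].
Qed.

End Multiplicities.

(** * Ranks and higher Dirac cohomology *)

Section DiracRanks.
Variables (K : numClosedFieldType).

(** By Fitting, A^n kills f and is invertible on the complementary component, so higher powers lose
    no further rank. *)
Lemma expmx_stable n (A : 'M[K]_n) k : (n <= k)%N -> exists C, A ^+ k = A ^+ k.+1 *m C.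
Proof.
case: n A => [|n] A nk; first by exists 0; apply: mx_dim0.
have [f [B [ff fA AB [Af BA _ _]]]] := fitting A.
have BAk j : B *m A ^+ j = A ^+ j *m B by apply: mx_exp_comm.
have An : A ^+ n.+1 = A ^+ (n.+1 + n.+1) *m B.
  rewrite -[LHS]mul1mx -[1%:M](subrK f) mulmxDl fA addr0 -AB -mulmxA BAk mulmxA.
  by rewrite exprD.
exists (A ^+ n *m B); rewrite mulmxA; rewrite -[k in LHS](subnK nk) exprD -[RHS]/(_ *m _).
rewrite [in LHS]An -[LHS]/(_ *m _) mulmxA; congr (_ *m B).
rewrite -[LHS]/(_ * _) -[RHS]/(_ * _) -!exprD; congr (_ ^+ _); lia.
Qed.

Variables (a b : nat).

(** X carries the given parity to the other and Y carries it back: ending in the given parity,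
    D^(2k) is (X Y)^k and D^(2k+1) is (Y X)^k Y. So these are the numerator and, with [boundaries],
    the denominator of H^k. *)
Definition cycles (X : 'M[K]_(a, b)) (Y : 'M[K]_(b, a)) k : 'M[K]_a :=
  ((X *m Y) ^+ k :&: kermx X)%MS.

Definition boundaries (X : 'M[K]_(a, b)) (Y : 'M[K]_(b, a)) k : 'M[K]_a :=
  ((Y *m X) ^+ k *m Y :&: kermx X)%MS.

End DiracRanks.

Section DiracRankIdentity.
Variables (K : numClosedFieldType).

Lemma exp_slide a b (X : 'M[K]_(a, b)) (Y : 'M[K]_(b, a)) k :
  (Y *m X) ^+ k *m Y = Y *m (X *m Y) ^+ k.
Proof. by apply/esym/mx_exp_comm; rewrite mulmxA. Qed.

Lemma boundaries_cycles a b (X : 'M[K]_(a, b)) (Y : 'M[K]_(b, a)) k :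
  (boundaries X Y k <= cycles X Y k)%MS.
Proof.
rewrite sub_capmx capmxSr andbT; apply: submx_trans (capmxSl _ _) _.
by rewrite exp_slide submxMl.
Qed.

Definition dirac_mult a b (X : 'M[K]_(a, b)) (Y : 'M[K]_(b, a)) k :=
  \rank (cycles X Y k :\: boundaries X Y k)%MS.

(** Rank-nullity for X on the images of (X Y)^k and of (Y X)^k Y. *)
Lemma dirac_multE a b (X : 'M[K]_(a, b)) (Y : 'M[K]_(b, a)) k :
  (dirac_mult X Y k + \rank ((X *m Y) ^+ k *m X) + \rank ((Y *m X) ^+ k *m Y) =
   \rank ((X *m Y) ^+ k) + \rank ((Y *m X) ^+ k.+1))%N.
Proof.
have e1 := mxrank_cap_compl (cycles X Y k) (boundaries X Y k).
have e2 := mxrank_mul_ker ((X *m Y) ^+ k) X.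
have e3 := mxrank_mul_ker ((Y *m X) ^+ k *m Y) X.
have e4 : \rank (cycles X Y k :&: boundaries X Y k)%MS = \rank (boundaries X Y k).
  by apply/eqP; rewrite eqn_leq mxrankS ?capmxSr//= mxrankS// sub_capmx submx_refl boundaries_cycles.
have e5 : (Y *m X) ^+ k *m Y *m X = (Y *m X) ^+ k.+1 by rewrite exprSr -mulmxA.
rewrite e4 in e1; rewrite e5 in e3; rewrite /dirac_mult.
move: e1 e2 e3; rewrite -/(cycles X Y k) -/(boundaries X Y k).
move: (\rank _) (\rank _) (\rank _) (\rank _) (\rank _) (\rank _) (\rank _) => x1 x2 x3 x4 x5 x6 x7; lia.
Qed.

Lemma dirac_index a b (X : 'M[K]_(a, b)) (Y : 'M[K]_(b, a)) n : (a <= n)%N -> (b <= n)%N ->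
  (\sum_(k < n) dirac_mult X Y k + b = \sum_(k < n) dirac_mult Y X k + a)%N.
Proof.
move=> an bn.
have tel m : (\sum_(k < m) dirac_mult X Y k + b + \rank ((X *m Y) ^+ m) =
    \sum_(k < m) dirac_mult Y X k + a + \rank ((Y *m X) ^+ m))%N.
  elim: m => [|m IH]; first by rewrite !big_ord0 !expr0 !mxrank1 addnC.
  rewrite !big_ord_recr /=; have := dirac_multE X Y m; have := dirac_multE Y X m.
  move: IH; move: (\sum_(_ < m) _)%N (\sum_(_ < m) _)%N (dirac_mult _ _ _) (dirac_mult _ _ _) => s1 s2 d1 d2.
  move: (\rank ((X *m Y) ^+ m)) (\rank ((Y *m X) ^+ m)) (\rank ((X *m Y) ^+ m.+1)) (\rank ((Y *m X) ^+ m.+1)) => x1 x2 x3 x4.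
  move: (\rank _) (\rank _) => x5 x6; lia.
(* (Z W)^(n+1) = Z (W Z)^n W, so the stable rank of Z W is at most that of W Z. *)
have half c d (Z : 'M[K]_(c, d)) (W : 'M[K]_(d, c)) : (c <= n)%N ->
    (\rank ((Z *m W) ^+ n) <= \rank ((W *m Z) ^+ n))%N.
  move=> cn; have [C ->] := expmx_stable (Z *m W) cn.
  apply: leq_trans (mxrankM_maxl _ _) _.
  rewrite exprSr -[_ * _]/(_ *m _) mulmxA exp_slide -mulmxA.
  by apply: leq_trans (mxrankM_maxr _ _) _; apply: mxrankM_maxl.
have := tel n; have := half _ _ X Y an; have := half _ _ Y X bn; lia.
Qed.

(** Once the images of the powers of X Y are stable, X Y is injective on them and they meet the
    kernel of X in 0. Hence a given type occurs in finitely many H^k. *)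
Lemma cycles_vanish a b (X : 'M[K]_(a, b)) (Y : 'M[K]_(b, a)) k : (a <= k)%N -> cycles X Y k = 0.
Proof.
move=> ak; apply/eqP/rowV0P => v; rewrite sub_capmx => /andP[/submxP[u ->] /sub_kermxP].
have [C CE] := expmx_stable (X *m Y) ak; move=> uX.
have : u *m (X *m Y) ^+ k.+1 = 0 by rewrite exprSr -[_ * _]/(_ *m _) !mulmxA uX mul0mx.
by rewrite CE mulmxA => ->; rewrite mul0mx.
Qed.

End DiracRankIdentity.

(** * Homomorphisms between decomposed modules *)

Section Maps.
Variables (K : numClosedFieldType) (g : lieAlgType K) (r : lieSubalg g).
Notation premod := (premodule (subvs_of r : lieAlgType K)).
Variables (N : premod) (n : irrep r -> nat) (Psi : forall c, 'M[K]_(idim c, n c) -> N).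
Hypotheses (modN : is_module N) (NP : mdec Psi) (cn : on_classes n).

(** For each type d and column k, the coordinates of [psi] give an intertwiner [F d k] from c to d.
    By Schur's lemma it vanishes unless d = c, where it is a scalar; these scalars form [y]. *)
Lemma mdec_hom (c : irrep r) (psi : 'rV[K]_(idim c) -> N) : irr_class c = c -> linear psi ->
  (forall v, carrier N (psi v)) ->
  (forall x v, psi (v *m imx c (vsval x)) = action N x (psi v)) ->
  exists y : 'rV_(n c), forall v, psi v = Psi (v^T *m y).
Proof.
move=> cc pl pN pa.
have [sA sAP] : exists sA : 'I_(idim c) -> seq (irrep r) * (forall c, 'M[K]_(idim c, n c)),
    forall i, coords Psi (psi (delta_mx 0 i)) (sA i).1 (sA i).2.
  have ce i := cid (coords_exist NP (pN (delta_mx 0 i))).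
  exists (fun i => (sval (ce i), sval (cid (svalP (ce i))))) => i.
  exact: svalP (cid (svalP (ce i))).
pose s := undup (flatten [seq (sA i).1 | i <- enum 'I_(idim c)]).
have us : uniq s := undup_uniq _.
have sub i : {subset (sA i).1 <= s}.
  move=> d ds; rewrite mem_undup; apply/flattenP; exists (sA i).1 => //.
  by apply: map_f; rewrite mem_enum.
have [_ Pc Pa _ _] := NP; have Pl d : linear (Psi (c := d)) by case: NP.
pose G d (v : 'rV[K]_(idim c)) := \sum_i v 0 i *: (sA i).2 d.
have cG v : coords Psi (psi v) s (G^~ v).
  split=> // [d ds|].
    rewrite /G big1// => i _; have [_ off _] := sAP i.
    by rewrite off ?scaler0//; apply: contra ds; apply: sub.
  rewrite {1}(row_sum_delta v) (linear_map_sum pl).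
  transitivity (\sum_i v 0 i *: \sum_(d <- s) Psi ((sA i).2 d)).
    apply: eq_bigr => i _; rewrite (linear_mapZ pl); congr (_ *: _).
    exact: (coords_widen NP (sAP i) us (sub i)).
  rewrite (eq_bigr _ (fun i _ => scaler_sumr _ _ _ _)) exchange_big; apply: eq_bigr => d _.
  by rewrite /G (linear_map_sum (Pl d)); apply: eq_bigr => i _; rewrite (linear_mapZ (Pl d)).
have Ga d (x : subvs_of r) v : G d (v *m imx c (vsval x)) = (imx d (vsval x))^T *m G d v.
  have := cG (v *m imx c (vsval x)); rewrite pa => c1.
  exact: (coords_unique NP c1 (coords_action modN NP x (cG v)) d).
pose F d (k : 'I_(n d)) : 'M[K]_(idim c, idim d) := \matrix_(i, l) (sA i).2 d l k.
have FE d (k : 'I_(n d)) v : v *m F d k = (col k (G d v))^T.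
  apply/rowP => l; rewrite !mxE summxE; apply: eq_bigr => i _.
  by rewrite !mxE.
have Fi d (k : 'I_(n d)) : intertwines (F d k).
  move=> x xr; apply/row_matrixP => i; rewrite !rowE !mulmxA !FE -(vsprojK xr) Ga.
  by rewrite colE -mulmxA -colE trmx_mul trmxK.
have G0 d v : d != c -> G d v = 0.
  move=> dc; apply/matrixP => l k; rewrite mxE.
  have -> : G d v l k = (v *m F d k) 0 l by rewrite FE !mxE.
  have [->|Fn0] := eqVneq (F d k) 0; first by rewrite mulmx0 mxE.
  case/negP: dc; apply/eqP/esym/(irr_class_inj cc); last exact: schur_iso Fn0.
  by apply: cn; apply: leq_ltn_trans (ltn_ord k).
have [y yE] : exists y : 'I_(n c) -> K, forall k, F c k = (y k)%:M.
  have ce k := cid (schur_scalar (Fi c k)).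
  by exists (fun k => sval (ce k)) => k; apply: svalP (ce k).
exists (\row_k y k) => v.
have -> : v^T *m (\row_k y k) = G c v.
  apply/matrixP => l k; have := FE c k v; rewrite yE mul_mx_scalar => /rowP/(_ l).
  by rewrite !mxE big_ord1 !mxE mulrC.
have [_ off ->] := cG v.
have [csm|cs] := boolP (c \in s); last first.
  rewrite off// (linear_map0 (Pl c)) big1_seq// => d /andP[_ ds].
  by rewrite G0 ?(linear_map0 (Pl d))//; apply: contra cs => /eqP<-.
rewrite (bigD1_seq c)//= big1 ?addr0// => d dc.
by rewrite G0// (linear_map0 (Pl d)).
Qed.

Variables (M : premod) (m : irrep r -> nat) (Phi : forall c, 'M[K]_(idim c, m c) -> M).
Hypotheses (MP : mdec Phi) (cm : on_classes m).

Lemma mdec_map (f : M -> N) : linear f -> (forall u, carrier M u -> carrier N (f u)) ->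
  (forall x u, carrier M u -> f (action M x u) = action N x (f u)) ->
  exists X : forall c, 'M[K]_(m c, n c), forall c A, f (Phi A) = Psi (A *m X c).
Proof.
move=> fl fN fa; have [_ Pc Pa _ _] := MP; have Pl d : linear (Phi (c := d)) by case: MP.
have Ql d : linear (Psi (c := d)) by case: NP.
have ex c (j : 'I_(m c)) : exists y : 'rV_(n c), forall v : 'rV_(idim c),
    f (Phi (v^T *m delta_mx 0 j)) = Psi (v^T *m y).
  apply: (mdec_hom (psi := fun v => f (Phi (v^T *m delta_mx 0 j)))) => [|a u v|v|x v].
  - by apply: cm; apply: leq_ltn_trans (ltn_ord j).
  - by rewrite linearP mulmxDl -scalemxAl Pl fl.
  - exact/fN/Pc.
  by rewrite -fa// Pa mulmxA -trmx_mul.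
exists (fun c => \matrix_j sval (cid (ex c j))) => c A.
have AE p (X : 'M[K]_(m c, p)) : A *m X = \sum_j col j A *m row j X.
  apply/matrixP => i k; rewrite !mxE summxE; apply: eq_bigr => j _.
  by rewrite !mxE big_ord1 !mxE.
rewrite -{1}[A]mulmx1 !AE (linear_map_sum (Pl c)) (linear_map_sum fl) (linear_map_sum (Ql c)).
apply: eq_bigr => j _; rewrite rowK row1; have := svalP (cid (ex c j)) (col j A)^T.
by rewrite trmxK.
Qed.

End Maps.

(** * Higher Dirac cohomology in coordinates *)

Section DiracCohomology.
Import Quotient.
Local Open Scope quotient_scope.
Variables (K : numClosedFieldType) (g : lieAlgType K) (r : lieSubalg g).
Notation premod := (premodule (subvs_of r : lieAlgType K)).
Variables (T : lmodType K) (act : subvs_of r -> T -> T) (D : {linear T -> T}).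
Hypotheses (actl : forall x, linear (act x)) (actr : forall t, linear (act ^~ t)).
Hypothesis actL : forall x y t, act 'L[x, y] t = act x (act y t) - act y (act x t).
Hypothesis actD : forall x t, D (act x t) = act x (D t).
Implicit Types (t u : T) (k n : nat) (x : subvs_of r).

Lemma iter_linear n : linear (iter n D).
Proof. by move=> a u v; elim: n => //= n ->; rewrite linearP. Qed.

Lemma imkerP n t : reflect ((exists u, iter n D u = t) /\ D t = 0) (t \in imker D n).
Proof.
by apply: (iffP andP) => [[/asboolP ? /eqP ?]|[? /eqP ?]]; split=> //; apply/asboolP.
Qed.

Lemma imker_act n x t : t \in imker D n -> act x t \in imker D n.
Proof.
move=> /imkerP[[u <-] tk]; apply/imkerP; rewrite actD tk (linear_map0 (actl x)); split=> //.
by exists (act x u); elim: n {tk} => //= n ->; rewrite actD.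
Qed.

Lemma quot_act n x t :
  \pi_{quot (imker D n)} (act x (repr (\pi_{quot (imker D n)} t))) = \pi_{quot (imker D n)} (act x t).
Proof.
apply/eqP; rewrite -idealrBE -(linear_mapB (actl x)); apply: imker_act.
by rewrite idealrBE reprK eqxx.
Qed.

Lemma quot_linear n a t u : \pi_{quot (imker D n)} (a *: t + u) =
  a *: \pi_{quot (imker D n)} t + \pi_{quot (imker D n)} u.
Proof. by rewrite -quot_add_pi -(@quot_scale_pi _ _ D n). Qed.

Lemma quot0 n : \pi_{quot (imker D n)} 0 = 0.
Proof. by have := quot_linear n (-1) 0 0; rewrite scaler0 addr0 scaleN1r addNr. Qed.

Lemma quot_eq0 n t : \pi_{quot (imker D n)} t = 0 <-> t \in imker D n.
Proof.
rewrite -(quot0 n) -[t in t \in _]subr0 idealrBE; split=> [->|/eqP//].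
exact: eqxx.
Qed.

Variables (Tp Tq : set T).
Hypotheses (modp : is_module (Premodule T act Tp : premod)) (modq : is_module (Premodule T act Tq : premod)).
Hypotheses (Dp : forall t, Tp t -> Tq (D t)) (Dq : forall t, Tq t -> Tp (D t)).
Hypotheses (Tsum : forall t, exists u v, [/\ Tp u, Tq v & t = u + v]).
Hypotheses (Tcap : forall t, Tp t -> Tq t -> t = 0).
Variables (m n : irrep r -> nat).
Variables (Phi : forall c, 'M[K]_(idim c, m c) -> T) (Psi : forall c, 'M[K]_(idim c, n c) -> T).
Hypothesis MP : mdec (M := Premodule T act Tp) Phi.
Hypothesis NP : mdec (M := Premodule T act Tq) Psi.
Variables (X : forall c, 'M[K]_(m c, n c)) (Y : forall c, 'M[K]_(n c, m c)).
Hypotheses (DX : forall c A, D (Phi A) = Psi (A *m X c)) (DY : forall c A, D (Psi A) = Phi (A *m Y c)).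

Let Phil c : linear (Phi (c := c)). Proof. by case: MP. Qed.
Let Psil c : linear (Psi (c := c)). Proof. by case: NP. Qed.
Let Tp0 : Tp 0. Proof. by case: modp => -[[]]. Qed.
Let Tq0 : Tq 0. Proof. by case: modq => -[[]]. Qed.
Let TpP a u v : Tp u -> Tp v -> Tp (a *: u + v). Proof. by case: modp => -[[_ H] _ _] _ _ _; apply: H. Qed.
Let TqP a u v : Tq u -> Tq v -> Tq (a *: u + v). Proof. by case: modq => -[[_ H] _ _] _ _ _; apply: H. Qed.
Let Phic c A : Tp (Phi (c := c) A). Proof. by case: MP => _ H _ _ _; apply: H. Qed.
Let Psic c A : Tq (Psi (c := c) A). Proof. by case: NP => _ H _ _ _; apply: H. Qed.

Lemma iter_even k c (A : 'M_(idim c, m c)) : iter k.*2 D (Phi A) = Phi (A *m (X c *m Y c) ^+ k).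
Proof.
elim: k => [|k IH]; first by rewrite expr0 mulmx1.
by rewrite doubleS /= IH DX DY exprSr -[_ * _]/(_ *m _) !mulmxA.
Qed.

Lemma iter_odd k c (A : 'M_(idim c, n c)) :
  iter k.*2.+1 D (Psi A) = Phi (A *m ((Y c *m X c) ^+ k *m Y c)).
Proof.
have -> : iter k.*2.+1 D (Psi A) = D (Psi (A *m (Y c *m X c) ^+ k)).
  rewrite iterS; congr (D _); elim: k => [|k IH]; first by rewrite expr0 mulmx1.
  by rewrite doubleS /= IH DY DX exprSr -[_ * _]/(_ *m _) !mulmxA.
by rewrite DY mulmxA.
Qed.

Lemma iter_parity k t : (Tp t -> if odd k then Tq (iter k D t) else Tp (iter k D t)) /\
  (Tq t -> if odd k then Tp (iter k D t) else Tq (iter k D t)).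
Proof.
elim: k => [//|k [IHp IHq]] /=; split=> [/IHp|/IHq]; case: (odd k) => /=; auto.
Qed.

(** [imker] allows preimages anywhere in T. The component of the wrong parity of such a preimage is
    sent into both halves, hence to 0, so a homogeneous preimage exists. *)
Lemma iter_preimage k u : Tp u -> (exists w, iter k D w = u) ->
  exists w, (if odd k then Tq w else Tp w) /\ iter k D w = u.
Proof.
move=> uT [w wE]; have [w1 [w2 [w1p w2q e]]] := Tsum w.
have e' : iter k D w1 + iter k D w2 = u by rewrite -(linear_mapD (iter_linear k)) -e.
have [/(_ w1p) ip _] := iter_parity k w1; have [_ /(_ w2q) iq] := iter_parity k w2.
have Tp_sub a b : Tp a -> Tp b -> Tp (a - b).
  by move=> Ta Tb; rewrite addrC -scaleN1r; apply: TpP.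
case: (odd k) ip iq => ip iq.
  exists w2; split=> //; rewrite -[RHS]e' (Tcap _ ip) ?add0r//.
  by rewrite -[iter k D w1](addrK (iter k D w2)) e'; apply: Tp_sub.
exists w1; split=> //; rewrite -[RHS]e' (Tcap _ iq) ?addr0//.
by rewrite -[iter k D w2](addKr (iter k D w1)) e' addrC; apply: Tp_sub.
Qed.

Lemma coords_kernel u s A : coords (M := Premodule T act Tp) Phi u s A ->
  D u = 0 <-> forall c, (A c <= kermx (X c))%MS.
Proof.
move=> [us off ->]; rewrite linear_sum; split=> [D0 c|AX]; last first.
  by rewrite big1// => c _; rewrite DX (sub_kermxP (AX c)) (linear_map0 (@Psil c)).
apply/sub_kermxP; have [cs|/off->] := boolP (c \in s); last exact: mul0mx.
have [_ _ _ _ ind] := NP; apply: (ind s (fun c => A c *m X c) us _ c cs).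
by rewrite -[RHS]D0; apply: eq_bigr => d _; rewrite DX.
Qed.

Lemma cyclesP k u s A : coords (M := Premodule T act Tp) Phi u s A -> Tp u ->
  u \in imker D k.*2 <-> forall c, (A c <= cycles (X c) (Y c) k)%MS.
Proof.
move=> cA uT; split=> [/imkerP[/(iter_preimage uT)[w]]|Az].
  rewrite odd_double => -[wT wE] /(coords_kernel cA) Ak c; rewrite sub_capmx Ak andbT.
  have [t [B cB]] := coords_exist MP wT.
  have cu : coords (M := Premodule T act Tp) Phi u t (fun c => B c *m (X c *m Y c) ^+ k).
    have [ut off e] := cB; split=> // [d /off->|]; first exact: mul0mx.
    rewrite -wE {1}e (linear_map_sum (iter_linear k.*2)); apply: eq_bigr => d _.
    exact: iter_even.
  by rewrite (coords_unique MP cA cu) submxMl.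
apply/imkerP; split; last by apply/(coords_kernel cA) => c; apply: submx_trans (Az c) (capmxSr _ _).
have [us off ->] := cA.
exists (\sum_(c <- s) Phi (A c *m pinvmx ((X c *m Y c) ^+ k))).
rewrite (linear_map_sum (iter_linear k.*2)); apply: eq_bigr => c _.
by rewrite iter_even mulmxKpV//; apply: submx_trans (Az c) (capmxSl _ _).
Qed.

Lemma boundariesP k u s A : coords (M := Premodule T act Tp) Phi u s A -> Tp u ->
  u \in imker D k.*2.+1 <-> forall c, (A c <= boundaries (X c) (Y c) k)%MS.
Proof.
move=> cA uT; split=> [/imkerP[/(iter_preimage uT)[w]]|Az].
  rewrite [odd _]/= odd_double => -[wT wE] /(coords_kernel cA) Ak c; rewrite sub_capmx Ak andbT.
  have [t [B cB]] := coords_exist NP wT.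
  have cu : coords (M := Premodule T act Tp) Phi u t (fun c => B c *m ((Y c *m X c) ^+ k *m Y c)).
    have [ut off e] := cB; split=> // [d /off->|]; first exact: mul0mx.
    rewrite -wE {1}e (linear_map_sum (iter_linear k.*2.+1)); apply: eq_bigr => d _.
    exact: iter_odd.
  by rewrite (coords_unique MP cA cu) submxMl.
apply/imkerP; split; last by apply/(coords_kernel cA) => c; apply: submx_trans (Az c) (capmxSr _ _).
have [us off ->] := cA.
exists (\sum_(c <- s) Psi (A c *m pinvmx ((Y c *m X c) ^+ k *m Y c))).
rewrite (linear_map_sum (iter_linear k.*2.+1)); apply: eq_bigr => c _.
by rewrite iter_odd mulmxKpV//; apply: submx_trans (Az c) (capmxSl _ _).
Qed.

Notation HV := (higher_cohomology act D Tp : premod).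

Lemma cohomology_module : is_module HV.
Proof.
have eqP_ k (q : {quot (imker D k.*2.+1)}) : q = \pi_{quot (imker D k.*2.+1)} (repr q) by rewrite reprK.
split; first split=> //.
- split.
    split; first by exists 0%N.
    by move=> k; exists 0; split=> //; rewrite ?quot0//; apply/imkerP; split; [exists 0; apply: (linear_map0 (iter_linear _)) | rewrite linear0].
  move=> a u v [[N1 uN] uk] [[N2 vN] vk]; split.
    exists (maxn N1 N2) => k; rewrite geq_max => /andP[k1 k2].
    rewrite [LHS]/(a *: u k + v k) uN// vN//.
    by have := quot_linear k.*2.+1 a 0 0; rewrite scaler0 addr0 !quot0 => e; apply/esym/e.
  move=> k; have [t [tk tp tE]] := uk k; have [t' [tk' tp' tE']] := vk k.
  exists (a *: t + t'); split; last by rewrite [LHS]/(a *: u k + v k) tE tE' quot_linear.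
    by have [_ H] := imker_submod_closed D k.*2; apply: H.
  exact: TpP.
- move=> x u [[N uN] uk]; split.
    by exists N => k /uN e; rewrite /= e -(quot0 k.*2.+1) quot_act (linear_map0 (actl x)) quot0.
  move=> k; have [t [tk tp tE]] := uk k; exists (act x t); split; first exact: imker_act.
    by case: modp => -[_ _ H] _ _ _; apply: (H x).
  by rewrite /= tE quot_act.
- move=> x a u v _ _; apply: functional_extensionality_dep => k.
  apply: etrans (quot_linear k.*2.+1 a (act x (repr (u k))) (act x (repr (v k)))).
  rewrite -actl -[RHS]quot_act quot_linear !reprK.
  by [].
- move=> u _ a x y; apply: functional_extensionality_dep => k.
  apply: etrans (quot_linear k.*2.+1 a (act x (repr (u k))) (act y (repr (u k)))).
  by rewrite /= actr.
move=> x y u _; apply: functional_extensionality_dep => k; set w := repr (u k).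
have e := quot_linear k.*2.+1 (-1) (act y (act x w)) (act x (act y w)).
rewrite /= actL addrC -scaleN1r; apply: etrans e _; rewrite scaleN1r addrC.
by rewrite -(quot_act _ x (act y w)) -(quot_act _ y (act x w)).
Qed.

(** The maximum of both multiplicities, so that the sums for the two parities have the same range
    and [dirac_index] compares them. *)
Notation coh_bound := (fun c => maxn (m c) (n c)).
Notation coh_mult := (fun c => \sum_(k < coh_bound c) dirac_mult (X c) (Y c) k)%N.
Notation coh_base c k := (row_base (cycles (X c) (Y c) k :\: boundaries (X c) (Y c) k)%MS).

(** The k-th block of A read in a basis of a complement of the boundaries in the cycles. Past the
    bound the value is 0, in accordance with [cycles_vanish]. *)
Definition coh_coord c (A : 'M[K]_(idim c, coh_mult c)) (k : nat) : 'M[K]_(idim c, m c) :=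
  if insub k is Some i then submxrow (A : 'M[K]_(_, \sum_(i < coh_bound c) dirac_mult (X c) (Y c) i)) i *m coh_base c i else 0.

Definition coh_Phi c (A : 'M[K]_(idim c, coh_mult c)) : HV :=
  fun k => \pi_{quot (imker D k.*2.+1)} (Phi (coh_coord A k)).

Lemma coh_coord_linear c k : linear (fun A => coh_coord (c := c) A k).
Proof.
move=> a A B; rewrite /coh_coord; case: insubP => [i _ _|_]; last by rewrite scaler0 addr0.
by rewrite scalemxAl -mulmxDl; congr (_ *m _); apply/matrixP => p q; rewrite !mxE.
Qed.

Lemma coh_coord_cycles c A k : (coh_coord (c := c) A k <= cycles (X c) (Y c) k :\: boundaries (X c) (Y c) k)%MS.
Proof.
rewrite /coh_coord; case: insubP => [i _ <-|_]; last exact: sub0mx.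
by apply: submx_trans (submxMl _ _) _; rewrite eq_row_base.
Qed.

Lemma coh_coord_exists c (F : nat -> 'M[K]_(idim c, m c)) :
  (forall k, (F k <= cycles (X c) (Y c) k)%MS) ->
  exists A, forall k, (F k - coh_coord A k <= boundaries (X c) (Y c) k)%MS.
Proof.
move=> Fz.
have ex k : exists G, (F k - G *m coh_base c k <= boundaries (X c) (Y c) k)%MS.
  set Z := cycles (X c) (Y c) k; set Bd := boundaries (X c) (Y c) k.
  have /sub_addsmxP[[u v] /= e] : (F k <= Z :\: Bd + Z :&: Bd)%MS by rewrite addsmx_diff_cap_eq.
  have : (u *m (Z :\: Bd)%MS <= coh_base c k)%MS.
    by apply: submx_trans (submxMl _ _) _; rewrite eq_row_base.
  move=> /submxP[G GE]; exists G; rewrite e GE addrC addKr.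
  by apply: submx_trans (submxMl _ _) (capmxSr _ _).
pose G k := sval (cid (ex k)).
exists (\mxrow_(i < coh_bound c) G i) => k; rewrite /coh_coord; case: insubP => [i _ ik|].
  by rewrite mxrowK -ik; apply: svalP (cid (ex i)).
rewrite -leqNgt => ck; have := Fz k; rewrite cycles_vanish ?(leq_trans (leq_maxl _ _) ck)//.
by rewrite submx0 subr0 => /eqP->; rewrite sub0mx.
Qed.

Lemma coh_coord_inj c A : (forall k, coh_coord (c := c) A k = 0) -> A = 0.
Proof.
move=> A0; pose A' := A : 'M[K]_(_, \sum_(i < coh_bound c) dirac_mult (X c) (Y c) i).
suff e : A' = 0 by [].
rewrite -[LHS]submxrowK -[RHS]submxrowK; congr mxrow; apply: functional_extensionality_dep => i.
have := A0 i; rewrite /coh_coord (valK i) => z.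
have /row_freeP[V VE] : row_free (coh_base c i) by rewrite /row_free eq_row_base.
have : submxrow A' i *m coh_base c i *m V = 0 by rewrite [X in X *m V]z mul0mx.
by rewrite -mulmxA VE mulmx1 submxrow0.
Qed.

Let coords1 c (A : 'M_(idim c, m c)) : coords (M := Premodule T act Tp) Phi (Phi A) [:: c]
    (dfwith (fun d => 0 : 'M_(idim d, m d)) A).
Proof. exact: coords_one. Qed.

Lemma cohomology_mdec : mdec (M := HV) coh_Phi.
Proof.
have [_ _ Pa _ _] := MP; split.
- move=> c a A B; apply: functional_extensionality_dep => k.
  by rewrite /coh_Phi coh_coord_linear Phil; apply: quot_linear.
- move=> c A; split.
    exists (coh_bound c) => k ck; rewrite /coh_Phi /coh_coord insubN -?leqNgt//.
    by rewrite (linear_map0 (@Phil c)) quot0.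
  move=> k; exists (Phi (coh_coord A k)); split=> //.
  apply/(cyclesP k (coords1 _) (Phic _)) => d.
  have [<-|cd] := eqVneq c d; last by rewrite dfwith_out// sub0mx.
  by rewrite dfwith_in; apply: submx_trans (coh_coord_cycles A k) (diffmxSl _ _).
- move=> c x A; apply: functional_extensionality_dep => k.
  rewrite /= /coh_Phi quot_act [act x _]Pa; congr (\pi_{quot (imker D k.*2.+1)} (Phi _)).
  rewrite /coh_coord; case: insubP => [i _ _|_]; last by rewrite mulmx0.
  by rewrite mulmxA mul_submxrow.
- move=> u [[N uN] uk].
  (* Representatives are taken to be 0 from degree N on, so that a single finite list of types
     serves all k. *)
  have ex k : exists t, [/\ t \in imker D k.*2, Tp t, u k = \pi_{quot (imker D k.*2.+1)} t & (N <= k)%N -> t = 0].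
    have [Nk|kN] := leqP N k; last first.
      by have [t [tk tp tE]] := uk k; exists t; split.
    exists 0; rewrite uN// quot0; split=> //; apply/imkerP; rewrite linear0; split=> //.
    by exists 0; apply: (linear_map0 (iter_linear _)).
  have [t tP] : exists t : nat -> T, forall k, [/\ t k \in imker D k.*2, Tp (t k),
      u k = \pi_{quot (imker D k.*2.+1)} (t k) & (N <= k)%N -> t k = 0].
    by exists (fun k => sval (cid (ex k))) => k; apply: svalP (cid (ex k)).
  have exc k : exists s A, coords (M := Premodule T act Tp) Phi (t k) s A.
    by have [_ tp _ _] := tP k; apply: (coords_exist MP tp).
  pose sk k := sval (cid (exc k)); pose Bk k := sval (cid (svalP (cid (exc k)))).
  have cB k : coords (M := Premodule T act Tp) Phi (t k) (sk k) (Bk k) := svalP (cid (svalP (cid (exc k)))).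
  have Bz c k : (Bk k c <= cycles (X c) (Y c) k)%MS.
    by have [tk tp _ _] := tP k; move: c; apply/(cyclesP k (cB k) tp).
  pose A c := sval (cid (coh_coord_exists (Bz c))).
  have AP c k : (Bk k c - coh_coord (A c) k <= boundaries (X c) (Y c) k)%MS.
    exact: (svalP (cid (coh_coord_exists (Bz c)))).
  pose s := undup (flatten [seq sk k | k <- iota 0 N]).
  exists s, A; split; first exact: undup_uniq.
  apply: functional_extensionality_dep => k.
  have evalS w : (\sum_(c <- w) coh_Phi (A c) : HV) k = \pi_{quot (imker D k.*2.+1)} (\sum_(c <- w) Phi (coh_coord (A c) k)).
    elim: w => [|c w IH]; first by rewrite !big_nil quot0.
    rewrite !big_cons; apply: etrans (congr2 +%R (erefl _) IH) _.
    by rewrite -[Phi _ in RHS]scale1r quot_linear scale1r.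
  rewrite evalS; have [tk tp tu tN] := tP k; apply: (etrans tu).
  have tE : t k = \sum_(c <- s) Phi (Bk k c).
    apply: (coords_widen MP (s := if (k < N)%N then sk k else [::])) (undup_uniq _) _.
      case: ltnP => // Nk; split=> // [c _|]; last by rewrite big_nil tN.
      apply: (coords_unique MP (cB k) (t := [::]) (B := fun=> 0)).
      by split=> //; rewrite big_nil tN.
    move=> c; case: ltnP => // kN ck; rewrite mem_undup; apply/flattenP; exists (sk k) => //.
    by apply: map_f; rewrite mem_iota.
  apply/eqP; rewrite -idealrBE {1}tE -sumrB.
  have HPB c : Phi (Bk k c) - Phi (coh_coord (A c) k) \in imker D k.*2.+1.
    rewrite -(linear_mapB (@Phil c)); apply/(boundariesP k (coords1 _) (Phic _)) => d.
    have [<-|cd] := eqVneq c d; last by rewrite dfwith_out// sub0mx.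
    by rewrite dfwith_in.
  have [I0 IP] := imker_submod_closed D k.*2.+1.
  elim: (s) => [|c w IH]; first by rewrite big_nil.
  by rewrite big_cons -[X in X + _]scale1r; apply: IP.
move=> s A us e c cs; apply: coh_coord_inj => k.
have evalS w : (\sum_(c <- w) coh_Phi (A c) : HV) k = \pi_{quot (imker D k.*2.+1)} (\sum_(c <- w) Phi (coh_coord (A c) k)).
  elim: w => [|d w IH]; first by rewrite !big_nil quot0.
  rewrite !big_cons; apply: etrans (congr2 +%R (erefl _) IH) _.
  by rewrite -[Phi _ in RHS]scale1r quot_linear scale1r.
have : (\sum_(c <- s) coh_Phi (A c) : HV) k = 0 by rewrite e.
rewrite evalS => /quot_eq0 bd.
pose E d := if d \in s then coh_coord (A d) k else 0.
have cE : coords (M := Premodule T act Tp) Phi (\sum_(c <- s) Phi (coh_coord (A c) k)) s E.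
  split=> // [d /negPf ds|]; first by rewrite /E ds.
  by apply: eq_big_seq => d ds; rewrite /E ds.
have car w : Tp (\sum_(c <- w) Phi (coh_coord (A c) k)).
  elim: w => [|d w IH]; first by rewrite big_nil.
  by rewrite big_cons -[Phi _]scale1r; apply: TpP.
have := (boundariesP k cE (car s)).1 bd c; rewrite /E cs => Eb.
apply/eqP; rewrite -submx0 -(capmx_diff (cycles (X c) (Y c) k) (boundaries (X c) (Y c) k)).
by rewrite sub_capmx Eb coh_coord_cycles.
Qed.

End DiracCohomology.

(** * Decomposition of tensor products *)

Section EigenLists.
Variable K : numClosedFieldType.

Definition eigen_list n (A : 'M[K]_n) := exists l : seq (K * 'M[K]_n),
  \sum_(p <- l) p.2 = 1%:M /\ forall p, p \in l -> p.2 *m A = p.1 *: p.2.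

Lemma eigen_list_diagonalizable n (A : 'M[K]_n.+1) : eigen_list A -> diagonalizable A.
Proof.
move=> [l [l1 lA]]; apply/diagonalizableP; exists (undup [seq p.1 | p <- l]); first exact: undup_uniq.
apply: mxminpoly_min; set q := \prod_(x <- _) _.
have pq (p : K * 'M[K]_n.+1) (u : {poly K}) : p \in l -> p.2 *m horner_mx A u = u.[p.1] *: p.2.
  move=> pl; elim/poly_ind: u => [|u c IH]; first by rewrite rmorph0 mulmx0 horner0 scale0r.
  rewrite rmorphD rmorphM /= horner_mx_X horner_mx_C mulmxDr -mulmxE mulmxA IH -scalemxAl lA//.
  by rewrite mul_mx_scalar hornerMXaddC scalerA scalerDl.
rewrite -[LHS]mul1mx -l1 mulmx_suml big1_seq// => p /andP[_ pl].
rewrite pq// (_ : q.[p.1] = 0) ?scale0r//; apply/rootP.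
by rewrite /q root_prod_XsubC mem_undup map_f.
Qed.

(** Meant for the dual module. Transposition exchanges left and right eigenvectors, so the list is
    first turned into an honest diagonalization, which can be transposed. *)
Lemma eigen_list_neg_tr n (A : 'M[K]_n) : eigen_list A -> eigen_list (- A^T).
Proof.
case: n A => [|n] A; first by exists [::]; split=> //; rewrite big_nil; apply: mx_dim0.
move=> /eigen_list_diagonalizable [P Pu /diagonalizable_forLR -/(_ Pu)[D AE]].
have {}AE : A = invmx P *m diag_mx D *m P by rewrite AE mxpoly.conjumx ?unitmx_inv// invmxK.
exists [seq (- D 0 i, P^T *m delta_mx i i *m (invmx P)^T) | i <- enum 'I_n.+1].
split=> [|_ /mapP[i _ ->] /=].
  rewrite big_map big_enum /= -mulmx_suml -mulmx_sumr.
  rewrite (_ : \sum_i _ = 1%:M) ?mulmx1 -?trmx_mul ?mulVmx ?trmx1//.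
  apply/matrixP => i j; rewrite summxE !mxE (bigD1 i)//= big1 => [|k ki]; rewrite !mxE.
    by rewrite eqxx andTb addr0 eq_sym.
  by rewrite eq_sym (negPf ki).
have key : (invmx P)^T *m A^T = diag_mx D *m (invmx P)^T.
  have e : A^T = P^T *m (diag_mx D *m (invmx P)^T) by rewrite AE !trmx_mul tr_diag_mx.
  have e1 : (invmx P)^T *m P^T = 1%:M by rewrite -trmx_mul mulmxV// trmx1.
  by rewrite e mulmxA e1 mul1mx.
have dD : delta_mx i i *m diag_mx D = D 0 i *: delta_mx i i.
  by apply/matrixP => j k; rewrite mul_mx_diag !mxE mulrC; case: (k =P i) => [->//|_]; rewrite andbF !mulr0.
rewrite mulmxN -(mulmxA (P^T *m delta_mx i i)) key mulmxA -(mulmxA P^T) dD -scalemxAr -scalemxAl scaleNr.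
by [].
Qed.

End EigenLists.

Section TensorReps.
Variables (K : numClosedFieldType) (g : lieAlgType K) (r : {vspace g}).

Lemma neg_tr_rep n (a : {linear g -> 'M[K]_n}) : lie_rep r a ->
  exists a' : {linear g -> 'M[K]_n}, (forall x, a' x = - (a x)^T) /\ lie_rep r a'.
Proof.
move=> ar; have [a' a'E] : exists a' : {linear g -> 'M[K]_n}, a' =1 (fun x => - (a x)^T).
  by apply: mk_linear => k x y; rewrite [a _]linearP [(_ + _)^T]linearP /= opprD scalerN.
exists a'; split=> // x y xr yr; rewrite !a'E ar// linearB /= !trmx_mul !mulmxN !mulNmx !opprK.
by rewrite opprB.
Qed.

(** The tensor product is realized on matrices, v (x) s being [v^T *m s]; [mxvec] turns them back
    into row vectors. *)
Lemma tensor_rep n d (Y : {linear g -> 'M[K]_n}) (a : {linear g -> 'M[K]_d}) :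
  lie_rep r Y -> lie_rep r a -> exists sg : {linear g -> 'M[K]_(n * d)},
    (forall x A, mxvec A *m sg x = mxvec ((Y x)^T *m A + A *m a x)) /\ lie_rep r sg.
Proof.
move=> Yr ar; have row_ext (M N : 'M[K]_(n * d)) : (forall A, mxvec A *m M = mxvec A *m N) -> M = N.
  by move=> e; apply/row_matrixP => i; rewrite !rowE -[delta_mx _ _]vec_mxK.
have sgE x A : mxvec A *m (lin_mulmx (Y x)^T + lin_mulmxr (a x)) = mxvec ((Y x)^T *m A + A *m a x).
  by rewrite mulmxDr !mul_vec_lin /= linearD.
have [sg sP] : exists sg : {linear g -> 'M[K]_(n * d)}, sg =1 (fun x => lin_mulmx (Y x)^T + lin_mulmxr (a x)).
  apply: mk_linear => k x y; apply: row_ext => A.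
  rewrite [RHS]mulmxDr -scalemxAr !sgE -[_ *: mxvec _]linearZ -linearD /=; congr mxvec.
  rewrite [Y _]linearP [a _]linearP [(_ + _)^T]linearP /=.
  by rewrite mulmxDl mulmxDr -!scalemxAl -!scalemxAr scalerDr addrACA.
have sE x A : mxvec A *m sg x = mxvec ((Y x)^T *m A + A *m a x) by rewrite sP.
exists sg; split=> // x y xr yr; apply: row_ext => A.
rewrite mulmxBr !mulmxA !sE -linearB; congr mxvec; rewrite Yr// ar// linearB /= !trmx_mul.
rewrite !(mulmxDr, mulmxDl, mulmxBl, mulmxBr, mulmxA) !mulmxN !mulNmx !mulmxA.
move: ((Y x)^T *m (Y y)^T *m A) ((Y y)^T *m (Y x)^T *m A) (A *m a y *m a x) (A *m a x *m a y)
  ((Y x)^T *m A *m a y) ((Y y)^T *m A *m a x) => p1 p2 p3 p4 p5 p6.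
by apply/matrixP => i j; rewrite !mxE; ring.
Qed.

Lemma irr_center_scalar (c : irrep r) z : z \in lie_center r -> exists y, imx c z = y%:M.
Proof.
move=> /lie_centerP[zr zc]; apply: schur_scalar => x xr.
by apply/eqP; rewrite -subr_eq0 -(irr_rep c zr xr) lieC zc// oppr0 linear0.
Qed.

Lemma tensor_diag (c : irrep r) d (a : {linear g -> 'M[K]_d}) (sg : {linear g -> 'M[K]_(idim c * d)}) :
  (forall x A, mxvec A *m sg x = mxvec ((imx c x)^T *m A + A *m a x)) ->
  {in lie_center r, forall z, eigen_list (a z)} -> diagonalizable_center r sg.
Proof.
move=> sE az z zZ; have [y yE] := irr_center_scalar c zZ; have [l [l1 lz]] := az z zZ.
have row_ext (M N : 'M[K]_(idim c * d)) : (forall A, mxvec A *m M = mxvec A *m N) -> M = N.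
  by move=> e; apply/row_matrixP => i; rewrite !rowE -[delta_mx _ _]vec_mxK.
exists [seq (y + p.1, lin_mulmxr p.2) | p <- l]; split=> [|_ /mapP[p pl ->] /=].
  rewrite big_map; apply: row_ext => A; rewrite mulmx1 mulmx_sumr.
  rewrite (eq_bigr (fun p => mxvec (A *m p.2))) => [|p _]; last by rewrite mul_vec_lin.
  by rewrite -linear_sum -mulmx_sumr l1 mulmx1.
apply: row_ext => A; rewrite mulmxA -scalemxAr mul_vec_lin /= sE yE tr_scalar_mx mul_scalar_mx.
by rewrite -mulmxA lz// -scalemxAr -scalerDl linearZ.
Qed.

(* A copy of [c] in [Y (x) E] contracts with [E^*] to a map from [c (x) E^*] to [Y]. *)
Lemma contraction (c Y : irrep r) d (a a' : {linear g -> 'M[K]_d})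
    (sg : {linear g -> 'M[K]_(idim Y * d)}) (tau : {linear g -> 'M[K]_(idim c * d)})
    (J : 'M[K]_(idim c, idim Y * d)) :
  (forall x A, mxvec A *m sg x = mxvec ((imx Y x)^T *m A + A *m a x)) ->
  (forall x, a' x = - (a x)^T) ->
  (forall x A, mxvec A *m tau x = mxvec ((imx c x)^T *m A + A *m a' x)) ->
  {in r, forall x, J *m sg x = imx c x *m J} -> J != 0 -> completely_reducible r tau ->
  forall l : seq (summand r tau), \sum_(s <- l) sm_out s *m sm_in s = 1%:M ->
  exists i : 'I_(size l), irr_iso (tnth (in_tuple l) i) Y.
Proof.
move=> sE aE tE JJ J0 _ l l1.
(* Row k of [vec_mx u] is the functional paired with the k-th basis vector of c; it is contracted
   with the second factor of the image of that vector under J. *)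
pose f (u : 'rV[K]_(idim c * d)) : 'rV[K]_(idim Y) :=
  \sum_k (vec_mx (row k J) *m (row k (vec_mx u))^T)^T.
have [F FE] : exists F : {linear 'rV[K]_(idim c * d) -> 'rV[K]_(idim Y)}, F =1 f.
  apply: mk_linear => k u v; rewrite /f scaler_sumr -big_split; apply: eq_bigr => i _ /=.
  rewrite [vec_mx (_ + _)]linearP [row i (_ + _)]linearP [(k *: row _ _ + _)^T]linearP /=.
  by rewrite mulmxDr -scalemxAr linearP.
pose G := lin1_mx F.
have GE u : u *m G = f u by rewrite mul_rV_lin1 /= FE.
have Gi : {in r, forall x, tau x *m G = G *m imx Y x}.
  move=> x xr; apply/row_matrixP => i; rewrite !rowE !mulmxA -[delta_mx _ _]vec_mxK.
  set A := vec_mx _; rewrite tE !GE /f !mxvecK mulmx_suml.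
  have e1 : \sum_k (vec_mx (row k J) *m (row k ((imx c x)^T *m A))^T)^T =
     \sum_k (vec_mx (row k (J *m sg x)) *m (row k A)^T)^T.
    transitivity (\sum_k \sum_l imx c x l k *: (vec_mx (row k J) *m (row l A)^T)^T).
      apply: eq_bigr => k _; rewrite row_mul mulmx_sum_row linear_sum /= mulmx_sumr linear_sum /=.
      apply: eq_bigr => j _; rewrite [(_ *: row _ _)^T]linearZ /= -scalemxAr.
      by rewrite [(_ *: _)^T]linearZ /= !mxE.
    rewrite exchange_big; apply: eq_bigr => k _; rewrite JJ// row_mul mulmx_sum_row linear_sum /=.
    rewrite mulmx_suml linear_sum /=; apply: eq_bigr => j _.
    by rewrite [vec_mx (_ *: _)]linearZ /= -scalemxAl [(_ *: _)^T]linearZ /= !mxE.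
  rewrite (eq_bigr (fun k => (vec_mx (row k J) *m (row k ((imx c x)^T *m A))^T)^T +
     (vec_mx (row k J) *m (row k (A *m a' x))^T)^T)) => [|k _]; last first.
    by rewrite [row k (_ + _)]linearD [(row k _ + _)^T]linearD /= mulmxDr linearD.
  rewrite big_split /= e1 -big_split; apply: eq_bigr => k _ /=.
  have eB : vec_mx (row k (J *m sg x)) = (imx Y x)^T *m vec_mx (row k J) + vec_mx (row k J) *m a x.
    by rewrite row_mul -[row k J in LHS]vec_mxK sE mxvecK.
  have ew : (row k (A *m a' x))^T = - (a x *m (row k A)^T).
    by rewrite row_mul aE mulmxN [(- _)^T]linearN /= trmx_mul trmxK.
  rewrite eB ew mulmxDl mulmxN mulmxA [(_ *m _ + _)^T]linearD /= [(- _)^T]linearN /= addrK.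
  by rewrite -mulmxA trmx_mul trmxK.
have G0 : G != 0.
  apply: contra J0 => /eqP G0; apply/eqP/row_matrixP => k; rewrite row0 -[row k J]vec_mxK.
  rewrite (_ : vec_mx _ = 0) ?linear0//; apply/matrixP => i j.
  have := GE (mxvec (delta_mx k j)); rewrite G0 mulmx0 /f mxvecK (bigD1 k)//= big1 => [|k' kk].
    rewrite addr0 => /rowP/(_ i); rewrite !mxE (bigD1 j)//= big1 => [|j' jj]; rewrite !mxE.
      by rewrite !eqxx mulr1 addr0 => <-.
    by rewrite (negPf jj) andbF mulr0.
  rewrite (_ : row k' (delta_mx k j) = 0) ?trmx0 ?mulmx0 ?trmx0//; apply/rowP => j'.
  by rewrite !mxE (negPf kk).
apply: contrapT => none; case/negP: G0; rewrite -[G]mul1mx -l1 mulmx_suml big_tnth big1// => i _.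
rewrite -mulmxA; have [->|sG] := eqVneq (sm_in (tnth (in_tuple l) i) *m G) 0; first by rewrite mulmx0.
exfalso; apply: none; exists i; apply: schur_iso sG => x xr.
by rewrite mulmxA -(sm_inP _ xr) -mulmxA Gi// mulmxA.
Qed.

End TensorReps.

(** * Multiplicity spaces from a family of irreducible pieces *)

Section Pieces.
Variables (K : numClosedFieldType) (g : lieAlgType K) (r : lieSubalg g).
Notation premod := (premodule (subvs_of r : lieAlgType K)).
Variables (M : premod) (Q : choiceType) (cq : Q -> irrep r).
Variables (psi : forall q, 'rV[K]_(idim (cq q)) -> M).
Hypotheses (modM : is_module M) (pl : forall q, linear (psi (q := q))).
Hypotheses (pc : forall q v, carrier M (psi (q := q) v)).
Hypothesis pa : forall q x v, action M x (psi (q := q) v) = psi (v *m imx (cq q) (vsval x)).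
Hypothesis psp : forall u, carrier M u -> exists l : seq {q : Q & 'rV[K]_(idim (cq q))},
  u = \sum_(p <- l) psi (tagged p).
Hypothesis pind : forall (s : seq Q) (v : forall q, 'rV[K]_(idim (cq q))), uniq s ->
  \sum_(q <- s) psi (v q) = 0 -> forall q, q \in s -> v q = 0.
Hypothesis pfin : forall c, finite_set [set q | irr_iso c (cq q)].

Lemma action_sum (I : Type) (l : seq I) (F : I -> M) x : (forall i, carrier M (F i)) ->
  action M x (\sum_(i <- l) F i) = \sum_(i <- l) action M x (F i) /\ carrier M (\sum_(i <- l) F i).
Proof.
have [[[M0 MD] _ _] ml _ _] := modM; move=> Fc.
have ml0 : action M x 0 = 0.
  by have := ml x (-1) 0 0 M0 M0; rewrite scaler0 addr0 scaleN1r addNr.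
elim: l => [|i l [IH1 IH2]]; first by rewrite !big_nil.
rewrite !big_cons; split; last by rewrite -[F i]scale1r; apply: MD.
by rewrite -[in LHS](scale1r (F i)) ml// scale1r IH1.
Qed.

(** The pieces isomorphic to a representative c form the finite list [fib c], whose length is the
    multiplicity. Fixed isomorphisms [f] from c to each of them turn the columns of a matrix into
    vectors of the successive pieces. *)
Lemma mdec_of_pieces : exists m (Phi : forall c, 'M[K]_(idim c, m c) -> M), on_classes m /\ mdec Phi.
Proof.
have [fib fibP] : exists fib : irrep r -> seq Q, forall c, uniq (fib c) /\
    forall q, q \in fib c <-> irr_class c = c /\ irr_iso c (cq q).
  have ex c : exists s : seq Q, uniq s /\ forall q, q \in s <-> irr_class c = c /\ irr_iso c (cq q).
    have [cc|cc] := pselect (irr_class c = c); last by exists [::]; split=> // q; split=> // -[].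
    have /finite_seqP[s sE] := pfin c; exists (undup s); rewrite undup_uniq; split=> // q.
    rewrite mem_undup; have : ([set` s] q <-> [set q | irr_iso c (cq q)] q)%classic by rewrite sE.
    by move=> /= [h1 h2]; split=> [/h1|[_ /h2]].
  by exists (fun c => sval (cid (ex c))) => c; apply: svalP (cid (ex c)).
have [f fP] : exists f : forall c q, 'M[K]_(idim c, idim (cq q)), forall c q, irr_iso c (cq q) ->
    intertwines (f c q) /\ exists f', f c q *m f' = 1%:M /\ f' *m f c q = 1%:M.
  have ex c q : exists F : 'M[K]_(idim c, idim (cq q)), irr_iso c (cq q) ->
      intertwines F /\ exists f', F *m f' = 1%:M /\ f' *m F = 1%:M.
    have [[F [F' [e1 e2 FF]]]|no] := pselect (irr_iso c (cq q)); last by exists 0.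
    by exists F => _; split=> //; exists F'.
  by exists (fun c q => sval (cid (ex c q))) => c q; apply: (svalP (cid (ex c q))).
pose qj c (j : 'I_(size (fib c))) := tnth (in_tuple (fib c)) j.
have qjP c (j : 'I_(size (fib c))) : irr_class c = c /\ irr_iso c (cq (qj c j)).
  by apply/(fibP c).2; apply: mem_tnth.
pose Phi c (A : 'M[K]_(idim c, size (fib c))) : M := \sum_j psi ((col j A)^T *m f c (qj c j)).
have Phil c : linear (Phi c).
  move=> a A A'; rewrite /Phi scaler_sumr -big_split; apply: eq_bigr => j _ /=.
  rewrite -pl; congr psi; rewrite [col j (_ + _)]linearP [(_ *: col _ _ + _)^T]linearP /=.
  by rewrite mulmxDl -scalemxAl.
have Phi0 c := linear_map0 (Phil c).
exists (fun c => size (fib c)), Phi; split.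
  move=> c; rewrite -has_predT => /hasP[q qf _]; have [[//]] := ((fibP c).2 q).1 qf.
split=> //.
- by move=> c A; have [_] := @action_sum _ (index_enum 'I_(size (fib c))) (fun j => psi ((col j A)^T *m f c (qj c j))) 0 (fun j => pc _).
- move=> c x A; have [-> _] := @action_sum _ (index_enum 'I_(size (fib c))) (fun j => psi ((col j A)^T *m f c (qj c j))) x (fun j => pc _).
  apply: eq_bigr => j _; rewrite pa; congr psi; have [_ /fP[FF _]] := qjP c j.
  have cE : (col j ((imx c (vsval x))^T *m A))^T = (col j A)^T *m imx c (vsval x).
    by rewrite colE -mulmxA -colE trmx_mul trmxK.
  by rewrite cE -!mulmxA FF// subvsP.
- pose rep u := exists s (A : forall c, 'M[K]_(idim c, size (fib c))), uniq s /\ u = \sum_(c <- s) Phi c (A c).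
  have rep0 : rep 0 by exists [::], (fun=> 0); rewrite big_nil.
  have repD u v : rep u -> rep v -> rep (u + v).
    move=> [s [A [us ->]]] [t [A' [ut ->]]]; exists (undup (s ++ t)).
    exists (fun c => (if c \in s then A c else 0) + (if c \in t then A' c else 0)).
    split; first exact: undup_uniq.
    rewrite (eq_bigr _ (fun c _ => linear_mapD (Phil c) _ _)) big_split /=.
    have wid w (B : forall c, 'M[K]_(idim c, size (fib c))) : uniq w -> {subset w <= undup (s ++ t)} ->
        \sum_(c <- w) Phi c (B c) = \sum_(c <- undup (s ++ t)) Phi c (if c \in w then B c else 0).
      move=> uw sw; rewrite [RHS](bigID (mem w)) /= [X in _ + X]big1 => [|c /negPf->]; last exact: Phi0.
      rewrite addr0 [RHS](eq_bigr (fun c => Phi c (B c))) => [|c ->//].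
      rewrite -[RHS]big_filter; apply: perm_big; apply: uniq_perm => //; first exact: filter_uniq (undup_uniq _).
      by move=> c; rewrite mem_filter andbC; case: (boolP (c \in w)) => [/sw->|]; rewrite ?andbF.
    by congr (_ + _); apply: wid => // c cs; rewrite mem_undup mem_cat cs ?orbT.
  have rep1 q v : rep (psi (q := q) v).
    pose c := irr_class (cq q).
    have : q \in fib c.
      by apply/(fibP c).2; split; [exact: irr_classK | apply/irr_iso_sym/irr_class_iso].
    move=> /(tnthP (in_tuple _))[j qE].
    suff gen (v' : 'rV[K]_(idim (cq (qj c j)))) : rep (psi v') by move: v; rewrite {}qE.
    have [_ /fP[_ [f' [_ f'f]]]] := qjP c j.
    exists [:: c], (dfwith (fun d => 0 : 'M[K]_(idim d, size (fib d))) ((v' *m f')^T *m delta_mx 0 j)).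
    split=> //; rewrite big_seq1 dfwith_in /Phi (bigD1 j)//= big1 => [|k kj].
      rewrite addr0; congr psi; rewrite colE -mulmxA mul_delta_mx.
      by rewrite (_ : delta_mx _ _ = 1%:M) ?mulmx1 ?trmxK -?mulmxA ?f'f ?mulmx1//; apply/matrixP => a b; rewrite !ord1 !mxE.
    by rewrite colE -mulmxA mul_delta_mx_0 1?eq_sym// mulmx0 trmx0 mul0mx (linear_map0 (@pl _)).
  by move=> u /psp[l ->]; elim/big_rec: _ => // p u' _; apply: repD.
move=> s A us e c cs.
pose vv c q : 'rV[K]_(idim (cq q)) :=
  if insub (index q (fib c)) is Some j then (col (j : 'I_(size (fib c))) (A c))^T *m f c q else 0.
have vvE d (j : 'I_(size (fib d))) : vv d (qj d j) = (col j (A d))^T *m f d (qj d j).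
  rewrite /vv (_ : index _ _ = j); first by rewrite (valK j).
  by rewrite /qj (tnth_nth (qj d j)) index_uniq//; case: (fibP d).
have clE d (j : 'I_(size (fib d))) : irr_class (cq (qj d j)) = d.
  by have [dd /irr_class_eq <-] := qjP d j.
have usq : uniq [seq qj d j | d <- s, j <- enum 'I_(size (fib d))].
  apply: allpairs_uniq_dep => [//|d _|]; first exact: enum_uniq.
  move=> [d j] [d' j'] _ _ /= ee; have dd : d = d' by rewrite -(clE d j) ee clE.
  subst d'; congr (Tagged _ _); apply: val_inj; have [ud _] := fibP d.
  have := congr1 (fun q => index q (fib d)) ee.
  by rewrite /qj !(tnth_nth (qj d j)) !index_uniq.
have := pind (v := fun q => vv (irr_class (cq q)) q) usq; rewrite big_allpairs_dep.
rewrite (eq_bigr (fun d => Phi d (A d))) => [/(_ e) z|d _]; last first.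
  by rewrite big_enum; apply: eq_bigr => j _; rewrite clE vvE.
apply/matrixP => i j; rewrite mxE.
have := z (qj c j); rewrite clE vvE => z'.
have : (col j (A c))^T *m f c (qj c j) = 0.
  by apply: z'; apply/allpairsPdep; exists c, j; rewrite mem_enum.
have [_ /fP[_ [f' [ff' _]]]] := qjP c j.
by move=> /(congr1 (mulmx^~ f')); rewrite mul0mx -mulmxA ff' mulmx1 => /rowP/(_ i); rewrite !mxE.
Qed.

End Pieces.

Record pieces (K : numClosedFieldType) (g : lieAlgType K) (r : {vspace g}) n
    (sg : g -> 'M[K]_n) (e : 'M[K]_n) := Pieces {
  pc_num : nat;
  pc_irr : 'I_pc_num -> irrep r;
  pc_in : forall j, 'M[K]_(idim (pc_irr j), n);
  pc_out : forall j, 'M[K]_(n, idim (pc_irr j));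
  pc_sum : \sum_j pc_out j *m pc_in j = e;
  pc_inK : forall j, pc_in j *m pc_out j = 1%:M;
  pc_inO : forall i j, i != j -> pc_in i *m pc_out j = 0;
  pc_inE : forall j, pc_in j *m e = pc_in j;
  pc_inA : forall j, {in r, forall x, pc_in j *m sg x = imx (pc_irr j) x *m pc_in j}
}.

Section IrrepPieces.
Variables (K : numClosedFieldType) (g : lieAlgType K) (r h : {vspace g}).
Hypotheses (clr : lie_closed r) (redr : reductive r) (carh : cartan_subalgebra r h).

Lemma irrep_pieces n (sg : {linear g -> 'M[K]_n}) (e : 'M[K]_n) : lie_rep r sg ->
  diagonalizable_center r sg -> e *m e = e -> {in r, forall x, e *m sg x = sg x *m e} ->
  inhabited (pieces r sg e).
Proof.
move=> sr dz ee ec; move: (idem_factor ee); move: (\rank e) => k [L [R [LR RL]]].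
have cR : {in r, forall x, L *m R *m sg x = sg x *m (L *m R)} by move=> x xr; rewrite LR ec.
have [||l [l1 lo]] := weyl clr redr carh (rho := mulmxr L \o (mulmx R \o sg)).
- exact: restrict_rep.
- move=> z zZ; have [l [l1 lz]] := dz z zZ; exists [seq (p.1, R *m p.2 *m L) | p <- l].
  rewrite big_map -mulmx_suml -mulmx_sumr l1 mulmx1 RL; split=> // _ /mapP[p pl ->] /=.
  have /lie_centerP[zr _] := zZ.
  have sE : L *m (R *m sg z *m L) = sg z *m L by rewrite [RHS](restrict_L RL (cR _ zr)).
  by rewrite -(mulmxA _ L) sE mulmxA -(mulmxA R) lz// -scalemxAr -scalemxAl.
pose t j := tnth (in_tuple l) j.
apply: inhabits; apply: (@Pieces _ _ _ _ _ _ (size l) (fun j => sm_irr (t j)) (fun j => sm_in (t j) *m R)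
  (fun j => L *m sm_out (t j))) => [|j|i j ij|j|j x xr].
- rewrite -[RHS]LR -[L in RHS]mulmx1 -l1 mulmx_sumr mulmx_suml [RHS]big_tnth.
  by apply: eq_bigr => j _; rewrite !mulmxA.
- by rewrite mulmxA -(mulmxA _ R) RL mulmx1 sm_inK.
- rewrite mulmxA -(mulmxA _ R) RL mulmx1.
  move/(pairwiseP (t i)): lo => lo.
  have tE (j' : 'I_(size l)) : t j' = nth (t i) l j' by apply: tnth_nth.
  have [lt|gt|/val_inj eq] := ltngtP i j; last by rewrite eq eqxx in ij.
    have /andP[/eqP + _] := lo i j (ltn_ord i) (ltn_ord j) lt.
    by rewrite -!tE.
  have /andP[_ /eqP] := lo j i (ltn_ord j) (ltn_ord i) gt.
  by rewrite -!tE.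
- by rewrite -LR mulmxA -(mulmxA _ R) RL mulmx1.
rewrite -mulmxA [in LHS](restrict_R RL (cR _ xr)).
have := sm_inP (t j) xr => /= e1.
by rewrite mulmxA -e1 !mulmxA.
Qed.

End IrrepPieces.

(** * Decomposition of the parity halves of a tensor product *)

Section TensorDecomposition.
Variables (K : numClosedFieldType) (g : lieAlgType K) (r : lieSubalg g) (h : {vspace g}).
Hypotheses (redr : reductive r) (carh : cartan_subalgebra r h).
Variables (V : lmodType K) (S : vectType K) (av : subvs_of r -> V -> V) (bS : subvs_of r -> S -> S).
Notation T := (tensor V S).
Variable act : subvs_of r -> T -> T.
Hypotheses (actl : forall x, linear (act x)).
Hypothesis act_tens : forall x v s, act x (tens v s) = tens (av x v) s + tens v (bS x s).
Hypotheses (bSl : forall x, linear (bS x)) (bSr : forall s, linear (bS ^~ s)).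
Hypothesis bSL : forall x y s, bS 'L[x, y] s = bS x (bS y s) - bS y (bS x s).
Variables (th : S -> S) (tsg : T -> T) (par : bool).
Hypotheses (thl : linear th) (thK : forall s, th (th s) = s) (th_act : forall x s, th (bS x s) = bS x (th s)).
Hypotheses (tsl : linear tsg) (tsg_tens : forall v s, tsg (tens v s) = tens v (th s)).
Hypothesis bSdiag : forall z, vsval z \in lie_center r -> forall w, exists l : seq (K * S),
  w = \sum_(p <- l) p.2 /\ forall p, p \in l -> bS z p.2 = p.1 *: p.2.
Hypothesis modV : semisimple_admissible (Premodule V av setT : premodule (subvs_of r : lieAlgType K)).
Definition parity_part : set T := fun t => tsg t = (-1) ^+ par *: t.
Hypothesis modT : is_module (Premodule T act parity_part : premodule (subvs_of r : lieAlgType K)).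

Notation d := (\dim {:S}).
Notation f := (fun i : 'I_d => (vbasis {:S})`_i).
Definition crow (s : S) : 'rV[K]_d := \row_j coord (vbasis {:S}) j s.
Definition opmx (L : S -> S) : 'M[K]_d := \matrix_j crow (L (f j)).

Lemma crow_linear : linear crow.
Proof. by move=> k s s'; apply/rowP => j; rewrite !mxE linearP. Qed.

Lemma crow_basis j : crow (f j) = delta_mx 0 j.
Proof.
apply/rowP => i; rewrite !mxE coord_free ?(basis_free (vbasisP _))//.
by rewrite [j == i]eq_sym eqxx.
Qed.

Lemma crow_inv (w : 'rV[K]_d) : exists s, crow s = w.
Proof.
exists (\sum_j w 0 j *: f j); rewrite (linear_map_sum crow_linear) [RHS]row_sum_delta.
by apply: eq_bigr => j _; rewrite (linear_mapZ crow_linear) crow_basis.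
Qed.

Lemma crow_opmx L s : linear L -> crow (L s) = crow s *m opmx L.
Proof.
move=> Ll; rewrite {1}(coord_vbasis (memvf s)) (linear_map_sum Ll) (linear_map_sum crow_linear).
rewrite mulmx_sum_row; apply: eq_bigr => j _.
by rewrite (linear_mapZ Ll) (linear_mapZ crow_linear) rowK mxE.
Qed.

Lemma opmx_ext (M N : 'M[K]_d) : (forall s, crow s *m M = crow s *m N) -> M = N.
Proof.
by move=> e; apply/row_matrixP => j; rewrite !rowE; have [s <-] := crow_inv (delta_mx 0 j).
Qed.

Lemma spin_rep : exists a : {linear g -> 'M[K]_d},
  [/\ forall x s, crow (bS x s) = crow s *m a (vsval x), lie_rep r a,
      forall x, opmx th *m a x = a x *m opmx th & {in lie_center r, forall z, eigen_list (a z)}].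
Proof.
have [a aE] : exists a : {linear g -> 'M[K]_d}, a =1 (fun x => opmx (bS (vsproj r x))).
  apply: mk_linear => k x y; apply: opmx_ext => s.
  rewrite mulmxDr -scalemxAr -!crow_opmx// linearP /=.
  by rewrite -crow_linear bSr.
have aS x s : crow (bS x s) = crow s *m a (vsval x) by rewrite aE vsvalK crow_opmx.
exists a; split=> //.
- move=> x y xr yr; apply: opmx_ext => s; rewrite mulmxBr !mulmxA -(vsprojK xr) -(vsprojK yr).
  rewrite -vsval_sub_lie -!aS -(linear_mapB crow_linear) -bSL.
  by [].
- move=> x; apply: opmx_ext => s; rewrite !mulmxA aE -crow_opmx// -!crow_opmx//.
  by rewrite th_act.
move=> z zZ; have /lie_centerP[zr _] := zZ; rewrite -(vsprojK zr).
have ex j : exists l : seq (K * S), f j = \sum_(p <- l) p.2 /\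
    forall p, p \in l -> bS (vsproj r z) p.2 = p.1 *: p.2.
  by apply: bSdiag; rewrite vsprojK.
pose l j := sval (cid (ex j)); have lP j := svalP (cid (ex j)).
exists (flatten [seq [seq (p.1, delta_mx j 0 *m crow p.2) | p <- l j] | j <- enum 'I_d]); split.
  rewrite big_flatten big_map big_enum /=.
  transitivity (\sum_j (delta_mx j j : 'M[K]_d)).
    apply: eq_bigr => j _; rewrite big_map /= -mulmx_sumr -(linear_map_sum crow_linear).
    by have [<- _] := lP j; rewrite crow_basis mul_delta_mx.
  apply/matrixP => i j; rewrite summxE !mxE (bigD1 i)//= big1 => [|k ki]; rewrite !mxE.
    by rewrite eqxx andTb addr0 eq_sym.
  by rewrite eq_sym (negPf ki).
move=> _ /flattenP[_ /mapP[j _ ->] /mapP[p pl ->]] /=.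
have [_ /(_ p pl) e] := lP j.
by rewrite -mulmxA -aS e (linear_mapZ crow_linear) scalemxAr.
Qed.

Lemma mx_tens_ind n (Q : 'M[K]_(n, d) -> Prop) : (Q 0) -> (forall A A', Q A -> Q A' -> Q (A + A')) ->
  (forall v s, Q (v^T *m crow s)) -> forall A, Q A.
Proof.
move=> Q0 QD Q1 A.
have -> : A = \sum_k (delta_mx 0 k : 'rV_n)^T *m row k A.
  apply/matrixP => i j; rewrite summxE (bigD1 i)//= big1 => [|k ki]; rewrite !mxE big_ord1 !mxE.
    by rewrite eqxx mul1r addr0.
  by rewrite [i == k]eq_sym (negPf ki) andbF mul0r.
elim/big_rec: _ => // k B _; apply: QD; have [s <-] := crow_inv (row k A); exact: Q1.
Qed.

Section Embedding.
Variables (n : nat) (phi : 'rV[K]_n -> V) (Y : subvs_of r -> 'M[K]_n).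
Hypotheses (phil : linear phi) (phiA : forall x v, av x (phi v) = phi (v *m Y x)).

(** Realizes the tensor product of one summand of V with S as a space of matrices, where the
    finite-dimensional theory applies. *)
Definition tens_emb (A : 'M[K]_(n, d)) : T := [ffun b => phi (col b A)^T].

Lemma tens_emb_linear : linear tens_emb.
Proof.
move=> k A A'; apply/ffunP => b; rewrite !ffunE -phil; congr phi.
by apply/rowP => i; rewrite !mxE.
Qed.

Lemma tens_emb_tens v s : tens_emb (v^T *m crow s) = tens (phi v) s.
Proof.
apply/ffunP => b; rewrite !ffunE -(linear_mapZ phil); congr phi.
by apply/rowP => i; rewrite !mxE big_ord1 !mxE mulrC.
Qed.

Lemma tens_emb_act (a : g -> 'M[K]_d) x A : (forall x s, crow (bS x s) = crow s *m a (vsval x)) ->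
  act x (tens_emb A) = tens_emb ((Y x)^T *m A + A *m a (vsval x)).
Proof.
move=> aS; elim/mx_tens_ind: A => [|A A' IH IH'|v s].
- by rewrite mulmx0 mul0mx addr0 (linear_map0 tens_emb_linear) (linear_map0 (actl x)).
- rewrite (linear_mapD tens_emb_linear) (linear_mapD (actl x)) IH IH' -(linear_mapD tens_emb_linear).
  by rewrite mulmxDr mulmxDl addrACA.
rewrite tens_emb_tens act_tens phiA (linear_mapD tens_emb_linear) -[in RHS]mulmxA -aS tens_emb_tens.
by rewrite mulmxA -trmx_mul tens_emb_tens.
Qed.

Lemma tens_emb_sign A : tsg (tens_emb A) = tens_emb (A *m opmx th).
Proof.
elim/mx_tens_ind: A => [|A A' IH IH'|v s].
- by rewrite mul0mx (linear_map0 tens_emb_linear) (linear_map0 tsl).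
- by rewrite (linear_mapD tens_emb_linear) (linear_mapD tsl) IH IH' -(linear_mapD tens_emb_linear) mulmxDl.
by rewrite tens_emb_tens tsg_tens -mulmxA -crow_opmx// tens_emb_tens.
Qed.

End Embedding.

Definition parity_mx : 'M[K]_d := 2%:R^-1 *: (1%:M + (-1) ^+ par *: opmx th).

Lemma opmx_th2 : opmx th *m opmx th = 1%:M.
Proof. by apply: opmx_ext => s; rewrite mulmxA -!crow_opmx// thK mulmx1. Qed.

Lemma parity_mx_sign : parity_mx *m opmx th = (-1) ^+ par *: parity_mx.
Proof.
rewrite /parity_mx -scalemxAl mulmxDl mul1mx -scalemxAl opmx_th2 scalerA [_ * 2%:R^-1]mulrC -scalerA.
by congr (_ *: _); rewrite scalerDr scalerA -expr2 sqrr_sign scale1r addrC.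
Qed.

Lemma parity_mx_idem : parity_mx *m parity_mx = parity_mx.
Proof.
rewrite {2}/parity_mx -scalemxAr mulmxDr mulmx1 -scalemxAr parity_mx_sign scalerA -expr2 sqrr_sign scale1r.
by rewrite -mulr2n -scaler_nat scalerA mulVf ?scale1r// pnatr_eq0.
Qed.

Lemma tens_parity_mdec : exists m (Phi : forall c, 'M[K]_(idim c, m c) -> T),
  on_classes m /\ mdec (M := Premodule T act parity_part) Phi.
Proof.
have [a [aS ar athC aeig]] := spin_rep.
have clr : lie_closed r := @lsubalgP _ _ r.
have [mV [I [F [[Fsub Fspan Find] Firr Ffin]]]] := modV.
have [cF cFP] : exists cF : forall i, {c : irrep r & 'rV[K]_(idim c) -> V},
    forall i, @row_model _ _ _ (submodule (F i)) (tag (cF i)) (tagged (cF i)).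
  have ex i : exists cf : {c : irrep r & 'rV[K]_(idim c) -> V},
      @row_model _ _ _ (submodule (F i)) (tag cf) (tagged cf).
    have mF : is_module (submodule (F i)).
      have [[sF cFi aF] [_ ml mr mL]] := (Fsub i, mV).
      split; [by split | | |].
      - by move=> x k u v uF vF; apply: ml.
      - by move=> u uF; apply: mr.
      by move=> x y u uF; apply: mL.
    have [ir fd] := Firr i; have [c [phi pP]] := row_model_exists mF ir fd.
    by exists (Tagged (fun c : irrep r => 'rV[K]_(idim c) -> V) phi).
  by exists (fun i => sval (cid (ex i))) => i; apply: svalP (cid (ex i)).
pose c i := tag (cF i); pose phi i : 'rV[K]_(idim (c i)) -> V := tagged (cF i).
have phil i : linear (phi i) by case: (cFP i).
have phii i : injective (phi i) by case: (cFP i).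
have phiF i : F i = range (phi i) by case: (cFP i).
have phiA i x v : av x (phi i v) = phi i (v *m imx (c i) (vsval x)).
  by have [_ _ _ H] := cFP i; apply: H.
pose Psi i := tens_emb (phi i); have Psil i : linear (Psi i) := tens_emb_linear (phil i).
have [sg sgP] : exists sg : forall i, {linear g -> 'M[K]_(idim (c i) * d)}, forall i,
    (forall x A, mxvec A *m sg i x = mxvec ((imx (c i) x)^T *m A + A *m a x)) /\ lie_rep r (sg i).
  exists (fun i => sval (cid (tensor_rep (irr_rep (c i)) ar))) => i.
  exact: (svalP (cid (tensor_rep (irr_rep (c i)) ar))).
have sgE i x A : mxvec A *m sg i x = mxvec ((imx (c i) x)^T *m A + A *m a x) by case: (sgP i).
have sgr i : lie_rep r (sg i) by case: (sgP i).
pose E i : 'M[K]_(idim (c i) * d) := lin_mulmxr parity_mx.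
have EE i A : mxvec A *m E i = mxvec (A *m parity_mx) by rewrite mul_vec_lin.
have row_ext n (M N : 'M[K]_(n * d)) : (forall A, mxvec A *m M = mxvec A *m N) -> M = N.
  by move=> e; apply/row_matrixP => j; rewrite !rowE -[delta_mx _ _]vec_mxK.
have parC x : parity_mx *m a x = a x *m parity_mx.
  by rewrite /parity_mx -scalemxAl -scalemxAr mulmxDl mulmxDr mul1mx mulmx1 -scalemxAl -scalemxAr athC.
have ex i : inhabited (pieces r (sg i) (E i)).
  apply: (irrep_pieces clr redr carh) => //.
  - exact: tensor_diag (sgE i) aeig.
  - by apply: row_ext => A; rewrite mulmxA !EE -mulmxA parity_mx_idem.
  by move=> x xr; apply: row_ext => A; rewrite !mulmxA EE !sgE EE mulmxDl -!mulmxA parC.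
have [io] : inhabited (forall i, pieces r (sg i) (E i)).
  by apply: inhabits => i; have : exists p : pieces r (sg i) (E i), True; [case: (ex i) => p; exists p | move=> /cid[]].
pose k i := pc_num (io i); pose cc i := pc_irr (p := io i).
pose inn i := pc_in (p := io i); pose out i := pc_out (p := io i).
pose Q := {i : I & 'I_(k i)}.
pose cq (q : Q) := cc (tag q) (tagged q).
pose psi (q : Q) (v : 'rV[K]_(idim (cq q))) := Psi (tag q) (vec_mx (v *m inn (tag q) (tagged q))).
apply: (@mdec_of_pieces _ _ _ (Premodule T act parity_part) Q cq psi) => //.
- move=> q x u v; rewrite /psi mulmxDl -scalemxAl [vec_mx (_ + _)]linearP; exact: Psil.
- move=> q v; rewrite /= /parity_part /psi /Psi tens_emb_sign//.
  have innE := pc_inE (p := io (tag q)).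
  have -> : vec_mx (v *m inn (tag q) (tagged q)) = vec_mx (v *m inn (tag q) (tagged q)) *m parity_mx.
    by apply: (can_inj mxvecK); rewrite -EE vec_mxK -mulmxA innE.
  by rewrite -mulmxA parity_mx_sign -scalemxAr (linear_mapZ (tens_emb_linear (phil _))).
- move=> q x v; rewrite /= /psi /Psi (tens_emb_act (phil _) (phiA _) _ _ aS); congr (tens_emb _ _).
  apply: (can_inj mxvecK); rewrite -sgE !vec_mxK -!mulmxA.
  by rewrite pc_inA ?subvsP.
- move=> t tP; pose rep u := exists l : seq {q : Q & 'rV[K]_(idim (cq q))}, u = \sum_(p <- l) psi _ (tagged p).
  have rep0 : rep 0 by exists [::]; rewrite big_nil.
  have repD u u' : rep u -> rep u' -> rep (u + u').
    by move=> [l ->] [l' ->]; exists (l ++ l'); rewrite big_cat.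
  have repE i A : rep (Psi i (A *m parity_mx)).
    exists [seq Tagged (fun q : Q => 'rV[K]_(idim (cq q)))
      ((mxvec A *m out i j) : 'rV[K]_(idim (cq (Tagged (fun i => 'I_(k i)) j)))) | j <- enum 'I_(k i)].
    rewrite big_map big_enum /= /psi /= -(linear_map_sum (Psil i)); congr (Psi i _).
    apply: (can_inj mxvecK); rewrite -EE linear_sum /=.
    transitivity (mxvec A *m \sum_j out i j *m inn i j); first by rewrite /out /inn pc_sum.
    rewrite mulmx_sumr; apply: eq_big => [j|j _]; first by rewrite inE.
    by rewrite vec_mxK mulmxA.
  have -> : t = 2%:R^-1 *: (t + (-1) ^+ par *: tsg t).
    rewrite tP scalerA -expr2 sqrr_sign scale1r -mulr2n -scaler_nat scalerA mulVf ?scale1r//.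
    by rewrite pnatr_eq0.
  pose eop u := 2%:R^-1 *: (u + (-1) ^+ par *: tsg u).
  have eopl : linear eop.
    move=> x u v; rewrite /eop tsl !scalerDr !scalerA !addrA.
    by rewrite [2%:R^-1 * x]mulrC [2%:R^-1 * _ * x]mulrC mulrA -!addrA; congr (_ + _); rewrite addrCA.
  rewrite -/(eop t) (tens_basis t) (linear_map_sum eopl).
  elim/big_rec: _ => // b u _ ru; apply: (repD) ru.
  have [s [w [wF ->]]] := Fspan (t b) Logic.I.
  rewrite tens_suml (linear_map_sum eopl); elim/big_rec: _ => // i u' _ ru'; apply: (repD) ru'.
  have := wF i; rewrite phiF => -[v _ <-].
  suff -> : eop (tens (phi i v) (vbasis {:S})`_b) = Psi i (v^T *m crow (vbasis {:S})`_b *m parity_mx) by [].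
  rewrite /eop tsg_tens -tensZr -tensDr -tensZr /Psi -mulmxA -(tens_emb_tens (phil i)); congr (tens_emb _ (_ *m _)).
  rewrite (linear_mapZ crow_linear) (linear_mapD crow_linear) (linear_mapZ crow_linear) crow_opmx//.
  by rewrite /parity_mx -scalemxAr mulmxDr mulmx1 -scalemxAr.
- move=> s v us s0 q qs.
  pose tg i (j : 'I_(k i)) : Q := Tagged (fun i => 'I_(k i)) j.
  pose Bv i : 'rV[K]_(idim (c i) * d) := \sum_(j < k i | tg i j \in s) (v (tg i j) : 'rV_(idim (cc i j))) *m inn i j.
  have sumB : \sum_(i <- undup (map tag s)) Psi i (vec_mx (Bv i)) = 0.
    rewrite -[RHS]s0.
    transitivity (\sum_(q <- [seq tg i j | i <- undup (map tag s), j <- enum 'I_(k i)] | q \in s) psi q (v q)).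
      rewrite [RHS]big_mkcond [RHS]big_allpairs_dep; apply: eq_bigr => i _; rewrite [RHS]big_enum /=.
      rewrite /Bv linear_sum (linear_map_sum (Psil i)) [LHS]big_mkcond; apply: eq_bigr => j _.
      by case: ifP.
    rewrite -[LHS]big_filter; apply: perm_big; apply: uniq_perm => //.
      apply: filter_uniq; apply: allpairs_uniq_dep => [|i _|]; rewrite ?undup_uniq ?enum_uniq//.
      by move=> [i j] [i' j'] _ _ /= e; have := congr1 tag e => /= ?; subst; move/eqP: e; rewrite eq_Tagged /= => /eqP->.
    move=> q'; rewrite mem_filter; case: (boolP (q' \in s)) => //= qs'.
    by apply/allpairsPdep; exists (tag q'), (tagged q'); rewrite mem_undup map_f// mem_enum; case: (q').
  have B0 : Bv (tag q) = 0.
    apply: (can_inj vec_mxK); rewrite linear0; apply/matrixP => x b.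
    (* Independence is read one coordinate of S at a time, where it is that of the summands [F i] of
       V. *)
    have sb : \sum_(i <- undup (map tag s)) phi i (col b (vec_mx (Bv i)))^T = 0.
      have e := congr1 (fun t : T => t b) sumB; rewrite /= sum_ffunE ffunE in e.
      by apply: etrans e; apply: eq_bigr => i _; rewrite ffunE.
    have := Find _ (fun i => phi i (col b (vec_mx (Bv i)))^T) (undup_uniq _) _ sb (tag q).
    rewrite mem_undup map_f// => H.
    have : phi (tag q) (col b (vec_mx (Bv (tag q))))^T = 0.
      by apply: H => // i; rewrite phiF; exists (col b (vec_mx (Bv i)))^T.
    rewrite -(linear_map0 (phil (tag q))) => /phii/rowP/(_ x); rewrite !mxE.
    by [].
  have inK := pc_inK (p := io (tag q)); have inO := pc_inO (p := io (tag q)).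
  have : Bv (tag q) *m out (tag q) (tagged q) = 0 by rewrite B0 mul0mx.
  rewrite /Bv mulmx_suml (bigD1 (tagged q))/=; last by rewrite /tg; case: (q) qs.
  rewrite big1 => [|j /andP[_ jq]]; last by rewrite -mulmxA inO// mulmx0.
  by rewrite addr0 -mulmxA inK mulmx1 /tg; case: (q).
move=> c0; have [a' [a'E ar']] := neg_tr_rep ar.
have [tau [tauE taur]] := tensor_rep (irr_rep c0) ar'.
have taud : diagonalizable_center r tau.
  by apply: (tensor_diag tauE) => z zZ; rewrite a'E; apply/eigen_list_neg_tr/aeig.
have tcr := weyl clr redr carh taur taud; have [l [l1 _]] := tcr.
(* [sq j] lists the summands of V of the type of the j-th summand of [tau]; they are finitely many
   by admissibility of V, applied to one of them if there is any. *)
have [sq sqP] : exists sq : 'I_(size l) -> seq I, forall j i, irr_iso (tnth (in_tuple l) j) (c i) -> i \in sq j.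
  have exs j : exists s : seq I, forall i, irr_iso (tnth (in_tuple l) j) (c i) -> i \in s.
    have [[i0 i0P]|none] := pselect (exists i0, irr_iso (tnth (in_tuple l) j) (c i0)); last first.
      by exists [::] => i iP; exfalso; apply: none; exists i.
    have /finite_seqP[s sE] := Ffin i0; exists s => i iP.
    suff : ([set` s] i)%classic by [].
    rewrite -sE /=; apply/(row_model_isoP (cFP i0) (cFP i)).
    exact: irr_iso_trans (irr_iso_sym i0P) iP.
  by exists (fun j => sval (cid (exs j))) => j; apply: svalP (cid (exs j)).
apply: (@sub_finite_set _ _ [set` [seq Tagged (fun i => 'I_(k i)) j | i <- flatten (map sq (enum 'I_(size l))), j <- enum 'I_(k i)]]%classic); last exact: finite_seq.
move=> q [F1 [F2 [e1 e2 FF]]] /=; have inK := pc_inK (p := io (tag q)); have inA := pc_inA (p := io (tag q)).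
have J0 : F1 *m inn (tag q) (tagged q) != 0.
  apply/eqP => J0; have : F1 *m inn (tag q) (tagged q) *m out (tag q) (tagged q) *m F2 = 0 by rewrite J0 !mul0mx.
  rewrite -(mulmxA F1) inK mulmx1 e1 => /eqP; rewrite -mxrank_eq0 mxrank1.
  by rewrite gtn_eqF// irr_gt0.
have [x xr|j jP] := contraction (sgE (tag q)) a'E tauE (J := F1 *m inn (tag q) (tagged q)) _ J0 tcr l1.
  by rewrite -mulmxA inA// mulmxA FF// mulmxA.
apply/allpairsPdep; exists (tag q), (tagged q); rewrite mem_enum; split=> //; last by case: (q).
by apply/flattenP; exists (sq j); [apply: map_f; rewrite mem_enum | apply: sqP].
Qed.

End TensorDecomposition.

(** * The index theorem *)

Lemma mdec_isomorphic_eq (K : numClosedFieldType) (g : lieAlgType K) (r : lieSubalg g)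
    (M N : premodule (subvs_of r : lieAlgType K)) m m'
    (Phi : forall c, 'M[K]_(idim c, m c) -> M) (Psi : forall c, 'M[K]_(idim c, m' c) -> N) :
  (forall c, m c = m' c) -> is_module M -> is_module N -> mdec Phi -> mdec Psi -> isomorphic M N.
Proof.
move=> e; have ee : m = m' by apply: functional_extensionality_dep.
by subst m'; apply: mdec_isomorphic.
Qed.

Section Main.
Variables (K : numClosedFieldType) (g : lieAlgType K) (B : {symmetric g}).
Variables (r : lieSubalg g) (h : {vspace g}) (P : seq 'Hom(subvs_of h, K^o)).
Variables (U : envelopingAlg g) (C : cliffordAlg (@rperp_form _ _ B r)).
Variables (S : exteriorAlg (subvs_of (splus P r))).
Variables (alpha : {linear subvs_of r -> C}) (cS : algModule C S).
Variables (b d : 'I_(\dim (rperp B r)) -> subvs_of (rperp B r)).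
Variables (V : lmodType K) (piV : g -> V -> V) (uV : algModule U V).
Hypotheses (redg : reductive {:g}) (invB : invariant_form B) (ndB : nondegenerate B).
Hypotheses (redr : reductive r) (ndr : (r :&: orthov B r)%VS = 0%VS).
Hypotheses (carg : cartan_subalgebra {:g} h) (carr : cartan_subalgebra r h).
Hypotheses (posP : positive_system P) (bdP : dual_bases b d) (alphaP : is_alpha alpha).
Hypotheses (spinP : is_spin_module cS) (modV : gr_module r piV uV).
Variables (th : {lrmorphism S -> S}) (thP : is_sign th).
Notation T := (tensor V S).
Notation act := (diag_act uV cS alpha).
Notation D := (tensor_act uV cS (dirac U C b d)).
Notation premod := (premodule (subvs_of r : lieAlgType K)).
Notation Tp p := (parity_part (tsign (V := V) th) p).

Lemma tens_sub_parity p : tens_sub (ext_parity S p) = Tp p.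
Proof. by apply/funext => t; apply/propext; apply: tens_sub_sign. Qed.

Lemma parity_module p : is_module (Premodule T act (Tp p) : premod).
Proof.
have tl := tsign_linear (V := V) th.
split.
- split=> //.
  + split=> [|a u v uP vP] /=; first by rewrite /parity_part (linear_map0 tl) scaler0.
    by rewrite /parity_part tl uP vP scalerDr !scalerA [a * _]mulrC.
  + move=> x t /= tP; rewrite /parity_part.
    rewrite (tsign_diag redg invB ndB ndr carg carr posP alphaP spinP uV thP) tP.
    exact: (linear_mapZ (diag_linear alpha cS uV x)).
- by move=> x a u v _ _; apply: diag_linear.
- by move=> u _ a x y; apply: diag_linearl.
by move=> x y u _; apply: diag_lie.
Qed.

Lemma parity_mdec p : exists m (Phi : forall c, 'M[K]_(idim c, m c) -> T),
  on_classes m /\ mdec (M := Premodule T act (Tp p)) Phi.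
Proof.
have [mV vE _ sV _] := modV; have [al _ _] := alphaP.
apply: (@tens_parity_mdec _ _ _ _ redr carr _ _ (fun x => piV (vsval x)) (fun x => cS (alpha x))
  _ _ _ _ _ _ (th : S -> S) (tsign th) p).
- by move=> x; apply: diag_linear.
- by move=> x v s; rewrite diag_tens vE.
- by move=> x k s s'; apply: cSr.
- by move=> s k x y; rewrite linearP; apply: cSl.
- by move=> x y s; rewrite al cSBl !cSM.
- by move=> k s s'; rewrite linearP.
- exact: signK.
- move=> x s; apply/esym; exact: (alpha_sign redg invB ndB ndr carg carr posP alphaP spinP thP).
- exact: tsign_linear.
- exact: tsign_tens.
(* A central element of r normalizes h, hence lies in h, where the spin action is known to be
   diagonal. *)
- move=> z /lie_centerP[zr zc] w; apply: spin_alpha_diag => //.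
  have [_ _ _ H] := carr; apply: H => // y yh; rewrite lieC zc ?oppr0 ?mem0v//.
  by have [/subvP hr _ _ _] := carr; apply: hr.
- exact: sV.
exact: parity_module.
Qed.

Lemma parity_dirac p t : Tp p t -> Tp (~~ p) (D t).
Proof.
rewrite /parity_part => tP.
have Dl : linear D by move=> k u v; rewrite linearP.
rewrite (tsign_dirac redg invB ndB ndr carg carr posP b d spinP uV thP) tP.
rewrite (linear_mapZ Dl) -scaleNr.
by case: (p); rewrite ?expr0 ?expr1 ?opprK.
Qed.

Lemma parity_sum t : exists u v, [/\ Tp false u, Tp true v & t = u + v].
Proof.
have tl := tsign_linear (V := V) th.
exists (2%:R^-1 *: (t + tsign th t)), (2%:R^-1 *: (t - tsign th t)).
rewrite /parity_part !(linear_mapZ tl) (linear_mapD tl) (linear_mapB tl) !(tsignK thP) expr0 expr1 scale1r scaleN1r.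
split; first by rewrite addrC.
  by rewrite -scalerN opprB.
rewrite -scalerDr addrACA subrr addr0 -mulr2n -scaler_nat scalerA mulVf ?scale1r//.
by rewrite pnatr_eq0.
Qed.

Lemma parity_cap t : Tp false t -> Tp true t -> t = 0.
Proof.
rewrite /parity_part expr0 expr1 scale1r scaleN1r => -> /eqP.
by rewrite -addr_eq0 -mulr2n -scaler_nat scaler_eq0 pnatr_eq0 => /eqP.
Qed.

Lemma dirac_index_theorem :
  let VS parity := tensor_module uV cS alpha (ext_parity S parity) in
  let HV parity := dirac_cohomology uV cS alpha b d (ext_parity S parity) in
  [/\ semisimple_admissible (HV false), semisimple_admissible (HV true),
      semisimple_admissible (VS false), semisimple_admissible (VS true) &
      virtual_eq (HV false) (HV true) (VS false) (VS true)].
Proof.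
have [m0 [Phi [c0 MP]]] := parity_mdec false; have [m1 [Psi [c1 NP]]] := parity_mdec true.
pose D' : {linear T -> T} := D.
have Dact x t : D' (act x t) = act x (D' t) by apply: dirac_diag.
have D01 t : Tp false t -> Tp true (D' t) by apply: parity_dirac.
have D10 t : Tp true t -> Tp false (D' t) by apply: parity_dirac.
have mod0 := parity_module false; have mod1 := parity_module true.
have actl x : linear (act x) by apply: diag_linear.
have actr t : linear (act ^~ t) by apply: diag_linearl.
have actL x y t : act 'L[x, y] t = act x (act y t) - act y (act x t) by apply: diag_lie.
have [X DX] := mdec_map mod1 NP c1 MP c0 (f := D') (linearP D') D01 (fun x u _ => Dact x u).
have [Y DY] := mdec_map mod0 MP c0 NP c1 (f := D') (linearP D') D10 (fun x u _ => Dact x u).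
have sum' t : exists u v, [/\ Tp true u, Tp false v & t = u + v].
  by have [u [v [up vp ->]]] := parity_sum t; exists v, u; rewrite addrC.
have cap' t : Tp true t -> Tp false t -> t = 0 by move=> ? ?; apply: parity_cap.
have H0 := cohomology_mdec actl Dact mod0 D01 D10 parity_sum parity_cap MP NP DX DY.
have H1 := cohomology_mdec actl Dact mod1 D10 D01 sum' cap' NP MP DY DX.
have HM0 := cohomology_module actl actr actL Dact mod0.
have HM1 := cohomology_module actl actr actL Dact mod1.
have ch0 : on_classes (fun c => \sum_(k < maxn (m0 c) (m1 c)) dirac_mult (X c) (Y c) k)%N.
  move=> c; have [a0|/c0//] := posnP (m0 c); have [b0|/c1//] := posnP (m1 c).
  have z : maxn (m0 c) (m1 c) = 0%N by rewrite a0 b0.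
  by move: (X c) (Y c); rewrite z => ? ?; rewrite big_ord0.
have ch1 : on_classes (fun c => \sum_(k < maxn (m1 c) (m0 c)) dirac_mult (Y c) (X c) k)%N.
  move=> c; have [a0|/c0//] := posnP (m0 c); have [b0|/c1//] := posnP (m1 c).
  have z : maxn (m1 c) (m0 c) = 0%N by rewrite a0 b0.
  by move: (X c) (Y c); rewrite z => ? ?; rewrite big_ord0.
move=> VS HV; rewrite /VS /HV /tensor_module /dirac_cohomology !tens_sub_parity.
split.
- exact: mdec_semisimple HM0 H0 ch0.
- exact: mdec_semisimple HM1 H1 ch1.
- exact: mdec_semisimple mod0 MP c0.
- exact: mdec_semisimple mod1 NP c1.
(* The multiplicities of the two sides agree type by type as finite numbers, so the auxiliary
   summand can be taken to be 0. *)
exists (zero_module r); split; first by apply: mdec_semisimple (zero_moduleP r) (mdec_zero r) _ => c.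
apply: mdec_isomorphic_eq (mdec_dsum (mdec_dsum H0 NP) (mdec_zero r)) (mdec_dsum (mdec_dsum MP H1) (mdec_zero r)).
- move=> c; have := dirac_index (X c) (Y c) (leq_maxl (m0 c) (m1 c)) (leq_maxr _ _).
  by rewrite !addn0 [maxn (m1 c) _]maxnC => ->; rewrite addnC.
- exact: dsum_module (dsum_module HM0 mod1) (zero_moduleP r).
exact: dsum_module (dsum_module mod0 HM1) (zero_moduleP r).
Qed.

End Main.

Local Open Scope complex_scope.

Theorem theorem3p5 (R : realType) (g : lieAlgType R[i]) (B : {symmetric g})
    (r : lieSubalg g) (h : {vspace g}) (P : seq 'Hom(subvs_of h, R[i]^o))
    (U : envelopingAlg g) (C : cliffordAlg (@rperp_form _ _ B r))
    (S : exteriorAlg (subvs_of (splus P r)))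
    (alpha : {linear subvs_of r -> C}) (cS : algModule C S)
    (b d : 'I_(\dim (rperp B r)) -> subvs_of (rperp B r))
    (V : lmodType R[i]) (piV : g -> V -> V) (uV : algModule U V) :
  reductive {:g} -> invariant_form B -> nondegenerate B ->
  reductive r -> (r :&: orthov B r)%VS = 0%VS ->
  cartan_subalgebra {:g} h -> cartan_subalgebra r h -> positive_system P ->
  dual_bases b d -> is_alpha alpha -> is_spin_module cS ->
  gr_module r piV uV ->
  let VS parity := tensor_module uV cS alpha (ext_parity S parity) in
  let HV parity := dirac_cohomology uV cS alpha b d (ext_parity S parity) in
  [/\ semisimple_admissible (HV false), semisimple_admissible (HV true),
      semisimple_admissible (VS false), semisimple_admissible (VS true) &
      virtual_eq (HV false) (HV true) (VS false) (VS true)].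
Proof.
move=> redg invB ndB redr ndr carg carr posP bdP alphaP spinP modV.
have [th thP] := ext_sign_exists S.
exact: (dirac_index_theorem redg invB ndB redr ndr carg carr posP bdP alphaP spinP modV thP).
Qed.
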